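(* Let $(z_n)$ be a sequence of distinct complex numbers in $\mathbb{D}$. Let $\psi\colon [1,+\infty)\to \mathbb{R}_+$ be a nondecreasing unbounded function satisfying $\psi(2x)=O(\psi(x))$ as $x\to+\infty$, let $\rho^*=\rho^*[\psi]$ be its Pólya order, let $s\ge [\rho^*]+1$ be an integer, and let $P$ and $B_n$ be the canonical product with parameter $s$ and the associated functions described in the context. Assume that $$\exists C>0\ \ \forall z\in\mathbb{D}:\quad n_z\Bigl(\frac{1-|z|}{2}\Bigr)\le C\,\psi\Bigl(\frac{1}{1-|z|}\Bigr),$$ and that at least one of the following three conditions holds: (a) $\exists C>0\ \forall n\in\mathbb{N}:\quad N_{z_n}\Bigl(\frac{1-|z_n|}{2}\Bigr)\le C\,\tilde\psi\Bigl(\frac{1}{1-|z_n|}\Bigr)$; (b) $\exists C>0\ \forall n\in\mathbb{N}:\quad -\log\bigl((1-|z_n|)|P'(z_n)|\bigr)\le C\,\tilde\psi\Bigl(\frac{1}{1-|z_n|}\Bigr)$; (c) $\exists C>0\ \forall n\in\mathbb{N}:\quad -\log|B_n(z_n)|\le C\,\tilde\psi\Bigl(\frac{1}{1-|z_n|}\Bigr)$. Then there exists an analytic function $a$ in $\mathbb{D}$ satisfying $$\exists C>0\ \forall r\in(0,1):\quad \log M(r,a)\le C\,\tilde\psi\Bigl(\frac{1}{1-r}\Bigr)$$ such that the equation $f''+a(z)f=0$ possesses a solution $f$, analytic in $\mathbb{D}$, having zeros precisely at the points $z_k$, $k\in\mathbb{N}$.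
   Context: $\mathbb{D}=\{z\in\mathbb{C}:|z|<1\}$, and $[x]$ denotes the integer part of $x$. For $f$ analytic in $\mathbb{D}$ and $r\in(0,1)$, $M(r,f)=\max\{|f(z)|:|z|=r\}$. For the sequence $(z_k)$ and $\zeta\in\mathbb{D}$, $n_\zeta(t)=\sum_{|z_k-\zeta|\le t}1$ is the number of members of the sequence with $|z_k-\zeta|\le t$, and $$N_\zeta(r)=\int_0^r\frac{(n_\zeta(t)-1)^+}{t}\,dt,\qquad x^+=\max\{x,0\}.$$ For a nondecreasing $\psi\colon[1,+\infty)\to\mathbb{R}_+$, $\tilde\psi(x)=\int_1^x\frac{\psi(t)}{t}\,dt$. The Pólya order $\rho^*[\psi]$ is the number characterized by the condition that for every $\rho>\rho^*[\psi]$ one has $\psi(Cx)\le C^{\rho}\psi(x)$ for all sufficiently large $x$ and $C$ (i.e. as $x,C\to\infty$); that is, it is the infimum of all $\rho$ with this property. It is finite when $\psi(2x)=O(\psi(x))$ as $x\to+\infty$. The canonical product is $$P(z)=\prod_{n=1}^\infty E\Bigl(\frac{1-|z_n|^2}{1-\bar z_n z},s\Bigr),\qquad E(w,s)=(1-w)\exp\Bigl\{w+\frac{w^2}{2}+\dots+\frac{w^s}{s}\Bigr\},\quad s\in\mathbb{N}.$$ It is analytic in $\mathbb{D}$ with zero sequence $(z_n)$ provided $\sum_n(1-|z_n|)^{s+1}<\infty$. For each $n$, $$B_n(z)=P(z)\Big/E\Bigl(\frac{1-|z_n|^2}{1-\bar z_n z},s\Bigr),$$ that is, the product $P$ with its $n$-th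 factor removed. *)

(* Defs.v *)
From HB Require Import structures.
From mathcomp Require Import all_boot all_order all_algebra.
From mathcomp Require Import complex.
From mathcomp Require Import all_classical all_reals all_analysis.

Set Implicit Arguments.
Unset Strict Implicit.
Unset Printing Implicit Defensive.

Import Order.TTheory GRing.Theory Num.Theory.
Import numFieldNormedType.Exports.
Import ComplexField.Normc.

Local Open Scope classical_set_scope.
Local Open Scope ring_scope.

Definition unit_disc (R : realType) : set R[i] := [set z | normc z < 1].
Arguments unit_disc {R}.

(* The topology and normed module structure over [R[i]] are carried by its copy
   [R[i]^o].  [derivable] over the field [R[i]] is complex differentiability, so on the
   open set [unit_disc] this is analyticity. *)
Definition analytic_in_disc (R : realType) (f : R[i]^o -> R[i]^o) : Prop :=
  forall z, unit_disc z -> derivable f z 1.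

(* The real exponential [expR] is not available over [R[i]]. *)
Definition cexp (R : realType) (w : R[i]) : R[i] :=
  (expR (complex.Re w))%:C%C
  * (cos (complex.Im w) +i* sin (complex.Im w))%C.

(* Extended-real valued, so that the supremum is meaningful without knowing
   beforehand that [f] is bounded on the circle; for continuous [f] it is a
   maximum. *)
Definition max_modulus (R : realType) (r : R) (f : R[i]^o -> R[i]^o) : \bar R :=
  ereal_sup [set (normc (f z))%:E | z in [set z | normc z = r]].

(* [counting] is [+oo] on infinite sets. *)
Definition disc_count (R : realType) (z : nat -> R[i]) (zeta : R[i]) (t : R)
    : \bar R :=
  counting [set k | normc (z k - zeta) <= t].

Definition disc_N (R : realType) (z : nat -> R[i]) (zeta : R[i]) (r : R)
    : \bar R :=
  (\int[lebesgue_measure]_(t in `]0%R, r])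
     (maxe (disc_count z zeta t - 1) 0 * (t^-1)%:E))%E.

Definition psi_tilde (R : realType) (psi : R -> R) (x : R) : \bar R :=
  (\int[lebesgue_measure]_(t in `[1%R, x]) (psi t / t)%:E)%E.

(* For [psi] nonnegative, nondecreasing and unbounded on [1, +oo) with
   [psi (2 * x) = O(psi x)], the set below is nonempty and bounded below by 0,
   so that the real infimum [inf] is the genuine one. *)
Definition polya_order (R : realType) (psi : R -> R) : R :=
  inf [set rho : R |
    \forall x & c \near +oo%R, psi (c * x) <= c `^ rho * psi x].

Definition primary_factor (R : realType) (s : nat) (w : R[i]) : R[i] :=
  (1 - w) * cexp (\sum_(1 <= j < s.+1) w ^+ j / j%:R).

Definition canonical_factor (R : realType) (z : nat -> R[i]) (s n : nat)
    (w : R[i]) : R[i] :=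
  primary_factor s ((1 - `|z n| ^+ 2) / (1 - (z n)^*%C * w)).

Definition canonical_product (R : realType) (z : nat -> R[i]) (s : nat)
    (w : R[i]^o) : R[i]^o :=
  lim ((fun m : nat => \prod_(k < m) canonical_factor z s k w : R[i]^o) @ \oo).

(* The quotient of [canonical_product z s] by its [n]-th factor is 0/0 at
   [z n]; omitting the factor from the product gives its value there. *)
Definition canonical_product_except (R : realType) (z : nat -> R[i]) (s n : nat)
    (w : R[i]^o) : R[i]^o :=
  lim ((fun m : nat => \prod_(k < m | k != n :> nat)
          canonical_factor z s k w : R[i]^o) @ \oo).

(* Main.v *)
Require Import Defs.
From HB Require Import structures.
From mathcomp Require Import all_boot all_order all_algebra.
From mathcomp Require Import complex ring lra zify.
From mathcomp Require Import all_classical all_reals all_analysis measurable_realfun.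

Set Implicit Arguments.
Unset Strict Implicit.
Unset Printing Implicit Defensive.

Import Order.TTheory GRing.Theory Num.Theory.
Import numFieldNormedType.Exports.
Import ComplexField.Normc.

Local Open Scope classical_set_scope.
Local Open Scope ring_scope.

(* If [f = P exp H] with [h = H'], then [f'' + a f = 0] for
   [a = - ((P'' + 2 P' h) / P + h' + h^2)], which is analytic as soon as
   [h (z n) = - P''(z n) / (2 P'(z n))] at every zero.  Each of the conditions (a), (b), (c)
   yields [|(1 - |z n|^2) P'(z n)| >= exp (- K L(z n))] with
   [L x = 1 + psi~ (1 / (1 - |x|))], so the prescribed values are at most [exp (K L(z n))].
   The density condition gives
   [sum_n |(1 - |z n|^2) / (1 - conj (z n) x)|^(s+1) <= K L(x)], by cutting the dyadic shells
   around the circle into cells of hyperbolically bounded size; this bounds [P], and makes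
   the interpolation series converge once its [n]-th term is damped by a power of the kernel
   proportional to [L(z n)].  The growth of [a] is then [exp (O (L))]; to remove the constant
   [1] in [L] one arranges [|a| <= 1] on a disc at whose boundary [psi~] is positive:
   if [psi 1 > 0] any small disc will do, and otherwise the points [z n] stay out of a larger
   disc, on which raising the genus of [P] makes [P - 1] and [h] small. *)

(** * Complex sequences, derivatives and the exponential *)

(** The condition on [s] enters through the shells: an exponent below [s] admissible for the Pólya
    order gives [psi (2^i x) <= A q^i (psi x + 1)] with [q < 2^s], and the shell at distance [2^-j]
    from the circle contributes [psi (2^(j+1)) (1 + 2^j (1 - |x|))^(-s)], one of the [s + 1] kernel
    powers being spent on the sum along the circle. The shells with [2^j] up to [1 / (1 - |x|)] add
    up to the logarithmic integral of [psi], so the bounds are in [psi~] rather than [psi]. Since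
    [psi] is unbounded, [log (1 / (1 - r)) = O (L)], and the powers of [1 - |x|] lost in Cauchy
    estimates disappear in [exp (O (L))]. The delicate term of [a] is the quotient by [P]. Outside
    the discs of radius [exp (- B L(z n))] about the zeros, the logarithmic derivatives of the
    factors are summed; inside such a disc the zero is divided out of numerator and denominator. As
    [B] depends on the constants of [P], the outer bound is proved for every [B]. A point [z n = 0]
    makes its canonical factor vanish identically. Conditions (b) and (c) exclude it; under (a) that
    factor is replaced by one with a simple zero. *)

Section ComplexNorm.
Variable R : realType.
Implicit Types x y z : R[i].

Lemma normc_real (a : R) : normc (a%:C)%C = `|a|.
Proof. by rewrite /normc /= expr0n addr0 sqrtr_sqr. Qed.

Lemma normcE' z : (normc z)%:C%C = `|z|.
Proof. by rewrite normc_def; case: z. Qed.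

Lemma normc_ge0 z : 0 <= normc z.
Proof. by case: z => a b; rewrite sqrtr_ge0. Qed.

Lemma normcX z n : normc (z ^+ n) = normc z ^+ n.
Proof. by elim: n => [|n IH]; rewrite ?expr0 ?normc1 // !exprS normcM IH. Qed.

Lemma normc_eq0 z : (normc z == 0) = (z == 0).
Proof. by apply/eqP/eqP => [/eq0_normc|->] //; rewrite normc0. Qed.

Lemma normc_gt0 z : (0 < normc z) = (z != 0).
Proof. by rewrite lt_def normc_eq0 normc_ge0 andbT. Qed.

Lemma normcB x y : normc (x - y) = normc (y - x).
Proof. by rewrite -normcN opprB. Qed.

Lemma le_normcB x y : normc (x - y) <= normc x + normc y.
Proof. by rewrite (le_trans (le_normcD _ _))// normcN. Qed.

Lemma le_normc_sub x y : normc x - normc y <= normc (x - y).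
Proof. by rewrite lerBlDr (le_trans _ (le_normcD _ _))// subrK. Qed.

Lemma le_normc_dist z x y : normc (x - y) <= normc (x - z) + normc (z - y).
Proof. by apply: le_trans (le_normcD _ _); rewrite addrA subrK. Qed.

Lemma le_normc_sum (I : Type) (r : seq I) (P : pred I) (F : I -> R[i]) :
  normc (\sum_(i <- r | P i) F i) <= \sum_(i <- r | P i) normc (F i).
Proof.
elim/big_ind2: _ => [|x1 x2 y1 y2 h1 h2|//]; first by rewrite normc0.
by rewrite (le_trans (le_normcD _ _))// lerD.
Qed.

Lemma normc_prod (I : Type) (r : seq I) (P : pred I) (F : I -> R[i]) :
  normc (\prod_(i <- r | P i) F i) = \prod_(i <- r | P i) normc (F i).
Proof. by apply: (big_morph _ (@normcM _)); exact: normc1. Qed.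

Lemma normc_conj z : normc z^*%C = normc z.
Proof. by case: z => a b; rewrite /normc /= sqrrN. Qed.

Lemma normc_nat n : normc (n%:R : R[i]) = n%:R.
Proof.
by rewrite -(rmorph_nat (real_complex R)) normc_real ger0_norm.
Qed.

Lemma sqr_normcE z : normc z ^+ 2 = (complex.Re z) ^+ 2 + (complex.Im z) ^+ 2.
Proof. by case: z => a b; rewrite sqr_sqrtr// addr_ge0 ?sqr_ge0. Qed.

Lemma normc_Re z : `|complex.Re z| <= normc z.
Proof.
by rewrite -(@ler_sqr R) ?nnegrE ?normc_ge0// sqr_normcE real_normK ?num_real// lerDl sqr_ge0.
Qed.

Lemma normc_Im z : `|complex.Im z| <= normc z.
Proof.
by rewrite -(@ler_sqr R) ?nnegrE ?normc_ge0// sqr_normcE real_normK ?num_real// lerDr sqr_ge0.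
Qed.

Lemma normc_ReIm z : normc z <= `|complex.Re z| + `|complex.Im z|.
Proof.
rewrite -(@ler_sqr R) ?nnegrE ?normc_ge0 ?addr_ge0// sqr_normcE sqrrD.
rewrite !real_normK ?num_real//.
by rewrite -subr_ge0 [X in 0 <= X](_ : _ = `|complex.Re z| * `|complex.Im z| *+ 2) ?mulrn_wge0 ?mulr_ge0//; ring.
Qed.

Lemma normc_conjM z : (normc z ^+ 2)%:C%C = z * z^*%C.
Proof.
case: z => a b; rewrite sqr_normcE /=.
by apply/eqP; rewrite eq_complex /=; apply/andP; split; apply/eqP; ring.
Qed.

End ComplexNorm.

Section Sequences.
Variable R : realType.
Implicit Types (b : nat -> R) (u : nat -> R[i]).

(** The norm of [R[i]] takes values in [R[i]], so limits are stated through the real modulus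
    [normc]. The bound is non-strict in order to pass to limits unchanged. *)
Definition tends u (l : R[i]) := forall e : R, 0 < e ->
  exists N, forall n, (N <= n)%N -> normc (u n - l) <= e.

Definition vanishes b := forall e : R, 0 < e ->
  exists N, forall n, (N <= n)%N -> b n <= e.

Lemma le_vanishing (a c : R) b :
  vanishes b -> (\forall n \near \oo, a <= c + b n) -> a <= c.
Proof.
move=> bv [N0 _ h]; apply/ler_addgt0Pl => e e0.
have [N hN] := bv _ e0.
rewrite (le_trans (h (maxn N N0) (leq_maxr _ _)))// addrC lerD2r.
exact: hN (leq_maxl _ _).
Qed.

Lemma vanishesZ b (c : R) : 0 <= c -> vanishes b -> vanishes (fun n => c * b n).
Proof.
move=> c0 bv e e0; have c1 : 0 < c + 1 by rewrite ltr_wpDl.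
have [N hN] := bv _ (divr_gt0 e0 c1); exists N => n /hN bn.
have [b0|b0] := leP (b n) 0; first by rewrite (le_trans _ (ltW e0))// mulr_ge0_le0.
rewrite (@le_trans _ _ ((c + 1) * b n)) ?ler_pM2r// ?lerDl//.
by rewrite mulrC -ler_pdivlMr.
Qed.

Lemma vanishesD b b' : vanishes b -> vanishes b' -> vanishes (b \+ b').
Proof.
move=> h h' e e0; have e2 : 0 < e / 2 by rewrite divr_gt0.
have [N hN] := h _ e2; have [N' hN'] := h' _ e2.
exists (maxn N N') => n; rewrite geq_max => /andP[/hN b1 /hN' b2] /=.
by rewrite [leRHS]splitr lerD.
Qed.

Lemma vanishes_le b b' : (\forall n \near \oo, b' n <= b n) -> vanishes b -> vanishes b'.
Proof.
move=> [N0 _ h] bv e /bv[N hN]; exists (maxn N0 N) => n; rewrite geq_max => /andP[n0 n1].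
by rewrite (le_trans (h _ n0)) ?hN.
Qed.

Lemma tends_unique u l l' : tends u l -> tends u l' -> l = l'.
Proof.
move=> ul ul'; apply/eqP; rewrite -subr_eq0 -normc_eq0 eq_le normc_ge0 andbT.
apply: (le_vanishing (vanishesD ul ul')); near=> n => /=.
by rewrite add0r (normcB (u n) l) le_normc_dist.
Unshelve. all: by end_near. Qed.

Lemma tends_cst l : tends (fun=> l) l.
Proof. by move=> e e0; exists 0%N => n _; rewrite subrr normc0 ltW. Qed.

Lemma tends_near u u' l : (\forall n \near \oo, u n = u' n) -> tends u l -> tends u' l.
Proof.
by move=> [N0 _ h]; apply: vanishes_le; exists N0 => // n /h ->.
Qed.

Lemma tendsD u u' l l' : tends u l -> tends u' l' -> tends (u \+ u') (l + l').
Proof.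
move=> h h'; apply: vanishes_le (vanishesD h h'); near=> n => /=.
by rewrite opprD addrACA le_normcD.
Unshelve. all: by end_near. Qed.

Lemma tends_le (M : R) u l :
  tends u l -> (\forall n \near \oo, normc (u n) <= M) -> normc l <= M.
Proof.
move=> ul h; apply: (le_vanishing ul); near=> n => /=.
rewrite -{1}(subrK (u n) l) (le_trans (le_normcD _ _))// addrC normcB lerD2r.
by near: n.
Unshelve. all: by end_near. Qed.

Lemma tends_ge (M : R) u l :
  tends u l -> (\forall n \near \oo, M <= normc (u n)) -> M <= normc l.
Proof.
move=> ul h; apply: (le_vanishing ul); near=> n => /=.
apply: (@le_trans _ _ (normc (u n))); first by near: n.
by rewrite -{1}(subrK l (u n)) (le_trans (le_normcD _ _))// [leLHS]addrC.
Unshelve. all: by end_near. Qed.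

Lemma tendsM u u' l l' : tends u l -> tends u' l' -> tends (u \* u') (l * l').
Proof.
move=> h h'.
have hK : \forall n \near \oo, normc (u' n) <= normc l' + 1.
  have [N hN] := h' _ ltr01; exists N => // n /hN.
  by rewrite -lerBlDl => /(le_trans _); apply; exact: le_normc_sub.
have K0 : 0 <= normc l' + 1 by rewrite addr_ge0 ?normc_ge0.
apply: vanishes_le (vanishesD (vanishesZ K0 h) (vanishesZ (normc_ge0 l) h')).
near=> n => /=.
have -> : u n * u' n - l * l' = (u n - l) * u' n + l * (u' n - l') by ring.
rewrite (le_trans (le_normcD _ _))// !normcM lerD2r mulrC ler_wpM2r ?normc_ge0//.
by near: n.
Unshelve. all: by end_near. Qed.

(** The partial sums increase to their supremum; [t m] is the distance still to cover. *)
Lemma vanishing_tail b : (forall k, 0 <= b k) ->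
  (exists B, forall m, \sum_(k < m) b k <= B) ->
  exists t : nat -> R, [/\ vanishes t, forall m, 0 <= t m &
    forall m n, (m <= n)%N -> \sum_(m <= k < n) b k <= t m].
Proof.
move=> b0 [B hB]; set S := fun m => \sum_(k < m) b k.
have Sle m n : (m <= n)%N -> S n = S m + \sum_(m <= k < n) b k.
  by move=> mn; rewrite /S -!(big_mkord xpredT) (big_cat_nat _ mn).
pose A := range S.
have hs : has_sup A by split; [exists (S 0%N), 0%N|exists B => _ [m _ <-]; exact: hB].
have up m : S m <= sup A by apply: ub_le_sup; [exact: hs.2|exists m].
exists (fun m => sup A - S m); split => [e e0|m|m n mn].
- have [_ [N _ <-] hN] := sup_adherent e0 hs; exists N => n Nn.
  rewrite lerBlDr -lerBlDl (le_trans (ltW hN))// (Sle _ _ Nn) lerDl.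
  by apply: sumr_ge0.
- by rewrite subr_ge0.
- by rewrite lerBrDl -Sle.
Qed.

(** Every [a m - t m] lies below every [a k + t k], so the supremum of the former is a limit that
    carries the rate [t]. *)
Lemma real_cauchy (a t : nat -> R) :
  (forall m n, (m <= n)%N -> `|a n - a m| <= t m) -> vanishes t ->
  exists l, forall m, `|l - a m| <= t m.
Proof.
move=> h tv; have t0 k : 0 <= t k by exact: le_trans (h k k _).
pose A := range (fun m => a m - t m).
have ub m : ubound A (a m + t m).
  move=> _ [k _ <-]; have [mk|/ltnW km] := leqP k m.
    by have := h _ _ mk; rewrite ler_distlC => /andP[_ ?]; rewrite lerBlDr; move: (t0 m); lra.
  have := t0 k.
  by have := h _ _ km; rewrite ler_distl => /andP[_ ?]; lra.
exists (sup A) => m; rewrite ler_distl; apply/andP; split.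
  by apply: ub_le_sup; [exists (a 0%N + t 0%N); exact: ub|exists m].
by apply: ge_sup; [exists (a 0%N - t 0%N), 0%N|exact: ub].
Qed.

Lemma complex_cauchy u (t : nat -> R) :
  (forall m n, (m <= n)%N -> normc (u n - u m) <= t m) -> vanishes t ->
  exists l, tends u l /\ forall m, normc (l - u m) <= t m.
Proof.
move=> h tv.
have [x hx] : exists l, forall m, `|l - complex.Re (u m)| <= t m.
  apply: real_cauchy tv => m n /h; apply: le_trans.
  by apply: le_trans (normc_Re _); case: (u n) (u m) => ? ? [? ?].
have [y hy] : exists l, forall m, `|l - complex.Im (u m)| <= t m.
  apply: real_cauchy tv => m n /h; apply: le_trans.
  by apply: le_trans (normc_Im _); case: (u n) (u m) => ? ? [? ?].
have h2 m : normc ((x +i* y)%C - u m) <= t m + t m.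
  rewrite (le_trans (normc_ReIm _))//; move: (hx m) (hy m).
  by case: (u m) => a b /= ? ?; exact: lerD.
exists (x +i* y)%C; split.
  apply: vanishes_le (vanishesD tv tv); near=> n => /=.
  by rewrite normcB.
(* Coordinates give only the rate [t m + t m]; going through [u n] with [n] large recovers [t m]. *)
move=> m; apply: (le_vanishing (vanishesD tv tv)); near=> n => /=.
rewrite (le_trans (le_normc_dist (u n) _ _))// [leLHS]addrC lerD//.
by apply: h; near: n; exists m.
Unshelve. all: by end_near. Qed.

End Sequences.

Section ComplexDerivative.
Variable R : realType.
Implicit Types (f g : R[i] -> R[i]) (z l : R[i]).

(** Differentiability in multiplicative form: no quotient occurs, [h = 0] is allowed, and all
    tolerances are real. *)
Definition cder f z l := forall e : R, 0 < e -> exists2 d : R, 0 < d &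
  forall h, normc h < d -> normc (f (z + h) - f z - l * h) <= e * normc h.

Lemma cder_derivable f z l : cder f z l ->
  derivable (f : R[i]^o -> R[i]^o) z 1 /\ derive1 (f : R[i]^o -> R[i]^o) z = l.
Proof.
move=> fl.
suff H : (fun h : R[i]^o => h^-1 *: ((f (h *: 1 + z) : R[i]^o) - f z)) @ 0^' --> (l : R[i]^o).
  split; first by apply/cvg_ex; exists l.
  by rewrite derive1E; exact: cvg_lim H.
apply/cvgrPdist_le => e e0.
(* Positivity in the order of [R[i]] forces the imaginary part to vanish, so the tolerance is
   real. *)
have [r eE] : exists r : R, e = (r%:C)%C.
  by case: e e0 => a b; rewrite ltcE /= => /andP[/eqP -> _]; exists a.
have Re0 : 0 < r by move: e0; rewrite eE ltcR.
have [d d0 hd] := fl _ Re0.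
have d0' : 0 < (d%:C)%C :> R[i] by rewrite ltcR.
near=> h.
have h0 : h != 0 by near: h; exact: nbhs_dnbhs_neq.
have hd' : normc h < d.
  have : `|h : R[i]^o| < (d%:C)%C by near: h; apply: dnbhs0_lt.
  by rewrite -normcE' ltcR.
have := hd _ hd'.
rewrite -[X in _ -> X <= _]normcE' {}eE lecR => hh.
have -> : l - h^-1 *: (f (h *: 1 + z) - f z) = - (h^-1 * (f (z + h) - f z - l * h)).
  by rewrite /GRing.scale /= mulr1 (addrC h); field.
rewrite normcN normcM normcV ler_pdivrMl ?normc_gt0//.
by rewrite (mulrC (normc h)).
Unshelve. all: by end_near. Qed.

Lemma cder_near f g z l (d : R) : 0 < d ->
  (forall h, normc h < d -> g (z + h) = f (z + h)) -> cder f z l -> cder g z l.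
Proof.
move=> d0 fg fl e /fl[d' d'0 h]; exists (Num.min d d') => [|k].
  by rewrite lt_min d0.
rewrite lt_min => /andP[kd kd']; rewrite fg// -{2}(addr0 z) fg ?normc0// addr0.
exact: h.
Qed.

Lemma cder_eq f z l l' : cder f z l -> l = l' -> cder f z l'.
Proof. by move=> ? <-. Qed.

Lemma cder_ext f g z l : f =1 g -> cder f z l -> cder g z l.
Proof. by move=> fg h; apply: (cder_near ltr01 _ h) => k _; rewrite fg. Qed.

Lemma cder_cst c z : cder (fun=> c) z 0.
Proof.
move=> e e0; exists 1 => // h _.
by rewrite subrr mul0r subrr normc0 mulr_ge0 ?normc_ge0 // ltW.
Qed.

Lemma cder_id z : cder id z 1.
Proof.
move=> e e0; exists 1 => // h _.
rewrite /= (_ : _ - _ = 0) ?normc0 ?mulr_ge0 ?normc_ge0 ?(ltW e0)//; ring.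
Qed.

Lemma cderD f g z l m : cder f z l -> cder g z m -> cder (fun x => f x + g x) z (l + m).
Proof.
move=> fl gm e e0; have e2 : 0 < e / 2 by rewrite divr_gt0.
have [d d0 hf] := fl _ e2; have [d' d'0 hg] := gm _ e2.
exists (Num.min d d') => [|h]; first by rewrite lt_min d0.
rewrite lt_min => /andP[/hf h1 /hg h2].
have -> : f (z + h) + g (z + h) - (f z + g z) - (l + m) * h =
  (f (z + h) - f z - l * h) + (g (z + h) - g z - m * h) by ring.
by rewrite (splitr e) mulrDl (le_trans (le_normcD _ _))// lerD.
Qed.

Lemma cder_lip f z l : cder f z l -> exists2 d : R, 0 < d &
  forall h, normc h < d -> normc (f (z + h) - f z) <= (normc l + 1) * normc h.
Proof.
move=> /(_ _ ltr01)[d d0 hd]; exists d => // h /hd.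
have -> : f (z + h) - f z = (f (z + h) - f z - l * h) + l * h by rewrite subrK.
rewrite addrK mulrDl mul1r => k; by rewrite (le_trans (le_normcD _ _))// normcM addrC lerD2l.
Qed.

Lemma cder_cont f z l : cder f z l -> forall e : R, 0 < e -> exists2 d : R, 0 < d &
  forall h, normc h < d -> normc (f (z + h) - f z) <= e.
Proof.
move=> /cder_lip[d d0 hd] e e0; have K0 : 0 < normc l + 1 by rewrite ltr_wpDl ?normc_ge0.
exists (Num.min d (e / (normc l + 1))) => [|h]; first by rewrite lt_min d0 divr_gt0.
rewrite lt_min => /andP[/hd h1]; rewrite ltr_pdivlMr// mulrC => /ltW; exact: le_trans.
Qed.

Lemma cderM f g z l m : cder f z l -> cder g z m ->
  cder (fun x => f x * g x) z (l * g z + f z * m).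
Proof.
move=> fl gm e e0.
pose K := normc (g z) + normc (f z) + (normc l + 1).
have K0 : 0 < K.
  by rewrite /K; have := normc_ge0 (g z); have := normc_ge0 (f z); have := normc_ge0 l; lra.
have eK : 0 < e / K by rewrite divr_gt0.
have [d1 d10 h1] := fl _ eK; have [d2 d20 h2] := gm _ eK.
have [d3 d30 h3] := cder_lip fl; have [d4 d40 h4] := cder_cont gm eK.
exists (Num.min (Num.min d1 d2) (Num.min d3 d4)) => [|h].
  by rewrite !lt_min d10 d20 d30.
rewrite !lt_min => /andP[/andP[/h1 k1 /h2 k2] /andP[/h3 k3 /h4 k4]].
have -> : f (z + h) * g (z + h) - f z * g z - (l * g z + f z * m) * h =
  (f (z + h) - f z - l * h) * g z + f z * (g (z + h) - g z - m * h) +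
  (f (z + h) - f z) * (g (z + h) - g z) by ring.
have -> : e * normc h = e / K * normc h * normc (g z) + normc (f z) * (e / K * normc h)
   + (normc l + 1) * normc h * (e / K).
  by rewrite /K; field; rewrite -/K; apply: lt0r_neq0.
rewrite (le_trans (le_normcD _ _))// lerD//; last by rewrite normcM ler_pM ?normc_ge0.
rewrite (le_trans (le_normcD _ _))// !normcM lerD//.
  by rewrite ler_wpM2r ?normc_ge0.
by rewrite ler_wpM2l ?normc_ge0.
Qed.

Lemma cderN f z l : cder f z l -> cder (fun x => - f x) z (- l).
Proof.
move=> fl e /fl[d d0 h]; exists d => // k /h.
by rewrite -normcN; congr (normc _ <= _); ring.
Qed.

Lemma cderB f g z l m : cder f z l -> cder g z m -> cder (fun x => f x - g x) z (l - m).
Proof. by move=> fl gm; apply: cderD => //; exact: cderN. Qed.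

Lemma cderZ f z l c : cder f z l -> cder (fun x => c * f x) z (c * l).
Proof.
by move=> fl; apply: cder_eq (cderM (cder_cst c z) fl) _; rewrite mul0r add0r.
Qed.

Lemma cderX f z l n : cder f z l ->
  cder (fun x => f x ^+ n) z (n%:R * f z ^+ n.-1 * l).
Proof.
move=> fl; elim: n => [|n IH].
  by rewrite !mul0r; apply: cder_ext (cder_cst 1 z) => x; rewrite expr0.
apply: cder_ext (cder_eq (cderM fl IH) _) => [x|]; first by rewrite exprS.
case: n {IH} => [|n]; first by rewrite !mul0r mulr0 addr0 expr0 !mulr1 mul1r.
by rewrite /= -[n.+2%:R]natr1 exprS; ring.
Qed.

Lemma cderV f z l : cder f z l -> f z != 0 ->
  cder (fun x => (f x)^-1) z (- l / f z ^+ 2).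
Proof.
move=> fl fz0 e e0; set a := normc (f z).
have a0 : 0 < a by rewrite normc_gt0.
(* Once [normc (f (z + h)) >= a / 2], the linear remainder of [f] costs [2 / a^2], and replacing
   [f (z + h)] by [f z] in the main term costs the second summand. *)
set K := 2 / a ^+ 2 + (normc l) * ((normc l + 1)) * (2 / a ^+ 3).
have a2 : 0 < 2 / a ^+ 2 by rewrite divr_gt0// exprn_gt0.
have a3 : 0 < 2 / a ^+ 3 by rewrite divr_gt0// exprn_gt0.
have K0 : 0 < K.
  by rewrite /K ltr_wpDr// mulr_ge0 ?(ltW a3)// mulr_ge0 ?addr_ge0 ?normc_ge0.
have eK : 0 < e / K by rewrite divr_gt0.
have ah : 0 < a / 2 by rewrite divr_gt0.
have [d1 d10 h1] := fl _ eK; have [d2 d20 h2] := cder_cont fl ah.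
have [d3 d30 h3] := cder_lip fl.
exists (Num.min (Num.min d1 d2) (Num.min d3 (e / K))) => [|h].
  by rewrite !lt_min d10 d20 d30.
rewrite !lt_min => /andP[/andP[/h1 k1 /h2 k2] /andP[/h3 k3 k4]].
have b : a / 2 <= normc (f (z + h)).
  have := le_normc_sub (f z) (f (z + h)); rewrite normcB => /le_trans/(_ k2).
  by rewrite -/a; lra.
have fh0 : f (z + h) != 0 by rewrite -normc_gt0 (lt_le_trans ah).
have ib : (normc (f (z + h)))^-1 <= 2 / a.
  by rewrite -[2 / a]invf_div lef_pV2 ?posrE// normc_gt0.
have -> : (f (z + h))^-1 - (f z)^-1 - - l / f z ^+ 2 * h =
  - ((f (z + h) - f z - l * h) * ((f (z + h))^-1 * (f z)^-1)) +
  l * h * (f (z + h) - f z) * ((f (z + h))^-1 * (f z)^-2).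
  by field; rewrite fz0 fh0.
rewrite (le_trans (le_normcD _ _))//.
have -> : e * normc h = e / K * normc h * (2 / a * a^-1) + normc l * normc h * ((normc l + 1) * (e / K)) * (2 / a * a ^- 2).
  rewrite -[X in X * _ = _](divfK (lt0r_neq0 K0)); move: (e / K) => E.
  by rewrite /K; field; rewrite lt0r_neq0.
apply: lerD; rewrite ?normcN !(normcM, normcV, normcX) -/a.
- by rewrite ler_pM// ?mulr_ge0 ?invr_ge0 ?normc_ge0// ?(ltW a0)// ler_wpM2r ?invr_ge0 ?(ltW a0).
- rewrite ler_pM ?mulr_ge0 ?invr_ge0 ?exprn_ge0 ?normc_ge0 ?(ltW a0)//; last first.
    by rewrite ler_wpM2r ?invr_ge0 ?exprn_ge0 ?(ltW a0).
  rewrite ler_wpM2l ?mulr_ge0 ?normc_ge0// (le_trans k3)// ler_wpM2l ?addr_ge0 ?normc_ge0//.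
  exact: ltW.
Qed.

Lemma cder_comp f g z l m : cder f z l -> cder g (f z) m ->
  cder (fun x => g (f x)) z (m * l).
Proof.
move=> fl gm e e0; pose K := normc l + 1 + normc m.
have K0 : 0 < K by rewrite /K; have := normc_ge0 l; have := normc_ge0 m; lra.
have eK : 0 < e / K by rewrite divr_gt0.
have [d1 d10 h1] := gm _ eK.
have [d2 d20 h2] := fl _ eK; have [d3 d30 h3] := cder_lip fl.
have l1 : 0 < normc l + 1 by rewrite ltr_wpDl ?normc_ge0.
exists (Num.min d2 (Num.min d3 (d1 / (normc l + 1)))) => [|h].
  by rewrite !lt_min d20 d30 divr_gt0.
rewrite !lt_min => /and3P[/h2 k2 /h3 k3]; rewrite ltr_pdivlMr// mulrC => k4.
have := h1 _ (le_lt_trans k3 k4); rewrite (addrC (f z)) subrK => k1.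
have -> : g (f (z + h)) - g (f z) - m * l * h =
  (g (f (z + h)) - g (f z) - m * (f (z + h) - f z)) + m * (f (z + h) - f z - l * h) by ring.
have -> : e * normc h = e / K * ((normc l + 1) * normc h) + normc m * (e / K * normc h).
  by rewrite /K; field; rewrite -/K lt0r_neq0.
rewrite (le_trans (le_normcD _ _))// lerD//.
  by rewrite (le_trans k1)// ler_wpM2l// ltW.
by rewrite normcM ler_wpM2l ?normc_ge0.
Qed.

Lemma cder_sum (F G : nat -> R[i] -> R[i]) z m :
  (forall k, (k < m)%N -> cder (F k) z (G k z)) ->
  cder (fun x => \sum_(k < m) F k x) z (\sum_(k < m) G k z).
Proof.
elim: m => [|m IH] h.
  by rewrite big_ord0; apply: cder_ext (cder_cst 0 z) => x; rewrite big_ord0.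
rewrite big_ord_recr; apply: cder_ext (cderD (IH _) (h m (ltnSn m))) => [x|k km].
  by rewrite big_ord_recr.
by apply: h; rewrite ltnS ltnW.
Qed.

Lemma cder_poly (p : {poly R[i]}) z : cder (horner p) z p^`().[z].
Proof.
elim/poly_ind: p => [|p c IH].
  by rewrite deriv0 horner0; apply: cder_ext (cder_cst 0 z) => x; rewrite horner0.
apply: cder_ext (cder_eq (cderD (cderM IH (cder_id z)) (cder_cst c z)) _) => [x|].
  by rewrite hornerMXaddC.
by rewrite derivD derivM derivX derivC !hornerE.
Qed.

Lemma cder_unique f z l m : cder f z l -> cder f z m -> l = m.
Proof. by move=> /cder_derivable[_ <-] /cder_derivable[_ <-]. Qed.

End ComplexDerivative.

Section MeanValue.
Variable R : realType.

Lemma rder_is_derive (f : R -> R) (t l : R) :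
  (forall e : R, 0 < e -> exists2 d : R, 0 < d &
    forall h, `|h| < d -> `|f (t + h) - f t - l * h| <= e * `|h|) ->
  is_derive t 1 f l.
Proof.
move=> fl.
suff H : (fun h : R => h^-1 *: (f (h *: 1 + t) - f t)) @ 0^' --> l.
  apply: DeriveDef; first by apply/cvg_ex; exists l.
  exact: cvg_lim H.
apply/cvgrPdist_le => e e0.
have [d d0 hd] := fl _ e0.
near=> h.
have h0 : h != 0 by near: h; exact: nbhs_dnbhs_neq.
have hd' : `|h| < d by near: h; apply: dnbhs0_lt.
have hh := hd _ hd'.
have -> : l - h^-1 *: (f (h *: 1 + t) - f t) = - (h^-1 * (f (t + h) - f t - l * h)).
  by rewrite /GRing.scale /= mulr1 (addrC h); field.
by rewrite normrN normrM normfV ler_pdivrMl ?normr_gt0// (mulrC `|h|).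
Unshelve. all: by end_near. Qed.

(** There is no complex mean value theorem, so the values on the segment are projected on the
    direction of the increment [u]: the real one for [Re (conj u * f)] gives
    [|u|^2 <= |u| M |b|]. *)
Lemma mean_value_le (f f' : R[i] -> R[i]) (a b : R[i]) (M : R) :
  (forall t : R, 0 <= t <= 1 -> cder f (a + t%:C%C * b) (f' (a + t%:C%C * b))) ->
  (forall t : R, 0 <= t <= 1 -> normc (f' (a + t%:C%C * b)) <= M) ->
  normc (f (a + b) - f a) <= M * normc b.
Proof.
move=> df hM; set u := f (a + b) - f a.
have M0 : 0 <= M by apply: le_trans (hM 0 _); rewrite ?normc_ge0 ?lexx ?ler01.
have [->|u0] := eqVneq u 0; first by rewrite normc0 mulr_ge0 ?normc_ge0.
pose phi (t : R) := complex.Re (u^*%C * f (a + t%:C%C * b)).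
pose dphi (t : R) := complex.Re (u^*%C * (f' (a + t%:C%C * b) * b)).
have D (t : R) : 0 <= t <= 1 -> is_derive t 1 phi (dphi t).
  move=> /df ft; apply: rder_is_derive => e e0.
  have K0 : 0 < normc u * (normc b + 1).
    by rewrite mulr_gt0 ?normc_gt0// ltr_wpDl ?normc_ge0.
  have b1 : 0 < normc b + 1 by rewrite ltr_wpDl ?normc_ge0.
  have eK : 0 < e / (normc u * (normc b + 1)) by rewrite divr_gt0.
  have [d d0 hd] := ft _ eK; exists (d / (normc b + 1)) => [|h]; first by rewrite divr_gt0.
  rewrite ltr_pdivlMr// => hb.
  have hb' : normc (h%:C%C * b) < d.
    rewrite normcM normc_real (le_lt_trans _ hb)// ler_wpM2l// lerDl//.
  have := hd _ hb'.
  have -> : phi (t + h) - phi t - dphi t * h = complex.Re (u^*%C *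
     (f (a + t%:C%C * b + h%:C%C * b) - f (a + t%:C%C * b) - f' (a + t%:C%C * b) * (h%:C%C * b))).
    rewrite /phi /dphi (rmorphD (real_complex R)) mulrDl addrA.
    move: (f _) (f _) (f' _) => [? ?] [? ?] [? ?]; case: (u) (b) => [? ?] [? ?] /=.
    by ring.
  move=> H; rewrite (le_trans (normc_Re _))// normcM normc_conj.
  rewrite (le_trans (ler_wpM2l (normc_ge0 _) H))// normcM normc_real.
  rewrite [leLHS](_ : _ = (e * `|h|) * (normc b / (normc b + 1))).
    apply: ler_piMr; first by rewrite mulr_ge0// ltW.
    by rewrite ler_pdivrMr// mul1r lerDl.
  by field; rewrite !lt0r_neq0 ?normc_gt0.
have D1 (x : R) : x \in `]0, 1[%R -> is_derive x 1 phi (dphi x).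
  by rewrite in_itv /= => /andP[x0 x1]; apply: D; rewrite !ltW.
have C1 : {within `[0, 1], continuous phi}.
  apply: derivable_within_continuous => x; rewrite in_itv /= => x01.
  by have [] := D _ x01.
have [t] := MVT_segment ler01 D1 C1; rewrite in_itv /= => t01 E.
have E2 : normc u ^+ 2 = dphi t.
  move: E; rewrite subr0 mulr1 => <-; rewrite /phi rmorph0 rmorph1 mul0r addr0 mul1r.
  have -> (x y : R[i]) : complex.Re x - complex.Re y = complex.Re (x - y).
    by case: x y => ? ? [? ?].
  by rewrite -mulrBr -/u mulrC -normc_conjM.
have : normc u ^+ 2 <= normc u * (M * normc b).
  rewrite E2 (le_trans (ler_norm _))// (le_trans (normc_Re _))// normcM normc_conj.
  by rewrite ler_wpM2l ?normc_ge0// normcM ler_wpM2r ?normc_ge0// hM// !ltW.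
by rewrite expr2 ler_pM2l// normc_gt0.
Qed.
End MeanValue.

Section ComplexExp.
Variable R : realType.
Implicit Types w x y z : R[i].

Lemma cexpD x y : cexp (x + y) = cexp x * cexp y.
Proof.
case: x y => a b [c d]; rewrite /cexp /= expRD cosD sinD.
by apply/eqP; rewrite eq_complex /=; apply/andP; split; apply/eqP; ring.
Qed.

Lemma normc_cexp w : normc (cexp w) = expR (complex.Re w).
Proof.
rewrite normcM normc_real ger0_norm ?expR_ge0//.
rewrite [X in _ * X](_ : _ = 1) ?mulr1//.
by rewrite /normc cos2Dsin2 sqrtr1.
Qed.

Lemma cexp0 : cexp (0 : R[i]) = 1.
Proof.
by rewrite /cexp /= expR0 cos0 sin0 mul1r.
Qed.

Lemma cexp_neq0 w : cexp w != 0.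
Proof. by rewrite -normc_gt0 normc_cexp expR_gt0. Qed.

Lemma cexpMn w n : cexp (n%:R * w) = cexp w ^+ n.
Proof.
elim: n => [|n IH]; first by rewrite mul0r cexp0 expr0.
by rewrite -natr1 mulrDl mul1r cexpD IH exprSr.
Qed.

Lemma le_normc_cexp w : normc (cexp w) <= expR (normc w).
Proof. by rewrite normc_cexp ler_expR (le_trans (ler_norm _))// normc_Re. Qed.

Lemma ge_normc_cexp w : expR (- normc w) <= normc (cexp w).
Proof. by rewrite normc_cexp ler_expR lerNl (le_trans (ler_norm _))// normrN normc_Re. Qed.

Lemma abs_sin_le (x : R) : `|sin x| <= `|x|.
Proof.
wlog x0 : x / 0 <= x => [H|].
  have [/H//|/ltW x0] := leP 0 x.
  by have := H (- x); rewrite sinN !normrN oppr_ge0; apply.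
have D1 (y : R) : y \in `]0, x[%R -> is_derive y 1 (@sin R) (cos y).
  by move=> _; exact: is_derive_sin.
have C1 : {within `[0, x], continuous (@sin R)}.
  by apply: continuous_subspaceT => y; exact: continuous_sin.
have [t _] := MVT_segment x0 D1 C1.
rewrite sin0 !subr0 => ->; rewrite normrM ler_piMl//.
by rewrite ler_norml cos_geN1 cos_le1.
Qed.

Lemma abs_cos_sub1_le (x : R) : `|cos x - 1| <= x ^+ 2.
Proof.
have -> : cos x - 1 = - 2 * sin (x / 2) ^+ 2.
  have {1}-> : x = x / 2 + x / 2 by rewrite -splitr.
  by rewrite cosD; have := cos2Dsin2 (x / 2); nra.
rewrite normrM normrN normrX.
have := abs_sin_le (x / 2); rewrite -(@ler_sqr R) ?nnegrE// => h.
have -> : `|2 : R| = 2 by rewrite ger0_norm.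
have h2 : `|x / 2| ^+ 2 = x ^+ 2 / 4 by rewrite real_normK ?num_real//; field.
by rewrite h2 in h; have := sqr_ge0 x; lra.
Qed.

Lemma abs_sin_sub_le (x : R) : `|x| <= 1 -> `|sin x - x| <= x ^+ 2.
Proof.
wlog x0 : x / 0 <= x => [H|x1].
  have [/H//|/ltW x0] := leP 0 x.
  by have := H (- x); rewrite sinN sqrrN oppr_ge0 -opprD !normrN; apply.
have D1 (y : R) : y \in `]0, x[%R -> is_derive y 1 (fun y : R => sin y - y) (cos y - 1).
  by move=> _; apply: is_deriveB.
have C1 : {within `[0, x], continuous (fun y : R => sin y - y)}.
  by apply: continuous_subspaceT => y; apply: cvgB; [exact: continuous_sin|exact: cvg_id].
have [t] := MVT_segment x0 D1 C1.
rewrite in_itv /= => /andP[t0 tx]; rewrite sin0 !subr0 => ->.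
rewrite normrM (ger0_norm x0) expr2 ler_wpM2r// (le_trans (abs_cos_sub1_le _))//.
rewrite ger0_norm// in x1.
by rewrite expr2 (le_trans (ler_piMl t0 (le_trans tx x1))).
Qed.

(** From [expR (- x) >= 1 - x] one gets [expR x * (1 - x) <= 1], and [(1 + x + 2 x^2) (1 - x) >= 1]
    when [x <= 1/2]. *)
Lemma abs_expR_sub_le (x : R) : `|x| <= 2^-1 -> `|expR x - 1 - x| <= 2 * x ^+ 2.
Proof.
move=> x1; rewrite ger0_norm; last by rewrite -addrA -opprD subr_ge0 expR_ge1Dx.
have h := expR_ge1Dx (- x).
have x2 : x <= 2^-1 by rewrite (le_trans (ler_norm _)).
have p : 0 < expR (- x) by exact: expR_gt0.
have q : expR x * expR (- x) = 1 by rewrite -expRD subrr expR0.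
have x3 : 0 < 1 - x by lra.
have : expR x * (1 - x) <= 1 by rewrite -[leRHS]q ler_wpM2l ?expR_ge0.
move=> k; have : expR x * (1 - x) <= (1 + x + 2 * x ^+ 2) * (1 - x).
  apply: le_trans k _; have : 0 <= x ^+ 2 * (1 - 2 * x) by rewrite mulr_ge0 ?sqr_ge0//; lra.
  by nra.
by rewrite ler_pM2r//; lra.
Qed.

(** For [w = a + ib] the real part errs by at most [2 a^2 + 2 b^2] and the imaginary part by
    [2 b^2 + (2 a^2 + |a|) |b|]. Only the quadratic order matters, so the constant [10] is
    generous. *)
Lemma cexp_sub_le w : normc w <= 2^-1 -> normc (cexp w - 1 - w) <= 10 * normc w ^+ 2.
Proof.
case: w => a b; set w := (a +i* b)%C => w1.
have a1 : `|a| <= 2^-1 by apply: le_trans w1; exact: (normc_Re w).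
have b1 : `|b| <= 2^-1 by apply: le_trans w1; exact: (normc_Im w).
rewrite sqr_normcE (le_trans (normc_ReIm _))// /cexp /=.
rewrite !mul0r subr0 addr0 subr0.
set E := expR a.
have E2 : E <= 2.
  have := abs_expR_sub_le a1; rewrite ler_norml => /andP[_]; rewrite -/E.
  move: a1; rewrite ler_norml => /andP[? ?].
  have : a ^+ 2 <= 4^-1 by nra.
  by lra.
have E0 : 0 <= E by exact: expR_ge0.
have e1 : `|E * cos b - 1 - a| <= 2 * a ^+ 2 + 2 * b ^+ 2.
  have -> : E * cos b - 1 - a = (E - 1 - a) + E * (cos b - 1) by ring.
  rewrite (le_trans (ler_normD _ _))// lerD ?abs_expR_sub_le// normrM (ger0_norm E0).
  by rewrite ler_pM// abs_cos_sub1_le.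
have e2 : `|E * sin b - b| <= 2 * b ^+ 2 + (a ^+ 2 * 2 + `|a|) * `|b|.
  have -> : E * sin b - b = E * (sin b - b) + (E - 1) * b by ring.
  rewrite (le_trans (ler_normD _ _))// lerD ?normrM//.
    by rewrite (ger0_norm E0) ler_pM// abs_sin_sub_le// (le_trans b1)//; lra.
  rewrite ler_wpM2r// -(subrK a (E - 1)) (le_trans (ler_normD _ _))// lerD2r mulrC.
  exact: abs_expR_sub_le.
have -> : a ^+ 2 = `|a| ^+ 2 by rewrite real_normK ?num_real.
have -> : b ^+ 2 = `|b| ^+ 2 by rewrite real_normK ?num_real.
rewrite (le_trans (lerD e1 e2))//.
have -> : a ^+ 2 = `|a| ^+ 2 by rewrite real_normK ?num_real.
have -> : b ^+ 2 = `|b| ^+ 2 by rewrite real_normK ?num_real.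
move: a1 b1 (normr_ge0 a) (normr_ge0 b); move: `|a| `|b| => x y xh yh x0 y0.
have h1 : 0 <= x ^+ 2 * (2^-1 - y) by rewrite mulr_ge0 ?sqr_ge0// subr_ge0.
have h2 := sqr_ge0 (x - y).
have := sqr_ge0 x; have := sqr_ge0 y; move: h1 h2; clear; nra.
Qed.

Lemma cder_cexp z : cder (@cexp R) z (cexp z).
Proof.
move=> e e0; set K := 10 * normc (cexp z).
have K0 : 0 < K by rewrite mulr_gt0// normc_gt0 cexp_neq0.
exists (Num.min 2^-1 (e / K)) => [|h]; first by rewrite lt_min invr_gt0 ltr0n divr_gt0.
rewrite lt_min => /andP[/ltW h1 h2].
have -> : cexp (z + h) - cexp z - cexp z * h = cexp z * (cexp h - 1 - h).
  by rewrite cexpD; ring.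
rewrite normcM (le_trans (ler_wpM2l (normc_ge0 _) (cexp_sub_le h1)))//.
rewrite mulrA (mulrC _ 10) -/K expr2 mulrA ler_wpM2r ?normc_ge0//.
by rewrite mulrC -ler_pdivlMr// ltW.
Qed.

End ComplexExp.

(** * Analytic functions in the disc *)

Section CauchyEstimate.
Variable R : realType.
Local Notation C := R[i].

Definition unity_root (n : nat) : C := cexp (0 +i* (2 * pi / n%:R))%C.

Lemma unity_rootX n k : unity_root n ^+ k = cexp (0 +i* (k%:R * (2 * pi / n%:R)))%C.
Proof.
rewrite -cexpMn; congr cexp; rewrite -(rmorph_nat (real_complex R)).
by apply/eqP; rewrite eq_complex /=; apply/andP; split; apply/eqP; ring.
Qed.

Lemma normc_unity_root n : normc (unity_root n) = 1.
Proof. by rewrite normc_cexp /= expR0. Qed.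

Lemma unity_rootXn n : (0 < n)%N -> unity_root n ^+ n = 1.
Proof.
move=> n0; rewrite unity_rootX mulrC divfK ?pnatr_eq0 -?lt0n//.
by rewrite /cexp /= expR0 mulr_natl cos2pi sin2pi mul1r.
Qed.

Lemma unity_root_neq1 n k : (0 < k < n)%N -> unity_root n ^+ k != 1.
Proof.
move=> /andP[k0 kn]; rewrite unity_rootX; apply/eqP => /(congr1 (@complex.Re R)).
have n0 : 0 < n%:R :> R by rewrite ltr0n (ltn_trans k0).
rewrite /cexp /= expR0 mul1r mul0r subr0.
pose x : R := k%:R * pi / n%:R.
have -> : k%:R * (2 * pi / n%:R) = x + x.
  by rewrite /x; field; rewrite lt0r_neq0.
rewrite cosD; have := cos2Dsin2 x; suff : 0 < sin x by nra.
apply: sin_gt0_pi; rewrite /x divr_gt0 ?mulr_gt0 ?ltr0n ?(ltn_trans k0 kn) ?pi_gt0//=.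
by rewrite ltr_pdivrMr// mulrC ltr_pM2l ?pi_gt0// ltr_nat.
Qed.

Lemma unity_root_sum n k : (0 < k < n)%N -> \sum_(j < n) (unity_root n ^+ k) ^+ j = 0.
Proof.
move=> kn; have := subrX1 (unity_root n ^+ k) n.
rewrite -exprM mulnC exprM unity_rootXn ?expr1n ?subrr; last first.
  by case/andP: kn => /ltn_trans h /h.
move=> /esym/eqP; rewrite mulf_eq0 subr_eq0 (negPf (unity_root_neq1 kn)).
by move/eqP.
Qed.

(* The coefficient is the discrete Fourier average of the values on the circle. *)
Lemma coef_le_circle (p : {poly C}) (r M : R) n : 0 <= r ->
  (forall z, normc z = r -> normc p.[z] <= M) -> normc p`_n * r ^+ n <= M.
Proof.
move=> r0 hM.
have M0 : 0 <= M.
  by apply: le_trans (hM (r%:C)%C _); rewrite ?normc_ge0// normc_real ger0_norm.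
have [np|np] := leqP (size p) n; first by rewrite nth_default// normc0 mul0r.
set N := size p in np; pose w := unity_root N.
have N0 : (0 < N)%N by rewrite (leq_ltn_trans _ np).
have E : \sum_(j < N) p.[(r%:C)%C * w ^+ j] * (w ^+ (N - n)) ^+ j = N%:R * (p`_n * (r%:C)%C ^+ n).
  transitivity (\sum_(j < N) \sum_(m < N) p`_m * (r%:C)%C ^+ m * (w ^+ (m + (N - n))) ^+ j).
    apply: eq_bigr => j _; rewrite horner_coef mulr_suml; apply: eq_bigr => m _.
    by rewrite exprMn -!exprM mulnDl exprD !mulrA (mulnC j).
  rewrite exchange_big /= (bigD1 (Ordinal np)) //= [X in _ + X]big1 ?addr0.
    rewrite subnKC ?(ltnW np)// (eq_bigr (fun=> p`_n * (r%:C)%C ^+ n)).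
      by rewrite sumr_const card_ord mulr_natl.
    by move=> j _; rewrite /w unity_rootXn// expr1n mulr1.
  move=> m mn; rewrite -mulr_sumr; suff -> : \sum_(i < N) (w ^+ (m + (N - n))) ^+ i = 0.
    by rewrite mulr0.
  have {}mn : (m != n :> nat) by apply: contra mn => /eqP mn; apply/eqP/val_inj.
  have [h|h] := ltnP m n.
    apply: unity_root_sum; rewrite addn_gt0 subn_gt0 np orbT /=.
    by have := leq_trans (ltn_addl _ h) (leqnn _); lia.
  have -> : (m + (N - n) = (m - n) + N)%N by lia.
  rewrite exprD {1}/w unity_rootXn// mulr1; apply: unity_root_sum.
  by rewrite subn_gt0 ltn_neqAle eq_sym mn h/= (leq_ltn_trans (leq_subr _ _)).
have : normc (N%:R * (p`_n * (r%:C)%C ^+ n)) <= N%:R * M.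
  rewrite -E (le_trans (le_normc_sum _ _ _))//.
  rewrite [leRHS](_ : _ = \sum_(j < N) M); last by rewrite sumr_const card_ord mulr_natl.
  apply: ler_sum => j _; rewrite normcM !normcX normc_unity_root !expr1n mulr1.
  by apply: hM; rewrite normcM normcX normc_unity_root expr1n mulr1 normc_real ger0_norm.
rewrite !normcM normc_nat normcX normc_real ger0_norm// ler_pM2l//.
by rewrite ltr0n.
Qed.

Lemma geo_sum_le (q : R) n : 0 <= q < 1 -> \sum_(i < n) q ^+ i <= (1 - q)^-1.
Proof.
move=> /andP[q0 q1]; have h : 0 < 1 - q by rewrite subr_gt0.
rewrite -(ler_pM2l h) mulfV ?lt0r_neq0//.
by rewrite -[X in X * _]opprB mulNr -subrX1 opprB lerBlDr lerDl exprn_ge0.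
Qed.

(** A substitute for the maximum principle: the coefficient bounds are summed as a geometric series,
    at the price of the factor [r / (r - |z|)]. *)
Lemma poly_le_circle (p : {poly C}) (r M : R) z :
  (forall z, normc z = r -> normc p.[z] <= M) -> normc z < r ->
  normc p.[z] <= M * (r / (r - normc z)).
Proof.
move=> hM zr; have r0 : 0 < r by rewrite (le_lt_trans (normc_ge0 z)).
have M0 : 0 <= M.
  by apply: le_trans (hM (r%:C)%C _); rewrite ?normc_ge0// normc_real gtr0_norm.
rewrite horner_coef (le_trans (le_normc_sum _ _ _))//.
apply: (@le_trans _ _ (\sum_(i < size p) M * (normc z / r) ^+ i)).
  apply: ler_sum => i _; rewrite normcM normcX exprMn exprVn (mulrC (_ ^+ i) (_^-1)) mulrA.
  by rewrite ler_wpM2r ?exprn_ge0 ?normc_ge0// ler_pdivlMr ?exprn_gt0// coef_le_circle// ltW.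
rewrite -mulr_sumr ler_wpM2l// (le_trans (geo_sum_le _ _))//.
  by rewrite divr_ge0 ?normc_ge0 ?ltW//= ltr_pdivrMr// mul1r.
rewrite le_eqVlt; apply/orP; left; apply/eqP; field.
by rewrite subr_eq0 gt_eqF//= lt0r_neq0.
Qed.

(** The divided difference at [c], equal to [p'] at [c] itself. A single bound on it yields
    Lipschitz bounds, derivative bounds and division by a zero. *)
Definition divdiff (c : C) (p : {poly C}) : {poly C} := (p - p.[c]%:P) %/ ('X - c%:P).

Lemma divdiffE c (p : {poly C}) : p = divdiff c p * ('X - c%:P) + p.[c]%:P.
Proof.
rewrite /divdiff divpK ?subrK//.
by rewrite -[X in X %| _]expr1 dvdp_XsubCl rootE !hornerE subrr.
Qed.

Lemma divdiffB c (p q : {poly C}) : divdiff c (p - q) = divdiff c p - divdiff c q.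
Proof.
have X0 : 'X - c%:P != 0 by rewrite polyXsubC_eq0.
apply: (mulIf X0); rewrite mulrBl.
have h (u : {poly C}) : divdiff c u * ('X - c%:P) = u - u.[c]%:P.
  by rewrite {2}(divdiffE c u) addrK.
by rewrite !h !hornerE polyCB; ring.
Qed.

Lemma horner_divdiff c (p : {poly C}) z : p.[z] - p.[c] = (divdiff c p).[z] * (z - c).
Proof. by rewrite {1}(divdiffE c p) !hornerE /= addrK. Qed.

Lemma horner_divdiff_deriv c (p : {poly C}) : (divdiff c p).[c] = p^`().[c].
Proof.
by rewrite {2}(divdiffE c p) derivD derivM derivXsubC derivC !hornerE subrr mulr0 add0r.
Qed.

(** One factor [r' - r] comes from dividing by [w - c] on the circle of radius [r'], the other from
    moving inside it; [r' <= 1] absorbs the numerator. *)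
Lemma divdiff_le c (p : {poly C}) (r r' M : R) z : r < r' -> r' <= 1 ->
  (forall z, normc z <= r' -> normc p.[z] <= M) -> normc c <= r -> normc z <= r ->
  normc (divdiff c p).[z] <= 2 / (r' - r) ^+ 2 * M.
Proof.
move=> rr r1 hM cr zr; have d0 : 0 < r' - r by rewrite subr_gt0.
have r'0 : 0 <= r' by rewrite (le_trans (normc_ge0 c))// (le_trans cr)// ltW.
have M0 : 0 <= M by rewrite (le_trans (normc_ge0 p.[c]))// hM// (le_trans cr)// ltW.
have H : forall w, normc w = r' -> normc (divdiff c p).[w] <= 2 * M / (r' - r).
  move=> w wr; have wc : r' - r <= normc (w - c).
    by rewrite (le_trans _ (le_normc_sub _ _))// wr lerD2l lerN2.
  rewrite ler_pdivlMr//; apply: le_trans (ler_wpM2l (normc_ge0 _) wc) _.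
  rewrite -normcM -horner_divdiff (le_trans (le_normcB _ _))// mulr_natl mulr2n.
  by rewrite lerD// hM// ?wr// (le_trans cr)// ltW.
rewrite (le_trans (poly_le_circle H _)) ?(le_lt_trans zr)//.
have e0 : 0 < r' - normc z by rewrite subr_gt0 (le_lt_trans zr).
have -> : 2 / (r' - r) ^+ 2 * M = 2 * M / (r' - r) * (1 / (r' - r)).
  by field; rewrite lt0r_neq0.
rewrite ler_wpM2l ?divr_ge0 ?mulr_ge0 ?(ltW d0)// ler_pM ?invr_ge0 ?(ltW e0)//.
by rewrite lef_pV2 ?posrE// lerD2l lerN2.
Qed.

End CauchyEstimate.

Section AnalyticDisc.
Variable R : realType.
Local Notation C := R[i].
Implicit Types (f g : C -> C).

(* Analyticity in the unit disc is encoded as local uniform approximability by polynomials,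
   which avoids contour integration. *)
Definition anal f := forall r e : R, r < 1 -> 0 < e ->
  exists p : {poly C}, forall z, normc z <= r -> normc (f z - p.[z]) <= e.

Lemma anal_lim f : (forall r e : R, r < 1 -> 0 < e -> exists2 g, anal g &
  forall z, normc z <= r -> normc (f z - g z) <= e) -> anal f.
Proof.
move=> h r e r1 e0; have e2 : 0 < e / 2 by rewrite divr_gt0.
have [g ag fg] := h _ _ r1 e2; have [p gp] := ag _ _ r1 e2.
exists p => z zr; rewrite (le_trans (le_normc_dist (g z) _ _))// [leRHS]splitr lerD//.
  exact: fg.
exact: gp.
Qed.

Lemma anal_ext f g : (forall z, normc z < 1 -> f z = g z) -> anal f -> anal g.
Proof.
move=> fg af; apply: anal_lim => r e r1 e0; exists f => // z zr.
by rewrite fg ?subrr ?normc0 ?(ltW e0)// (le_lt_trans zr).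
Qed.

Lemma anal_poly (p : {poly C}) : anal (horner p).
Proof. by move=> r e r1 e0; exists p => z _; rewrite subrr normc0 ltW. Qed.

Lemma anal_cst c : anal (fun=> c).
Proof. by apply: anal_ext (anal_poly c%:P) => z _; rewrite hornerC. Qed.

Lemma anal_id : anal id.
Proof. by apply: anal_ext (anal_poly 'X) => z _; rewrite hornerX. Qed.

Lemma analD f g : anal f -> anal g -> anal (fun z => f z + g z).
Proof.
move=> af ag r e r1 e0; have e2 : 0 < e / 2 by rewrite divr_gt0.
have [p hp] := af _ _ r1 e2; have [q hq] := ag _ _ r1 e2.
exists (p + q) => z zr; rewrite hornerD opprD addrACA (le_trans (le_normcD _ _))//.
by rewrite [leRHS]splitr lerD ?hp ?hq.
Qed.

Lemma poly_bounded (p : {poly C}) (r : R) :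
  exists2 M : R, 0 <= M & forall z, normc z <= r -> normc p.[z] <= M.
Proof.
exists (\sum_(i < size p) normc p`_i * `|r| ^+ i).
  by apply: sumr_ge0 => i _; rewrite mulr_ge0 ?normc_ge0 ?exprn_ge0.
move=> z zr; rewrite horner_coef (le_trans (le_normc_sum _ _ _))//.
apply: ler_sum => i _; rewrite normcM normcX ler_wpM2l ?normc_ge0//.
by rewrite lerXn2r ?nnegrE ?normc_ge0// (le_trans zr)// ler_norm.
Qed.

Lemma anal_bounded f (r : R) : anal f -> r < 1 ->
  exists2 M : R, 0 <= M & forall z, normc z <= r -> normc (f z) <= M.
Proof.
move=> af r1; have [p hp] := af _ _ r1 ltr01; have [M M0 hM] := poly_bounded p r.
exists (1 + M) => [|z zr]; first by rewrite addr_ge0.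
by rewrite -(subrK p.[z] (f z)) (le_trans (le_normcD _ _))// lerD ?hp ?hM.
Qed.

Lemma analM f g : anal f -> anal g -> anal (fun z => f z * g z).
Proof.
move=> af ag r e r1 e0.
have [M M0 hM] := anal_bounded af r1; have [K K0 hK] := anal_bounded ag r1.
have MK : 0 < M + K + 1 by rewrite ltr_wpDl ?addr_ge0.
pose d := Num.min 1 (e / (M + K + 1)).
have d0 : 0 < d by rewrite lt_min ltr01 divr_gt0.
have [p hp] := af _ _ r1 d0; have [q hq] := ag _ _ r1 d0.
exists (p * q) => z zr; rewrite hornerM.
have -> : f z * g z - p.[z] * q.[z] = (f z - p.[z]) * g z + f z * (g z - q.[z])
  - (f z - p.[z]) * (g z - q.[z]) by ring.
apply: (@le_trans _ _ (d * K + M * d + d * 1)).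
  rewrite (le_trans (le_normcB _ _))// lerD//.
    rewrite (le_trans (le_normcD _ _))// lerD// normcM ler_pM ?normc_ge0 ?hp ?hK ?hM ?hq//.
  rewrite normcM ler_pM ?normc_ge0 ?hp//.
  by apply: le_trans (hq _ zr) _; rewrite ge_min lexx.
have -> : d * K + M * d + d * 1 = d * (M + K + 1) by ring.
by rewrite -ler_pdivlMr// ge_min lexx orbT.
Qed.

Lemma analN f : anal f -> anal (fun z => - f z).
Proof. by move=> af; apply: anal_ext (analM (anal_cst (-1)) af) => z _; rewrite mulN1r. Qed.

Lemma analB f g : anal f -> anal g -> anal (fun z => f z - g z).
Proof. by move=> af ag; apply: analD => //; exact: analN. Qed.

Lemma analX f n : anal f -> anal (fun z => f z ^+ n).
Proof.
move=> af; elim: n => [|n IH]; first by apply: anal_ext (anal_cst 1) => z _; rewrite expr0.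
by apply: anal_ext (analM af IH) => z _; rewrite exprS.
Qed.

Lemma anal_sum (I : Type) (s : seq I) (F : I -> C -> C) :
  (forall i, anal (F i)) -> anal (fun z => \sum_(i <- s) F i z).
Proof.
move=> h; elim: s => [|i s IH].
  by apply: anal_ext (anal_cst 0) => z _; rewrite big_nil.
by apply: anal_ext (analD (h i) IH) => z _; rewrite big_cons.
Qed.

Lemma anal_geo c : normc c <= 1 -> anal (fun z => (1 - c * z)^-1).
Proof.
move=> c1; apply: anal_lim => r e r1 e0.
have [r0|r0] := ltP r 0.
  by exists (fun=> 0) => [|z /le_lt_trans/(_ r0)]; [exact: anal_cst|rewrite ltNge normc_ge0].
have p : 0 < 1 - r by rewrite subr_gt0.
have pe : 0 < (1 - r) * e by rewrite mulr_gt0.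
have : (fun n => r ^+ n) @ \oo --> (0 : R) by apply: cvg_expr; rewrite ger0_norm.
move=> /cvgrPdist_lt/(_ _ pe)[N _ /(_ N (leqnn _))/=].
rewrite sub0r normrN ger0_norm ?exprn_ge0// => rN.
exists (fun z => \sum_(0 <= i < N) (c * z) ^+ i).
  by apply: anal_sum => i; apply: analX; apply: analM; [exact: anal_cst|exact: anal_id].
move=> z zr; have czr : normc (c * z) <= r.
  by rewrite normcM -[leRHS]mul1r ler_pM ?normc_ge0.
have c0 : 1 - r <= normc (1 - c * z).
  by rewrite (le_trans _ (le_normc_sub _ _))// normc1 lerD2l lerN2.
have cz0 : 1 - c * z != 0 by rewrite -normc_gt0 (lt_le_trans p).
rewrite big_mkord.
have -> : (1 - c * z)^-1 - \sum_(i < N) (c * z) ^+ i = (c * z) ^+ N / (1 - c * z).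
  apply: (mulIf cz0); rewrite divfK// mulrBl mulVf// mulrC -[1 - c * z]opprB mulNr -subrX1.
  by ring.
rewrite normcM normcX normcV ler_pdivrMr ?(lt_le_trans p)//.
apply: (@le_trans _ _ (r ^+ N)); first by rewrite lerXn2r ?nnegrE ?normc_ge0.
by rewrite (le_trans (ltW rN))// mulrC ler_wpM2l// ltW.
Qed.

Lemma normc_exprB (x y : C) (K : R) n : normc x <= K -> normc y <= K ->
  normc (x ^+ n - y ^+ n) <= n%:R * K ^+ n.-1 * normc (x - y).
Proof.
move=> xK yK; have K0 : 0 <= K by rewrite (le_trans (normc_ge0 x)).
rewrite subrXX normcM mulrC ler_wpM2r ?normc_ge0// (le_trans (le_normc_sum _ _ _))//.
rewrite (@le_trans _ _ (\sum_(i < n) K ^+ n.-1))//; last first.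
  by rewrite sumr_const card_ord mulr_natl.
apply: ler_sum => i _; rewrite normcM !normcX.
have -> : K ^+ n.-1 = K ^+ (n.-1 - i) * K ^+ i.
  by rewrite -exprD subnK// -ltnS prednK ?(leq_ltn_trans _ (ltn_ord i)).
by rewrite ler_pM ?exprn_ge0 ?normc_ge0// lerXn2r ?nnegrE ?normc_ge0// subn1.
Qed.

(* [cexp F] is the locally uniform limit of [(1 + F / n) ^ n]. *)
Lemma anal_cexp f : anal f -> anal (fun z => cexp (f z)).
Proof.
move=> af; apply: anal_lim => r e r1 e0.
have [M M0 hM] := anal_bounded af r1.
(* The term [2 * M] makes [f z / n] at most [1/2], as [cexp_sub_le] requires; the other makes the
   final error [10 M^2 exp M / n] at most [e]. *)
pose n := (Num.truncn (2 * M + 10 * M ^+ 2 * expR M / e)).+1.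
have n0 : 0 < n%:R :> R by rewrite ltr0n.
have nb : 2 * M + 10 * M ^+ 2 * expR M / e <= n%:R by apply/ltW/truncnS_gt.
have t0 : 0 <= 10 * M ^+ 2 * expR M / e.
  by rewrite !mulr_ge0 ?exprn_ge0 ?expR_ge0 ?invr_ge0 ?(ltW e0).
exists (fun z => (1 + n%:R^-1 * f z) ^+ n).
  apply: analX; apply: analD; first exact: anal_cst.
  by apply: analM => //; exact: anal_cst.
move=> z /hM fM; set w := n%:R^-1 * f z.
have nw : normc w = normc (f z) / n%:R by rewrite normcM normcV normc_nat mulrC.
have wM : normc w <= M / n%:R by rewrite nw ler_pM2r ?invr_gt0.
have w2 : normc w <= 2^-1 by rewrite (le_trans wM)// ler_pdivrMr//; lra.
have -> : cexp (f z) = cexp w ^+ n.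
  by rewrite -cexpMn /w mulVKf// -normc_gt0 normc_nat.
have h1 : normc (cexp w) <= expR (M / n%:R).
  by rewrite (le_trans (le_normc_cexp _))// ler_expR.
have h2 : normc (1 + w) <= expR (M / n%:R).
  rewrite (le_trans (le_normcD _ _))// normc1 (le_trans _ (expR_ge1Dx _))// lerD2l//.
rewrite (le_trans (normc_exprB n h1 h2))//.
apply: (@le_trans _ _ (n%:R * expR M * (10 * (M / n%:R) ^+ 2))).
  rewrite ler_pM ?mulr_ge0 ?ler0n ?exprn_ge0 ?expR_ge0 ?normc_ge0//.
    rewrite ler_wpM2l// -expRM_natl ler_expR mulrA ler_pdivrMr// mulrC ler_wpM2l//.
    by rewrite ler_nat leq_pred.
  rewrite opprD addrA (le_trans (cexp_sub_le w2))// ler_wpM2l// lerXn2r ?nnegrE ?normc_ge0//.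
  by rewrite divr_ge0.
have -> : n%:R * expR M * (10 * (M / n%:R) ^+ 2) = 10 * M ^+ 2 * expR M / n%:R.
  by field; rewrite lt0r_neq0.
rewrite ler_pdivrMr// (mulrC e) -ler_pdivrMr//; lra.
Qed.

End AnalyticDisc.

(** * Operators on polynomials extended to analytic functions; Cauchy estimates and series *)

Section Operators.
Variable R : realType.
Local Notation C := R[i].
Implicit Types (f g : C -> C).

(* The value at [f] of the continuous extension of [T] is [g]. *)
Definition image_by (T : {poly C} -> {poly C}) f g :=
  forall r e : R, r < 1 -> 0 < e -> exists r' d : R, [/\ r' < 1, 0 < d &
    forall p : {poly C}, (forall z, normc z <= r' -> normc (f z - p.[z]) <= d) ->
      forall z, normc z <= r -> normc (g z - (T p).[z]) <= e].

Lemma le_eps (a b K : R) : 0 <= K -> (forall e, 0 < e -> a <= b + K * e) -> a <= b.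
Proof.
move=> K0 h; apply/ler_addgt0Pr => e e0; have K1 : 0 < K + 1 by rewrite ltr_wpDl.
apply: le_trans (h _ (divr_gt0 e0 K1)) _; rewrite lerD2l mulrA ler_pdivrMr//.
by rewrite mulrC ler_wpM2l ?(ltW e0)// lerDl.
Qed.

(** An additive operator bounded from a larger disc to a smaller one maps locally uniform Cauchy
    sequences to such sequences, hence extends. It is applied to divided differences, derivatives
    and primitives. *)
Lemma anal_image (T : {poly C} -> {poly C}) f :
  (forall p q, T (p - q) = T p - T q) ->
  (forall r : R, r < 1 -> exists r' K : R, [/\ r' < 1, 0 <= K & forall (p : {poly C}) M,
     (forall z, normc z <= r' -> normc p.[z] <= M) ->
      forall z, normc z <= r -> normc (T p).[z] <= K * M]) ->
  anal f -> exists2 g, anal g & image_by T f g.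
Proof.
move=> TB TK af.
have e0 m : 0 < (m.+1%:R : R)^-1 by rewrite invr_gt0 ltr0n.
have r1 m : 1 - (m.+1%:R : R)^-1 < 1 by rewrite ltrBlDr ltrDl.
(* The error is [1 / (m + 1)] on the disc of radius [1 - 1 / (m + 1)], so this one sequence serves
   every smaller disc. *)
have [p hp] := choice (fun m => af _ _ (r1 m) (e0 m)).
have vK (K : R) : 0 <= K -> vanishes (fun m => K * (m.+1%:R : R)^-1).
  move=> K0; apply: (vanishesZ K0) => e ep; exists (Num.truncn e^-1) => n hn.
  rewrite invf_ple ?posrE ?ltr0n// ltW// (lt_le_trans (truncnS_gt _))//.
  by rewrite ler_nat.
have big (r : R) : r < 1 -> exists m0, forall m, (m0 <= m)%N -> r <= 1 - (m.+1%:R : R)^-1.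
  rewrite -subr_gt0 => /(vK 1 ler01)[m0 h].
  by exists m0 => m /h /=; rewrite mul1r lerBrDr addrC -lerBrDr.
have cau r : r < 1 -> exists m0 K, 0 <= K /\ forall m n z, (m0 <= m <= n)%N -> normc z <= r ->
    normc ((T (p n)).[z] - (T (p m)).[z]) <= K * (m.+1%:R : R)^-1.
  move=> rl; have [r' [K [r'1 K0 hK]]] := TK _ rl; have [m0 hm0] := big _ r'1.
  exists m0, (K * 2); split; first by rewrite mulr_ge0.
  move=> m n z /andP[mm0 mn] zr; rewrite -hornerN -hornerD -TB -mulrA; apply: hK zr => w wr.
  rewrite hornerD hornerN (le_trans (le_normc_dist (f w) _ _))// mulr_natl mulr2n.
  rewrite lerD//; last by rewrite hp// (le_trans wr)// hm0.
  rewrite normcB (@le_trans _ _ (n.+1%:R^-1))//; last by rewrite lef_pV2 ?posrE ?ltr0n// ler_nat.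
  by rewrite hp// (le_trans wr)// hm0// (leq_trans mm0).
have lims z : exists l, normc z < 1 -> forall r, normc z <= r -> r < 1 -> tends (fun m => (T (p m)).[z]) l.
  have [z1|z1] := ltP (normc z) 1; last by exists 0.
  have [m0 [K [K0 hK]]] := cau _ z1.
  have cz m n : (m <= n)%N -> normc ((T (p (n + m0)%N)).[z] - (T (p (m + m0)%N)).[z]) <= K * (m.+1%:R : R)^-1.
    have mm : (m0 <= m + m0 <= n + m0)%N -> _ := hK (m + m0)%N (n + m0)%N z ^~ (lexx _).
    move=> mn; apply: le_trans (mm _) _; first by rewrite leq_addl leq_add2r.
    by rewrite ler_wpM2l// lef_pV2 ?posrE ?ltr0n// ler_nat ltnS leq_addr.
  have [l [hl _]] := complex_cauchy cz (vK _ K0).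
  exists l => _ r _ _ e /hl[N hN]; exists (N + m0)%N => n nn.
  by have := hN (n - m0)%N; rewrite subnK ?(leq_trans (leq_addl N m0))//; apply; lia.
have [g hg] := choice lims.
have im : image_by T f g.
  move=> r e rl ep; have [r' [K [r'1 K0 hK]]] := TK _ rl.
  have [m0 [K' [K'0 hK']]] := cau _ rl; have [m1 hm1] := big _ r'1.
  have K1 : 0 < 2 * K + 2 by rewrite ltr_wpDl ?mulr_ge0.
  (* On the larger disc [q] and [p m] differ by at most [d + d], so the total error is
     [d + K (d + d) <= e]. *)
  pose d := e / (2 * K + 2); have d0 : 0 < d by rewrite divr_gt0.
  exists r', d; split => // q hq z zr.
  have [m2 hm2] := vK _ K'0 _ d0; have [m3 hm3] := vK _ ler01 _ d0.
  pose m := maxn (maxn m0 m1) (maxn m2 m3).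
  have gm : normc (g z - (T (p m)).[z]) <= d.
    rewrite normcB; apply: (@tends_le _ _ (fun n => (T (p m)).[z] - (T (p n)).[z])).
      apply: tendsD; first exact: tends_cst.
      move=> e' /(hg z (le_lt_trans zr rl) r zr rl)[N hN]; exists N => n /hN.
      by rewrite -normcN; congr (normc _ <= _); ring.
    exists m => // n mn; rewrite normcB (le_trans (hK' m n z _ zr))//.
      by rewrite mn /m !leq_max leqnn.
    by rewrite hm2// /m !leq_max leqnn !orbT.
  rewrite (le_trans (le_normc_dist (T (p m)).[z] _ _))//.
  rewrite (@le_trans _ _ (d + K * (d + d)))//; last first.
    have -> : d + K * (d + d) = d * (2 * K + 1) by ring.
    have -> : e = d * (2 * K + 2) by rewrite /d divfK ?lt0r_neq0.
    by rewrite ler_wpM2l ?(ltW d0)// lerD2l ler1n.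
  rewrite lerD// -hornerN -hornerD -TB; apply: hK zr => w wr.
  rewrite hornerD hornerN (le_trans (le_normc_dist (f w) _ _))// lerD ?hq//.
  rewrite normcB (le_trans (hp m w _))//; last first.
    by rewrite -[leLHS]mul1r hm3// /m !leq_max leqnn !orbT.
  by rewrite (le_trans wr)// hm1// /m !leq_max leqnn !orbT.
exists g => // r e rl /(im _ _ rl)[r' [d [r'1 d0 h]]].
have [q hq] := af _ _ r'1 d0; exists (T q); exact: h.
Qed.

(** One polynomial approximates [f] while its image approximates [g]; identities between [p] and
    [T p] thereby pass to [f] and [g]. *)
Lemma image_lim T f g r (e : R) z : anal f -> image_by T f g -> normc z <= r -> r < 1 -> 0 < e ->
  exists p : {poly C}, (forall w, normc w <= r -> normc (f w - p.[w]) <= e) /\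
    (forall w, normc w <= r -> normc (g w - (T p).[w]) <= e).
Proof.
move=> af im zr rl e0; have [r' [d [r'1 d0 h]]] := im _ _ rl e0.
have m1 : Num.max r r' < 1 by rewrite gt_max rl.
have d1 : 0 < Num.min d e by rewrite lt_min d0.
have [p hp] := af _ _ m1 d1; exists p; split => [w wr|].
  by rewrite (le_trans (hp w _))// ?ge_min ?lexx ?orbT// le_max wr.
by apply: h => w wr; rewrite (le_trans (hp w _))// ?ge_min ?lexx ?orbT// le_max wr orbT.
Qed.

Lemma divdiff_op_bound c (r : R) : normc c < 1 -> r < 1 ->
  exists r' K : R, [/\ r' < 1, 0 <= K & forall (p : {poly C}) M,
     (forall z, normc z <= r' -> normc p.[z] <= M) ->
      forall z, normc z <= r -> normc (divdiff c p).[z] <= K * M].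
Proof.
move=> c1 r1; pose r0 := Num.max r (normc c).
have r01 : r0 < 1 by rewrite gt_max r1.
exists ((1 + r0) / 2), (2 / ((1 + r0) / 2 - r0) ^+ 2).
have h : r0 < (1 + r0) / 2 by lra.
split; [lra|by rewrite divr_ge0 ?exprn_ge0// subr_ge0 ltW|].
move=> p M hM z zr; apply: divdiff_le h _ hM _ _; first lra.
  by rewrite le_max lexx orbT.
by rewrite le_max zr.
Qed.

Lemma anal_lipschitz f (r r' M : R) z c : anal f -> r < r' -> r' < 1 ->
  (forall z, normc z <= r' -> normc (f z) <= M) -> normc c <= r -> normc z <= r ->
  normc (f z - f c) <= 2 / (r' - r) ^+ 2 * M * normc (z - c).
Proof.
move=> af rr r1 hM cr zr; set K := 2 / _.
have K0 : 0 <= K by rewrite divr_ge0 ?exprn_ge0// subr_ge0 ltW.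
apply: (@le_eps _ _ (2 + K * normc (z - c))) => [|e e0].
  by rewrite addr_ge0// mulr_ge0// normc_ge0.
have [p hp] := af _ _ r1 e0.
have rr' := ltW rr.
have -> : f z - f c = (f z - p.[z]) + (p.[z] - p.[c]) - (f c - p.[c]) by ring.
rewrite (@le_trans _ _ (e + K * (M + e) * normc (z - c) + e))//; last first.
  by rewrite le_eqVlt; apply/orP; left; apply/eqP; ring.
rewrite (le_trans (le_normcB _ _))// lerD ?hp ?(le_trans cr)//.
rewrite (le_trans (le_normcD _ _))// lerD ?hp ?(le_trans zr)//.
rewrite horner_divdiff normcM ler_wpM2r ?normc_ge0//.
apply: (divdiff_le rr (ltW r1)) => // w wr.
by rewrite -(subrK (f w) p.[w]) (le_trans (le_normcD _ _))// addrC lerD ?hM// normcB hp.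
Qed.

Lemma cder_le f (K : R) z l : cder f z l ->
  (exists2 d : R, 0 < d & forall h, normc h < d -> normc (f (z + h) - f z) <= K * normc h) ->
  normc l <= K.
Proof.
move=> fl [d d0 hd]; apply: (@le_eps _ _ 1) => // e e0; rewrite mul1r.
have [d' d'0 hd'] := fl _ e0; pose t := Num.min d d' / 2.
have t0 : 0 < Num.min d d' by rewrite lt_min d0.
have tt : t < Num.min d d' by rewrite /t ltr_pdivrMr// mulr_natr mulr2n ltrDl.
have tp : 0 < t by rewrite divr_gt0.
have nt : normc (t%:C)%C = t by rewrite normc_real gtr0_norm.
have := tt; rewrite lt_min -nt => /andP[/hd h1 /hd' h2].
rewrite -(ler_pM2r tp) -{1}nt -normcM.
have -> : l * (t%:C)%C = (f (z + (t%:C)%C) - f z) - (f (z + (t%:C)%C) - f z - l * (t%:C)%C) by ring.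
by rewrite nt in h1 h2; rewrite (le_trans (le_normcB _ _))// mulrDl lerD.
Qed.

(** If [c] lies on the circle of radius [r], increments leave the disc, so the Lipschitz bound is
    taken on radii [t > r]; a limit then restores the constant with [r' - r]. *)
Lemma anal_cder_le f (r r' M : R) c l : anal f -> r < r' -> r' < 1 ->
  (forall z, normc z <= r' -> normc (f z) <= M) -> normc c <= r -> cder f c l ->
  normc l <= 2 / (r' - r) ^+ 2 * M.
Proof.
move=> af rr r1 hM cr fl.
pose s := (r + r') / 2.
have M0 : 0 <= M by rewrite (le_trans (normc_ge0 (f c)))// hM// (le_trans cr)// ltW.
pose F (t : R) : R := 2 / (r' - t) ^+ 2 * M.
suff H t : r < t < r' -> normc l <= F t.
  (* let t decrease to r *)
  have d0 : 0 < r' - r by rewrite subr_gt0.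
  have FE (k : R) : 0 < k < 1 -> normc l * (1 - k) ^+ 2 <= F r.
    move=> /andP[k0 k1]; have := H (r + k * (r' - r)).
    have k1' : 0 < 1 - k by rewrite subr_gt0.
    rewrite ltrDl mulr_gt0//= -ltrBrDl gtr_pMl// => /(_ k1).
    have -> : F (r + k * (r' - r)) = F r / (1 - k) ^+ 2.
      rewrite /F; have -> : r' - (r + k * (r' - r)) = (r' - r) * (1 - k) by ring.
      by field; rewrite !lt0r_neq0.
    by rewrite ler_pdivlMr ?exprn_gt0.
  rewrite -/(F r); apply: (@le_eps _ _ (2 * normc l)) => [|e e0]; first by rewrite mulr_ge0 ?normc_ge0.
  pose k := Num.min e 2^-1.
  have k01 : 0 < k < 1.
    by rewrite lt_min e0 invr_gt0 ltr0n/= gt_min invf_lt1 ?ltr0n// ltr1n orbT.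
  have ke : k <= e by rewrite ge_min lexx.
  have := FE k k01; move: k01 => /andP[k0 k1]; have := normc_ge0 l.
  move: (normc l) (F r) => L Fr L0 h; have : 0 <= L * (e - k) by rewrite mulr_ge0// subr_ge0.
  have : 0 <= L * k ^+ 2 by rewrite mulr_ge0// sqr_ge0.
  by move: h; clear; nra.
move=> /andP[rt tr]; apply: cder_le fl _; exists (t - r); first by rewrite subr_gt0.
move=> h hh; have := @anal_lipschitz f t r' M (c + h) c af tr r1 hM.
rewrite [in normc (c + h - c)]addrC addKr; apply; first by rewrite (le_trans cr)// ltW.
by rewrite (le_trans (le_normcD _ _))// -lerBrDl; move: cr hh; lra.
Qed.

Lemma anal_divdiff f c : anal f -> normc c < 1 ->
  exists2 g, anal g & forall z, normc z < 1 -> f z - f c = (z - c) * g z.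
Proof.
move=> af c1; have [g ag im] := anal_image (@divdiffB R c)
  (fun r rl => @divdiff_op_bound c r c1 rl) af.
exists g => // z z1.
pose r := Num.max (normc z) (normc c).
have rl : r < 1 by rewrite gt_max z1.
have zr : normc z <= r by rewrite le_max lexx.
have cr : normc c <= r by rewrite le_max lexx orbT.
apply/eqP; rewrite -subr_eq0 -normc_eq0 eq_le normc_ge0 andbT.
apply: (@le_eps _ _ (2 + normc (z - c))) => [|e e0]; first by rewrite addr_ge0 ?normc_ge0.
have [p [hp hg]] := image_lim af im zr rl e0.
have -> : f z - f c - (z - c) * g z = (f z - p.[z]) - (f c - p.[c])
   - (z - c) * (g z - (divdiff c p).[z]).
  by have := horner_divdiff c p z => /eqP; rewrite subr_eq => /eqP ->; ring.
rewrite add0r [leRHS]mulrDl (le_trans (le_normcB _ _))// lerD//.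
  by rewrite (le_trans (le_normcB _ _))// mulr_natl mulr2n lerD ?hp.
by rewrite normcM ler_wpM2l ?normc_ge0 ?hg.
Qed.

Lemma divdiff_deriv_bound (r : R) : r < 1 ->
  exists r' K : R, [/\ r' < 1, 0 <= K & forall (p : {poly C}) M,
     (forall z, normc z <= r' -> normc p.[z] <= M) ->
      forall z, normc z <= r -> normc (p^`()).[z] <= K * M].
Proof.
move=> r1; exists ((1 + r) / 2), (2 / ((1 + r) / 2 - r) ^+ 2).
have h : r < (1 + r) / 2 by lra.
split; [lra|by rewrite divr_ge0 ?exprn_ge0// subr_ge0 ltW|].
move=> p M hM z zr; rewrite -horner_divdiff_deriv.
by apply: divdiff_le h _ hM _ _ => //; lra.
Qed.

Lemma anal_deriv_im f : anal f -> exists2 g, anal g & image_by (@deriv C) f g.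
Proof.
by move=> af; apply: (anal_image (@derivB C) divdiff_deriv_bound).
Qed.

(** For a polynomial the first-order remainder is the second divided difference times [h^2]. Two
    uses of [divdiff_le] on nested radii bound it uniformly over the approximants, so the bound
    survives the limit. *)
Lemma image_deriv f g : anal f -> image_by (@deriv C) f g ->
  forall z, normc z < 1 -> cder f z (g z).
Proof.
move=> af im z z1 e e0.
pose r := (1 + normc z) / 2; pose r1 := (1 + r) / 2; pose r2 := (1 + r1) / 2.
have h1 : r < r1 by rewrite /r1 /r; lra.
have h2 : r1 < r2 by rewrite /r2 /r1 /r; lra.
have h3 : r2 < 1 by rewrite /r2 /r1 /r; lra.
have zr : normc z < r by rewrite /r; lra.
have [M M0 hM] := anal_bounded af h3.
pose K := 2 / (r1 - r) ^+ 2 * (2 / (r2 - r1) ^+ 2 * (M + 1)).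
have K0 : 0 <= K by rewrite !mulr_ge0 ?invr_ge0 ?sqr_ge0 ?addr_ge0.
have main h : normc h < r - normc z ->
    normc (f (z + h) - f z - g z * h) <= K * normc h ^+ 2.
  move=> hh; have zhr : normc (z + h) <= r by rewrite (le_trans (le_normcD _ _))//; lra.
  apply: (@le_eps _ _ (2 + normc h)) => [|d d0]; first by rewrite addr_ge0 ?normc_ge0.
  have d1 : 0 < Num.min d 1 by rewrite lt_min d0 ltr01.
  have zr2 : normc z <= r2 by rewrite (le_trans (ltW zr))// ltW// (lt_trans h1).
  have [p [hp hg]] := image_lim af im zr2 h3 d1.
  have hp' w : normc w <= r2 -> normc (f w - p.[w]) <= d.
    by move=> /hp/le_trans; apply; rewrite ge_min lexx.
  have pM w : normc w <= r2 -> normc p.[w] <= M + 1.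
    move=> wr; rewrite -(subrK (f w) p.[w]) (le_trans (le_normcD _ _))// addrC lerD ?hM//.
    by rewrite normcB (le_trans (hp _ wr))// ge_min lexx orbT.
  have -> : f (z + h) - f z - g z * h = (p.[z + h] - p.[z] - p^`().[z] * h) +
     ((f (z + h) - p.[z + h]) - (f z - p.[z]) - (g z - p^`().[z]) * h) by ring.
  rewrite (le_trans (le_normcD _ _))// lerD//.
    have zh : z + h - z = h by ring.
    rewrite horner_divdiff zh -horner_divdiff_deriv -mulrBl horner_divdiff zh -mulrA -expr2.
    rewrite normcM normcX ler_wpM2r ?sqr_ge0//.
    apply: (@divdiff_le _ _ _ r r1) => //; [by apply: ltW; lra| |exact: ltW] => w wr.
    by apply: (@divdiff_le _ _ _ r1 r2) => //; [exact: ltW|rewrite ltW// (lt_trans zr)].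
  rewrite (le_trans (le_normcB _ _))// [leRHS]mulrDl lerD//.
    rewrite (le_trans (le_normcB _ _))// mulr_natl mulr2n lerD ?hp'//.
    by rewrite (le_trans zhr)// ltW// (lt_trans h1).
  rewrite normcM mulrC ler_wpM2l ?normc_ge0// (le_trans (hg _ zr2))// ge_min lexx//.
have K1 : 0 < K + 1 by rewrite ltr_wpDl.
exists (Num.min (r - normc z) (e / (K + 1))) => [|h].
  by rewrite lt_min subr_gt0 zr divr_gt0.
rewrite lt_min => /andP[/main hh he]; rewrite (le_trans hh)// expr2 mulrA ler_wpM2r ?normc_ge0//.
rewrite ltr_pdivlMr// in he; rewrite (le_trans _ (ltW he))// mulrC ler_wpM2l ?normc_ge0// lerDl//.
Qed.

Lemma anal_cder f : anal f -> exists2 g, anal g & forall z, normc z < 1 -> cder f z (g z).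
Proof.
by move=> af; have [g ag im] := anal_deriv_im af; exists g => //; exact: image_deriv.
Qed.

Definition primitive_poly (p : {poly C}) : {poly C} :=
  \poly_(i < (size p).+1) (if i is j.+1 then p`_j / j.+1%:R else 0).

Lemma coef_primitive p i :
  (primitive_poly p)`_i = if i is j.+1 then p`_j / j.+1%:R else 0.
Proof.
rewrite coef_poly; case: i => [|i] //; rewrite ltnS.
by case: ltnP => // h; rewrite nth_default ?mul0r.
Qed.

Lemma primitive_polyB p q : primitive_poly (p - q) = primitive_poly p - primitive_poly q.
Proof.
apply/polyP => i; rewrite coefB !coef_primitive.
by case: i => [|i]; rewrite ?subr0// coefB mulrBl.
Qed.

Lemma deriv_primitive p : (primitive_poly p)^`() = p.
Proof.
apply/polyP => i; rewrite coef_deriv coef_primitive -(mulr_natr (_ / _)) divfK//.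
Qed.

Lemma primitive_op_bound (r : R) : r < 1 ->
  exists r' K : R, [/\ r' < 1, 0 <= K & forall (p : {poly C}) M,
     (forall z, normc z <= r' -> normc p.[z] <= M) ->
      forall z, normc z <= r -> normc (primitive_poly p).[z] <= K * M].
Proof.
move=> r1; exists r, 1; split => // p M hM z zr; rewrite mul1r.
have p0 : (primitive_poly p).[0] = 0 by rewrite horner_coef0 coef_primitive.
have M0 : 0 <= M.
  by rewrite (le_trans (normc_ge0 p.[0]))// hM// normc0 (le_trans (normc_ge0 z)).
have D (t : R) : 0 <= t <= 1 -> cder (horner (primitive_poly p)) (0 + (t%:C)%C * z) p.[0 + (t%:C)%C * z].
  by move=> _; rewrite -{2}(deriv_primitive p); exact: cder_poly.
have B (t : R) : 0 <= t <= 1 -> normc p.[0 + (t%:C)%C * z] <= M.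
  move=> /andP[t0 t1]; apply: hM; rewrite add0r normcM normc_real ger0_norm//.
  by rewrite (le_trans _ zr)// ler_piMl ?normc_ge0.
have := @mean_value_le _ (horner (primitive_poly p)) (horner p) 0 z M D B.
rewrite add0r p0 subr0 => /le_trans; apply.
by rewrite ler_piMr// (le_trans zr)// ltW.
Qed.

Lemma anal_primitive f : anal f -> exists2 F, anal F & forall z, normc z < 1 -> cder F z (f z).
Proof.
move=> af; have [F aF im] := anal_image primitive_polyB primitive_op_bound af.
exists F => // z z1; have [g ag img] := anal_deriv_im aF.
(* [g] is the derivative of [F]; it equals [f] because the primitive of one approximant of [f]
   approximates [F] and differentiates back to that approximant. *)
suff -> : f z = g z by exact: image_deriv img z z1.
apply/eqP; rewrite -subr_eq0 -normc_eq0 eq_le normc_ge0 andbT.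
apply: (@le_eps _ _ 2) => // e e0; rewrite add0r.
have [r' [d [r'1 d0 h]]] := img _ _ z1 e0.
have m1 : Num.max (normc z) r' < 1 by rewrite gt_max z1.
have de : 0 < Num.min d e by rewrite lt_min d0.
have zm : normc z <= Num.max (normc z) r' by rewrite le_max lexx.
have [p [hp hF]] := image_lim af im zm m1 de.
have : normc (g z - (primitive_poly p)^`().[z]) <= e.
  apply: h (lexx _) => w wr; rewrite (le_trans (hF w _)) ?ge_min ?lexx//.
  by rewrite le_max wr orbT.
rewrite deriv_primitive => gp.
rewrite (le_trans (le_normc_dist p.[z] _ _))// mulr_natl mulr2n lerD//.
  by rewrite (le_trans (hp z zm))// ge_min lexx orbT.
by rewrite normcB.
Qed.

Definition utends (F : nat -> C -> C) f := forall r e : R, r < 1 -> 0 < e ->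
  exists N, forall n z, (N <= n)%N -> normc z <= r -> normc (F n z - f z) <= e.

Lemma utends_tends F f z : utends F f -> normc z < 1 -> tends (F ^~ z) (f z).
Proof. by move=> h z1 e /(h _ _ z1)[N hN]; exists N => n Nn; exact: hN (lexx _). Qed.

(** Weierstrass's theorem on derivatives: the Cauchy estimate applied to [F n - f]. *)
Lemma utends_cder (F G : nat -> C -> C) f g : (forall n, anal (F n)) -> anal f ->
  (forall n z, normc z < 1 -> cder (F n) z (G n z)) -> (forall z, normc z < 1 -> cder f z (g z)) ->
  utends F f -> utends G g.
Proof.
move=> aF af FG fg h r e r1 e0; pose r' := (1 + r) / 2.
have rr' : r < r' by rewrite /r'; lra.
have r'1 : r' < 1 by rewrite /r'; lra.
have K0 : 0 < 2 / (r' - r) ^+ 2 by rewrite divr_gt0// exprn_gt0// subr_gt0.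
have [N hN] := h _ _ r'1 (divr_gt0 e0 K0); exists N => n z Nn zr.
have z1 : normc z < 1 by rewrite (le_lt_trans zr).
have := anal_cder_le (analB (aF n) af) rr' r'1 (fun z => hN n z Nn) zr (cderB (FG n z z1) (fg z z1)).
by rewrite mulrC divfK ?lt0r_neq0.
Qed.

(** The majorant has the form [B * d k] since in the applications [d k = (1 - |z k|)^(s+1)] and only
    the constant depends on the radius. *)
Lemma anal_series (u : nat -> C -> C) (d : nat -> R) :
  (forall k, 0 <= d k) -> (exists B, forall m, \sum_(k < m) d k <= B) ->
  (forall k, anal (u k)) ->
  (forall r : R, r < 1 -> exists2 B : R, 0 <= B & forall k z, normc z <= r -> normc (u k z) <= B * d k) ->
  exists2 F, anal F & utends (fun m z => \sum_(k < m) u k z) F.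
Proof.
move=> d0 sd au hu; have [t [tv t0 ht]] := vanishing_tail d0 sd.
have cau (r B : R) z m n : (forall k z, normc z <= r -> normc (u k z) <= B * d k) -> 0 <= B ->
   normc z <= r -> (m <= n)%N ->
   normc (\sum_(k < n) u k z - \sum_(k < m) u k z) <= B * t m.
  move=> hB B0 zr mn; rewrite -!(big_mkord xpredT (fun k => u k z)).
  rewrite (big_cat_nat _ mn)//= addrAC subrr add0r (le_trans (le_normc_sum _ _ _))//.
  apply: (@le_trans _ _ (B * \sum_(m <= k < n) d k)); last by rewrite ler_wpM2l ?ht.
  by rewrite mulr_sumr; apply: ler_sum => k _; exact: hB.
have lims z : exists l, normc z < 1 -> tends (fun m => \sum_(k < m) u k z) l.
  have [z1|z1] := ltP (normc z) 1; last by exists 0.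
  have [B B0 hB] := hu _ z1.
  have [l [hl _]] := complex_cauchy (fun m n => cau _ _ z m n hB B0 (lexx _)) (vanishesZ B0 tv).
  by exists l.
have [F hF] := choice lims.
have uF : utends (fun m z => \sum_(k < m) u k z) F.
  move=> r e r1 e0; have [B B0 hB] := hu _ r1.
  have [N hN] := vanishesZ B0 tv e0; exists N => m z Nm zr.
  apply: le_trans (hN m Nm).
  apply: (@tends_le _ _ (fun n => \sum_(k < m) u k z - \sum_(k < n) u k z)).
    apply: tendsD; first exact: tends_cst.
    move=> e' /(hF z (le_lt_trans zr r1))[N' hN']; exists N' => n /hN'.
    by rewrite -normcN; congr (normc _ <= _); ring.
  by exists m => // n mn; rewrite normcB (cau r).
exists F => //; apply: anal_lim => r e r1 e0; have [N hN] := uF _ _ r1 e0.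
exists (fun z => \sum_(k < N) u k z) => [|z zr]; last by rewrite normcB hN.
rewrite [X in anal X](_ : _ = fun z => \sum_(0 <= k < N) u k z).
  by apply: anal_sum => i; exact: au.
by apply/funext => z; rewrite big_mkord.
Qed.

End Operators.

(** * Canonical products *)

Section Factors.
Variable R : realType.
Local Notation C := R[i].
Implicit Types (a x y w : C).

(** The argument of the primary factor with zero [a]: it is [1] at [a] and at most [2] in modulus on
    the disc. *)
Definition unit_kernel a x : C := (1 - `|a| ^+ 2) / (1 - a^*%C * x).
Local Notation W := unit_kernel.

Lemma denom_neq0 a x : normc a < 1 -> normc x < 1 -> 1 - a^*%C * x != 0.
Proof.
move=> a1 x1; rewrite -normc_gt0 (lt_le_trans _ (le_normc_sub _ _))//.
by rewrite normc1 normcM normc_conj subr_gt0 mulr_ilt1 ?normc_ge0.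
Qed.

Lemma denom_ge_r a x : normc a < 1 -> 1 - normc x <= normc (1 - a^*%C * x).
Proof.
move=> a1; rewrite (le_trans _ (le_normc_sub _ _))// normc1 normcM normc_conj.
by rewrite lerD2l lerN2 ler_piMl ?normc_ge0// ltW.
Qed.

Lemma denom_ge_l a x : normc x < 1 -> 1 - normc a <= normc (1 - a^*%C * x).
Proof.
move=> x1; rewrite (le_trans _ (le_normc_sub _ _))// normc1 normcM normc_conj.
by rewrite lerD2l lerN2 ler_piMr ?normc_ge0// ltW.
Qed.

Lemma kernel_num a : (1 - `|a| ^+ 2 : C) = (1 - normc a ^+ 2)%:C%C.
Proof. by rewrite rmorphB rmorph1 rmorphXn /= normcE'. Qed.

Lemma kernel_num_conj a : (1 - `|a| ^+ 2 : C) = 1 - a^*%C * a.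
Proof. by rewrite mulrC -normc_conjM rmorphXn /= normcE'. Qed.

Lemma sqr_normc_lt1 a : normc a < 1 -> 0 < 1 - normc a ^+ 2.
Proof. by move=> a1; rewrite subr_gt0 expr_lt1 ?normc_ge0. Qed.

Lemma normc_kernel a x : normc a < 1 ->
  normc (W a x) = (1 - normc a ^+ 2) / normc (1 - a^*%C * x).
Proof.
move=> a1; rewrite /W kernel_num normcM normcV normc_real ger0_norm// ltW//.
exact: sqr_normc_lt1.
Qed.

Lemma kernel_le2 a x : normc a < 1 -> normc x < 1 -> normc (W a x) <= 2.
Proof.
move=> a1 x1; rewrite normc_kernel// ler_pdivrMr ?normc_gt0 ?denom_neq0//.
have := denom_ge_l a x1; have := normc_ge0 a; move: (normc a) (normc _) a1 => u v; nra.
Qed.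

Lemma kernel_le a x : normc a < 1 -> normc x < 1 ->
  normc (W a x) <= 2 * (1 - normc a) / (1 - normc x).
Proof.
move=> a1 x1; rewrite normc_kernel// ler_pM ?invr_ge0 ?normc_ge0 ?(ltW (sqr_normc_lt1 a1))//.
  by have := normc_ge0 a; move: (normc a) a1 => u; nra.
by rewrite lef_pV2 ?posrE ?normc_gt0 ?denom_neq0 ?subr_gt0// denom_ge_r.
Qed.

Lemma kernel_diag a : normc a < 1 -> W a a = 1.
Proof.
by move=> a1; rewrite /W kernel_num_conj divff// denom_neq0.
Qed.

Lemma kernel_sub1 a x : normc a < 1 -> normc x < 1 ->
  W a x - 1 = a^*%C * (x - a) / (1 - a^*%C * x).
Proof.
move=> a1 x1; rewrite /W kernel_num_conj; field.
exact: denom_neq0.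
Qed.

Lemma anal_kernel a : normc a < 1 -> anal (W a).
Proof.
move=> a1; apply: analM; first exact: anal_cst.
by apply: anal_geo; rewrite normc_conj ltW.
Qed.

Lemma cder_denom a x : cder (fun x => 1 - a^*%C * x) x (- a^*%C).
Proof.
apply: cder_eq (cderB (cder_cst 1 x) (cderZ (a^*%C) (cder_id x))) _.
by rewrite mulr1 sub0r.
Qed.

Lemma cder_kernel a x : normc a < 1 -> normc x < 1 ->
  cder (W a) x (W a x * a^*%C / (1 - a^*%C * x)).
Proof.
move=> a1 x1; have d0 := denom_neq0 a1 x1.
apply: cder_eq (cderZ _ (cderV (cder_denom a x) d0)) _.
by rewrite /W opprK; field.
Qed.

Definition log_poly s w : C := \sum_(1 <= j < s.+1) w ^+ j / j%:R.
Definition log_polyR s (t : R) : R := \sum_(1 <= j < s.+1) t ^+ j / j%:R.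

Lemma le_log_poly s w t : normc w <= t -> normc (log_poly s w) <= log_polyR s t.
Proof.
move=> wt; rewrite (le_trans (le_normc_sum _ _ _))// /log_polyR.
apply: ler_sum => j _; rewrite normcM normcX normcV normc_nat.
by rewrite ler_wpM2r ?invr_ge0// lerXn2r ?nnegrE ?normc_ge0// (le_trans (normc_ge0 w)).
Qed.

Lemma log_polyR_ge0 s t : 0 <= t -> 0 <= log_polyR s t.
Proof. by move=> t0; apply: sumr_ge0 => j _; rewrite divr_ge0 ?exprn_ge0. Qed.

Lemma log_poly_real s t : log_poly s (t%:C)%C = (log_polyR s t)%:C%C.
Proof.
rewrite /log_poly /log_polyR (rmorph_sum (real_complex R)); apply: eq_bigr => j _.
by rewrite rmorphM fmorphV rmorphXn rmorph_nat.
Qed.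

Lemma anal_log_poly s (f : C -> C) : anal f -> anal (fun x => log_poly s (f x)).
Proof.
move=> af; apply: anal_sum => j; apply: analM; last exact: anal_cst.
exact: analX.
Qed.

Lemma cder_log_poly s w : cder (log_poly s) w (\sum_(j < s) w ^+ j).
Proof.
have H (j : nat) : cder (fun w : C => w ^+ j.+1 / j.+1%:R) w (w ^+ j).
  apply: cder_eq (cderM (cderX j.+1 (cder_id w)) (cder_cst _ w)) _.
  by rewrite /= mulr0 addr0 mulr1 mulrAC divff ?mul1r//.
have := cder_sum (m := s) (F := fun j w => w ^+ j.+1 / j.+1%:R) (G := fun j w => w ^+ j) (fun k _ => H k).
apply: cder_ext => x; rewrite /log_poly big_add1 /= big_mkord; exact: eq_bigr.
Qed.

(** [(1 - w) (1 + ... + w^(s-1))] telescopes to [1 - w^s], so only the top power survives; this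
    gives [E - 1] its order [s + 1] at [0]. *)
Lemma cder_primary_factor s w : cder (@primary_factor R s) w (- (w ^+ s * cexp (log_poly s w))).
Proof.
apply: cder_eq (cderM (cderB (cder_cst 1 w) (cder_id w)) (cder_comp (cder_log_poly s w) (cder_cexp _))) _.
have := subrX1 w s => h.
rewrite sub0r mulN1r.
have -> : (1 - w) * (cexp (log_poly s w) * \sum_(j < s) w ^+ j) = - (w ^+ s - 1) * cexp (log_poly s w).
  by rewrite h; ring.
by ring.
Qed.

Lemma primary_factor0 s : primary_factor s 0 = 1 :> C.
Proof.
rewrite /primary_factor subr0 mul1r big1_seq ?cexp0// => j.
by rewrite mem_index_iota => /andP[_ /andP[j0 _]]; rewrite expr0n gtn_eqF// mul0r.
Qed.

Lemma primary_factor_sub1 s w (t : R) : normc w <= t ->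
  normc (primary_factor s w - 1) <= normc w ^+ s.+1 * expR (log_polyR s t).
Proof.
move=> wt.
have t0 : 0 <= t by rewrite (le_trans (normc_ge0 w)).
have := @mean_value_le R (@primary_factor R s) (fun w => - (w ^+ s * cexp (log_poly s w))) 0 w
   (normc w ^+ s * expR (log_polyR s t)).
rewrite add0r primary_factor0 exprSr mulrAC; apply => [u _|u /andP[u0 u1]].
  exact: cder_primary_factor.
have uw : normc (0 + (u%:C)%C * w) <= normc w.
  by rewrite add0r normcM normc_real ger0_norm// ler_piMl ?normc_ge0.
rewrite normcN normcM normcX ler_pM ?exprn_ge0 ?normc_ge0//.
  by rewrite lerXn2r ?nnegrE ?normc_ge0.
rewrite (le_trans (le_normc_cexp _))// ler_expR le_log_poly//.
exact: le_trans wt.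
Qed.

(* The factor with zero [a]; for [a = 0], where the kernel is constantly [1], the factor
   [primary_factor s (W a x)] would vanish identically. *)
Definition zfactor s a x : C :=
  (if a == 0 then x else 1 - W a x) * cexp (log_poly s (W a x)).

(** The constant in [factor_lin], which writes the factor as a multiple of
    [(x - a) / (1 - conj a x)] times an exponential, uniformly in [a]. *)
Definition fcoef a : C := if a == 0 then 1 else - a^*%C.

Lemma factorE s a x : a != 0 -> zfactor s a x = primary_factor s (W a x).
Proof. by rewrite /zfactor => /negPf ->. Qed.

Lemma kernel0 x : W 0 x = 1.
Proof. by rewrite /W normr0 expr0n subr0 conjc0 mul0r subr0 divr1. Qed.

Lemma factor_lin s a x : normc a < 1 -> normc x < 1 ->
  zfactor s a x = fcoef a * (x - a) / (1 - a^*%C * x) * cexp (log_poly s (W a x)).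
Proof.
move=> a1 x1; rewrite /zfactor /fcoef; case: eqVneq => [->|a0].
  by rewrite conjc0 mul0r !subr0 mul1r divr1.
by congr (_ * _); rewrite -opprB kernel_sub1// mulNr mulNr.
Qed.

Lemma factor_eq0 s a x : normc a < 1 -> normc x < 1 -> (zfactor s a x == 0) = (x == a).
Proof.
move=> a1 x1; rewrite factor_lin// mulf_eq0 (negPf (cexp_neq0 _)) orbF !mulf_eq0.
rewrite invr_eq0 (negPf (denom_neq0 a1 x1)) orbF subr_eq0 [X in X || _](_ : _ = false)//.
rewrite /fcoef; case: (eqVneq a 0) => [_|a0]; first by rewrite oner_eq0.
by rewrite oppr_eq0 conjc_eq0 (negPf a0).
Qed.

Lemma anal_factor s a : normc a < 1 -> anal (zfactor s a).
Proof.
move=> a1; have aW := anal_kernel a1; apply: analM; last exact/anal_cexp/anal_log_poly.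
case: (a == 0); first exact: anal_id.
by apply: analB => //; exact: anal_cst.
Qed.

(** The derivative of the factor in a form free of division by [x - a], hence valid at the zero too,
    where [P'] has to be evaluated. *)
Definition dfactor s a x : C :=
  fcoef a * W a x ^+ s.+1 * cexp (log_poly s (W a x)) / (1 - a^*%C * x).

Lemma cder_factor s a x : normc a < 1 -> normc x < 1 -> cder (zfactor s a) x (dfactor s a x).
Proof.
move=> a1 x1; have d0 := denom_neq0 a1 x1.
have [->|a0] := eqVneq a 0.
  rewrite /dfactor /fcoef eqxx kernel0 expr1n conjc0 mul0r subr0 divr1 !mul1r.
  apply: cder_ext (cder_eq (cderM (cder_id x) (cder_cst (cexp (log_poly s 1)) x)) _) => [y|].
    by rewrite /zfactor eqxx kernel0.
  by rewrite mulr0 addr0 mul1r.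
apply: cder_ext (cder_eq (cder_comp (cder_kernel a1 x1) (cder_primary_factor s _)) _) => [y|].
  by rewrite factorE.
by rewrite /dfactor /fcoef (negPf a0) exprS; field.
Qed.

Definition d2factor s a x : C :=
  dfactor s a x * (a^*%C / (1 - a^*%C * x)) * (s.+1%:R + \sum_(j < s.+1) W a x ^+ j).

Lemma cder_dfactor s a x : normc a < 1 -> normc x < 1 -> cder (dfactor s a) x (d2factor s a x).
Proof.
move=> a1 x1; have d0 := denom_neq0 a1 x1.
have dW := cder_kernel a1 x1.
have dE := cder_comp (cder_comp dW (cder_log_poly s _)) (cder_cexp _).
have dD := cderV (cder_denom a x) d0.
apply: cder_eq (cderM (cderM (cderZ (fcoef a) (cderX s.+1 dW)) dE) dD) _.
rewrite /d2factor /dfactor /= big_ord_recl expr0 /=.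
have -> : \sum_(i < s) W a x ^+ bump 0 i = W a x * \sum_(j < s) W a x ^+ j.
  by rewrite mulr_sumr; apply: eq_bigr => i _; rewrite exprS.
rewrite exprS opprK; move: (\sum_(j < s) _) (cexp _) (s.+1%:R) => S e n.
by field.
Qed.

(** The logarithmic derivative of the factor. Both it and its derivative [dlogder] carry the power
    of the kernel that [kernel_sum_bound] can sum. *)
Definition logder s a x : C := W a x ^+ s.+1 / (x - a).
Definition dlogder s a x : C :=
  W a x ^+ s.+1 / (x - a) * (s.+1%:R * a^*%C / (1 - a^*%C * x) - (x - a)^-1).

Lemma dfactorE s a x : normc a < 1 -> normc x < 1 -> x != a ->
  dfactor s a x = logder s a x * zfactor s a x.
Proof.
move=> a1 x1 xa; rewrite /dfactor factor_lin// /logder.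
by field; rewrite denom_neq0// subr_eq0.
Qed.

Lemma d2factorE s a x : normc a < 1 -> normc x < 1 -> x != a ->
  d2factor s a x = (logder s a x ^+ 2 + dlogder s a x) * zfactor s a x.
Proof.
move=> a1 x1 xa; have d0 := denom_neq0 a1 x1.
have xa0 : x - a != 0 by rewrite subr_eq0.
have -> : (logder s a x ^+ 2 + dlogder s a x) * zfactor s a x =
  dfactor s a x * (logder s a x + (s.+1%:R * a^*%C / (1 - a^*%C * x) - (x - a)^-1)).
  by rewrite dfactorE// /dlogder -/(logder s a x); ring.
rewrite /d2factor -mulrA; congr (_ * _).
(* Expanding [W^(s+1) - 1] as [(W - 1)] times the power sum cancels the pole at [x = a] and matches
   the two forms. *)
have := subrX1 (W a x) s.+1; rewrite kernel_sub1// => /eqP; rewrite subr_eq => /eqP h.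
rewrite /logder h; move: (\sum_(j < s.+1) _) (s.+1%:R) => S n.
by field; rewrite xa0 d0.
Qed.

Lemma normc_dfactor_diag s a : normc a < 1 ->
  normc (dfactor s a a) = normc (fcoef a) / (1 - normc a ^+ 2) * expR (log_polyR s 1).
Proof.
move=> a1; rewrite /dfactor kernel_diag// expr1n mulr1 normcM normcV normcM normc_cexp mulrAC.
have -> : 1 - a^*%C * a = ((1 - normc a ^+ 2)%:C)%C.
  by rewrite -kernel_num kernel_num_conj.
rewrite normc_real ger0_norm; last exact: ltW (sqr_normc_lt1 a1).
by rewrite -(rmorph1 (real_complex R)) log_poly_real.
Qed.

(** The summand [1] in the constant pays for the substituted factor at [a = 0]: it need not be near
    [1], but its kernel is [1]. *)
Lemma factor_sub1 s a x (t : R) : normc a < 1 -> normc x < 1 -> 1 <= t -> normc (W a x) <= t ->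
  normc (zfactor s a x - 1) <= (1 + expR (log_polyR s t)) * normc (W a x) ^+ s.+1.
Proof.
move=> a1 x1 t1 wt; have [a0|a0] := eqVneq a 0.
  rewrite /zfactor a0 eqxx kernel0 normc1 expr1n mulr1 (le_trans (le_normcB _ _))//.
  rewrite normc1 addrC lerD2l normcM (le_trans (ler_piMl _ (ltW x1))) ?normc_ge0//.
  by rewrite (le_trans (le_normc_cexp _))// ler_expR le_log_poly// normc1.
rewrite factorE// (le_trans (primary_factor_sub1 s wt))// mulrC ler_wpM2r ?exprn_ge0 ?normc_ge0//.
by rewrite lerDr.
Qed.

End Factors.

(** * Gauges [L] and growth of order [exp (O (L))] *)

Section Gauge.
Variables (R : realType) (L : R -> R).
Local Notation C := R[i].

(** The lower bound [1] absorbs constants, halving the distance to the circle changes [L] by a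
    bounded factor, and the last clause says [log (1 / (1 - r)) = O (L)], which absorbs the losses
    of Cauchy estimates. *)
Definition gauge := [/\ forall r, 0 <= r < 1 -> 1 <= L r,
  forall r r', 0 <= r -> r <= r' -> r' < 1 -> L r <= L r',
  exists2 K, 0 <= K & forall r, 0 <= r < 1 -> L ((1 + r) / 2) <= K * L r &
  exists2 K, 0 <= K & forall r, 0 <= r < 1 -> (1 - r)^-1 <= expR (K * L r)].

Definition tame (g : C -> R) := exists2 K, 0 <= K &
  forall x, normc x < 1 -> g x <= expR (K * L (normc x)).

Hypothesis gL : gauge.

Lemma gauge_ge1 x : normc x < 1 -> 1 <= L (normc x).
Proof. by move=> x1; case: gL => h _ _ _; rewrite h// normc_ge0. Qed.

Lemma gauge_ge0 x : normc x < 1 -> 0 <= L (normc x).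
Proof. by move=> x1; rewrite (le_trans _ (gauge_ge1 x1)). Qed.

Lemma tame_le (g h : C -> R) : (forall x, normc x < 1 -> g x <= h x) -> tame h -> tame g.
Proof. by move=> gh [K K0 hK]; exists K => // x x1; rewrite (le_trans (gh x x1))// hK. Qed.

Lemma tame_gauge (K : R) : 0 <= K -> tame (fun x => K * L (normc x)).
Proof. by move=> K0; exists K => // x x1; rewrite (le_trans _ (expR_ge1Dx _))// lerDr. Qed.

Lemma tame_exp (K : R) : 0 <= K -> tame (fun x => expR (K * L (normc x))).
Proof. by move=> K0; exists K. Qed.

Lemma tame_cst (K : R) : tame (fun=> K).
Proof.
apply: tame_le (tame_gauge (normr_ge0 K)) => x x1.
by rewrite (le_trans (ler_norm K))// ler_peMr// gauge_ge1.
Qed.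

Lemma tameM (g h : C -> R) : (forall x, 0 <= g x) -> (forall x, 0 <= h x) ->
  tame g -> tame h -> tame (fun x => g x * h x).
Proof.
move=> g0 h0 [K K0 hK] [K' K'0 hK']; exists (K + K'); first exact: addr_ge0.
by move=> x x1; rewrite mulrDl expRD ler_pM ?hK ?hK'.
Qed.

Lemma tameD (g h : C -> R) : tame g -> tame h -> tame (fun x => g x + h x).
Proof.
move=> [K K0 hK] [K' K'0 hK']; exists (Num.max K K' + 1); first by rewrite addr_ge0// le_max K0.
move=> x x1; have L1 := gauge_ge1 x1; have L0 := gauge_ge0 x1.
rewrite mulrDl mul1r expRD mulrC.
have e2 : 2 <= expR (L (normc x)).
  by rewrite (le_trans _ (expR_ge1Dx _))//; lra.
rewrite (@le_trans _ _ (2 * expR (Num.max K K' * L (normc x))))//; last first.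
  by rewrite ler_wpM2r// expR_ge0.
rewrite mulr_natl mulr2n; apply: lerD.
  by rewrite (le_trans (hK _ x1))// ler_expR ler_wpM2r// le_max lexx.
by rewrite (le_trans (hK' _ x1))// ler_expR ler_wpM2r// le_max lexx orbT.
Qed.

Lemma tame_inv : tame (fun x => (1 - normc x)^-1).
Proof. by case: gL => _ _ _ [K K0 hK]; exists K => // x x1; rewrite hK// normc_ge0. Qed.

Lemma gauge_scale i : exists2 K : R, 0 <= K & forall r r', 0 <= r < 1 -> 0 <= r' < 1 ->
  1 - r <= 2 ^+ i * (1 - r') -> L r' <= K * L r.
Proof.
case: gL => L1 Lm [K' K'0 hK'] _; elim: i => [|i [K K0 hK]].
  exists 1 => // r r' /andP[r0 r1] /andP[r'0 r'1]; rewrite expr0 !mul1r => h.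
  by rewrite Lm//; lra.
exists (K * K'); first exact: mulr_ge0.
move=> r r' r01 r'01; rewrite exprS => h; have := hK' _ r01 => h'.
rewrite (le_trans (hK ((1 + r) / 2) r' _ r'01 _)) -?mulrA ?ler_wpM2l//.
  by move: r01 => /andP[? ?]; lra.
by move: h; rewrite -mulrA; lra.
Qed.

Definition tamef (f : C -> C) := tame (fun x => normc (f x)).

Lemma tamefD f g : tamef f -> tamef g -> tamef (fun x => f x + g x).
Proof. by move=> tf tg; apply: tame_le (tameD tf tg) => x _; exact: le_normcD. Qed.

Lemma tamefM f g : tamef f -> tamef g -> tamef (fun x => f x * g x).
Proof.
move=> tf tg; apply: tame_le (tameM _ _ tf tg) => x; rewrite ?normc_ge0// => _.
by rewrite normcM.
Qed.

Lemma tamefN f : tamef f -> tamef (fun x => - f x).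
Proof. by move=> tf; apply: tame_le tf => x _; rewrite normcN. Qed.

Lemma tamef_cst c : tamef (fun=> c).
Proof. exact: tame_cst. Qed.

(** The Lipschitz bound is common to all [f] with growth constant [K0]; it will be applied to the
    family of quotients of [P] by its zeros. The two radii differ by [(1 - |x|) / 4], whence
    [32 = 2 * 16]. *)
Lemma tame_lipschitz (K0 : R) : 0 <= K0 -> exists2 K : C -> R, tame K &
  (forall x, 0 <= K x) /\ forall f, anal f ->
  (forall x, normc x < 1 -> normc (f x) <= expR (K0 * L (normc x))) ->
  forall x y y', normc x < 1 -> normc y <= (1 + 3 * normc x) / 4 -> normc y' <= (1 + 3 * normc x) / 4 ->
    normc (f y - f y') <= K x * normc (y - y').
Proof.
move=> K00; case: (gL) => L1 Lm [K' K'0 hK'] _.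
exists (fun x => 32 * ((1 - normc x)^-1 * (1 - normc x)^-1) * expR (K0 * K' * L (normc x))).
  have i0 (x : C) : 0 <= (1 - normc x)^-1 * (1 - normc x)^-1 by rewrite -expr2 sqr_ge0.
  have T : tame (fun x => `|(1 - normc x)^-1|).
    by apply: tame_le tame_inv => x x1; rewrite ger0_norm// invr_ge0 subr_ge0 ltW.
  have T2 : tame (fun x => (1 - normc x)^-1 * (1 - normc x)^-1).
    apply: tame_le (tameM (fun=> normr_ge0 _) (fun=> normr_ge0 _) T T) => x x1.
    by rewrite -normrM ger0_norm.
  have T3 := tameM (fun=> ler0n R 32) i0 (tame_cst 32) T2.
  by apply: (tameM _ _ T3) => [x|x|]; [exact: mulr_ge0|exact: expR_ge0|apply: tame_exp; rewrite mulr_ge0].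
split => [x|f af hK x y y' x1 yx y'x].
  by rewrite mulr_ge0 ?expR_ge0// mulr_ge0// -expr2 sqr_ge0.
have x0 := normc_ge0 x.
pose r := (1 + 3 * normc x) / 4; pose r' := (1 + normc x) / 2.
have := @anal_lipschitz R f r r' (expR (K0 * K' * L (normc x))) y y' af.
have -> : 2 / (r' - r) ^+ 2 = 32 * ((1 - normc x)^-1 * (1 - normc x)^-1).
  rewrite /r /r'; have -> : (1 + normc x) / 2 - (1 + 3 * normc x) / 4 = (1 - normc x) / 4 by field.
  by field; rewrite lt0r_neq0// subr_gt0.
apply => //; [by rewrite /r /r'; lra|by rewrite /r'; lra|].
move=> w wr; have w1 : normc w < 1 by move: wr; rewrite /r'; lra.
rewrite (le_trans (hK w w1))// ler_expR -mulrA ler_wpM2l//.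
rewrite (le_trans _ (hK' _ _)) ?x0// Lm ?normc_ge0//; lra.
Qed.

Lemma tame_cder f g : anal f -> tamef f -> (forall x, normc x < 1 -> cder f x (g x)) -> tamef g.
Proof.
move=> af [K0 K00 tf] fg; have [K tK [_ hK]] := tame_lipschitz K00.
apply: tame_le tK => x x1; apply: cder_le (fg x x1) _.
have x0 := normc_ge0 x.
exists ((1 - normc x) / 4) => [|h hh]; first by rewrite divr_gt0// subr_gt0.
rewrite (_ : normc h = normc (x + h - x)); last by congr normc; ring.
apply: (hK f) => //; last by lra.
by rewrite (le_trans (le_normcD _ _))//; lra.
Qed.

End Gauge.

Section ProductBounds.
Variable R : realType.
Local Notation C := R[i].

Lemma prod_le_exp (I : Type) (r : seq I) (P : pred I) (u : I -> C) :
  normc (\prod_(i <- r | P i) u i) <= expR (\sum_(i <- r | P i) normc (u i - 1)).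
Proof.
rewrite normc_prod expR_sum; apply: ler_prod => i _; rewrite normc_ge0/=.
rewrite (le_trans _ (expR_ge1Dx _))// -{1}(subrK 1 (u i)).
by rewrite (le_trans (le_normcD _ _))// normc1 addrC.
Qed.

Lemma prod_sub1_le (I : Type) (r : seq I) (u : I -> C) :
  normc (\prod_(i <- r) u i - 1) <= expR (\sum_(i <- r) normc (u i - 1)) - 1.
Proof.
elim: r => [|i r IH]; first by rewrite !big_nil expR0 !subrr normc0.
rewrite !big_cons expRD; set p := \prod_(_ <- _) _ in IH *; set e := expR (\sum_(_ <- _) _) in IH *.
have -> : u i * p - 1 = (u i - 1) * p + (p - 1) by ring.
have pe : normc p <= e by exact: prod_le_exp.
rewrite (le_trans (le_normcD _ _))//.
have h := expR_ge1Dx (normc (u i - 1)).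
rewrite (@le_trans _ _ (normc (u i - 1) * e + (e - 1)))//.
  by rewrite lerD// normcM ler_wpM2l// normc_ge0.
have e0 : 0 <= e by exact: expR_ge0.
have := ler_wpM2r e0 h; lra.
Qed.

Lemma prod_ge_sub (I : Type) (r : seq I) (u : I -> C) :
  1 - \sum_(i <- r) normc (u i - 1) <= normc (\prod_(i <- r) u i).
Proof.
elim: r => [|i r IH]; first by rewrite !big_nil subr0 normc1.
rewrite !big_cons normcM; set p := \prod_(_ <- _) _ in IH *; set e := (\sum_(_ <- _) _) in IH *.
have e0 : 0 <= e by apply: sumr_ge0 => j _; exact: normc_ge0.
have u1 : 1 - normc (u i - 1) <= normc (u i).
  by have := le_normc_sub 1 (1 - u i); rewrite normc1 (normcB 1 (u i)) subKr.
have := normc_ge0 (u i); have := normc_ge0 p; have := normc_ge0 (u i - 1).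
move: (normc p) (normc (u i)) (normc (u i - 1)) u1 IH e0 => x y d h1 h2 e0 d0 x0 y0.
have [dle|dgt] := leP d 1; last by rewrite (le_trans _ (mulr_ge0 y0 x0))//; lra.
have [ele|egt] := leP e 1; last by rewrite (le_trans _ (mulr_ge0 y0 x0))//; lra.
apply: (@le_trans _ _ ((1 - d) * (1 - e))); last by rewrite ler_pM// subr_ge0.
have := mulr_ge0 d0 e0; lra.
Qed.

End ProductBounds.

Section Product.
Variables (R : realType) (z : nat -> R[i]) (L : R -> R) (s : nat).
Local Notation C := R[i].
Local Notation W := unit_kernel.

Definition kernel_sum_bound := exists2 K : R, 0 <= K & forall m x, normc x < 1 ->
  \sum_(k < m) normc (W (z k) x) ^+ s.+1 <= K * L (normc x).

(** The common outcome of (a), (b) and (c). It is stated for partial products so that a change of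
    genus can be carried out factor by factor. *)
Definition product_low := exists2 K : R, 0 <= K & forall n, exists N, forall m, (N <= m)%N ->
  expR (- (K * L (normc (z n)))) <= \prod_(k < m | k != n :> nat) normc (zfactor s (z k) (z n)).

Hypothesis z1 : forall n, normc (z n) < 1.
Hypothesis gL : gauge L.
Hypothesis wsum : kernel_sum_bound.

Definition pprod m x := \prod_(k < m) zfactor s (z k) x.
Fixpoint dpprod m x := if m is m'.+1 then
  dpprod m' x * zfactor s (z m') x + pprod m' x * dfactor s (z m') x else 0.
Fixpoint d2pprod m x := if m is m'.+1 then
  d2pprod m' x * zfactor s (z m') x + dpprod m' x * dfactor s (z m') x +
  (dpprod m' x * dfactor s (z m') x + pprod m' x * d2factor s (z m') x) else 0.

Lemma pprodS m x : pprod m.+1 x = pprod m x * zfactor s (z m) x.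
Proof. by rewrite /pprod big_ord_recr. Qed.

Lemma anal_pprod m : anal (pprod m).
Proof.
elim: m => [|m IH]; first by apply: anal_ext (anal_cst 1) => x _; rewrite /pprod big_ord0.
apply: anal_ext (analM IH (anal_factor s (z1 m))) => x _; exact/esym/pprodS.
Qed.

Lemma cder_pprod m x : normc x < 1 -> cder (pprod m) x (dpprod m x).
Proof.
move=> x1; elim: m => [|m IH].
  by apply: cder_ext (cder_cst 1 x) => y; rewrite /pprod big_ord0.
by apply: cder_ext (cderM IH (cder_factor s (z1 m) x1)) => y; exact/esym/pprodS.
Qed.

Lemma cder_dpprod m x : normc x < 1 -> cder (dpprod m) x (d2pprod m x).
Proof.
move=> x1; elim: m => [|m IH]; first exact: cder_cst.
apply: cderD; apply: cderM => //; [exact: cder_factor|exact: cder_pprod|exact: cder_dfactor].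
Qed.

Definition factor_cst : R := 1 + expR (log_polyR s 2).

Lemma factor_cst_ge0 : 0 <= factor_cst.
Proof. by rewrite addr_ge0// expR_ge0. Qed.

Lemma factor_sub1_le k x : normc x < 1 ->
  normc (zfactor s (z k) x - 1) <= factor_cst * normc (W (z k) x) ^+ s.+1.
Proof. by move=> x1; apply: factor_sub1 => //; [exact: ler1n|exact: kernel_le2]. Qed.

Lemma pprod_le : exists2 K : R, 0 <= K & forall m x, normc x < 1 ->
  normc (pprod m x) <= expR (K * L (normc x)).
Proof.
case: wsum => K K0 hK; exists (factor_cst * K); first by rewrite mulr_ge0// factor_cst_ge0.
move=> m x x1; rewrite (le_trans (prod_le_exp _ _ _))// ler_expR -mulrA.
apply: le_trans (ler_wpM2l factor_cst_ge0 (hK m x x1)).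
by rewrite mulr_sumr; apply: ler_sum => k _; exact: factor_sub1_le.
Qed.

Lemma summable_dist : exists B, forall m, \sum_(k < m) (1 - normc (z k)) ^+ s.+1 <= B.
Proof.
case: wsum => K K0 hK; exists (K * L (normc (0 : C))) => m.
apply: le_trans (hK m 0 _); last by rewrite normc0.
apply: ler_sum => k _; rewrite normc_kernel// mulr0 subr0 normc1 divr1.
have := normc_ge0 (z k); have := z1 k; move: (normc _) => t t1 t0.
by rewrite lerXn2r ?nnegrE//; nra.
Qed.

Lemma dist_ge0 k : 0 <= (1 - normc (z k)) ^+ s.+1.
Proof. by rewrite exprn_ge0// subr_ge0 ltW. Qed.

Lemma kernel_pow_le (r : R) k x : normc x <= r -> r < 1 ->
  normc (W (z k) x) ^+ s.+1 <= (2 / (1 - r)) ^+ s.+1 * (1 - normc (z k)) ^+ s.+1.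
Proof.
move=> xr r1; have x1 := le_lt_trans xr r1.
rewrite -exprMn lerXn2r ?nnegrE ?normc_ge0//.
  by rewrite mulr_ge0 ?divr_ge0 ?subr_ge0 ?(ltW r1)// ltW.
rewrite (le_trans (kernel_le (z1 k) x1))// mulrAC; apply: ler_wpM2r.
  by rewrite subr_ge0 ltW.
by rewrite ler_pM2l// lef_pV2 ?posrE ?subr_gt0// lerD2l lerN2.
Qed.

(** The product is the telescoping series of the differences [pprod m x * (factor m - 1)]: the first
    term is bounded on each smaller disc, and the second is majorized by a summable sequence. *)
Lemma canonical_limit : exists2 P, anal P & utends pprod P.
Proof.
case: pprod_le => K K0 hK.
have [] := @anal_series R (fun m x => pprod m x * (zfactor s (z m) x - 1))
  (fun k => (1 - normc (z k)) ^+ s.+1) dist_ge0 summable_dist.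
- move=> k; apply: analM; first exact: anal_pprod.
  by apply: analB; [exact: anal_factor|exact: anal_cst].
- move=> r r1; have [r0|r0] := ltP r 0.
    by exists 0 => // k x /le_lt_trans/(_ r0); rewrite ltNge normc_ge0.
  case: gL => L1 Lm _ _.
  exists (expR (K * L r) * (factor_cst * (2 / (1 - r)) ^+ s.+1)).
    by rewrite mulr_ge0 ?expR_ge0// mulr_ge0 ?factor_cst_ge0// exprn_ge0// divr_ge0// subr_ge0 ltW.
  move=> k x xr; have x1 := le_lt_trans xr r1.
  rewrite normcM -mulrA ler_pM ?normc_ge0//.
    by rewrite (le_trans (hK k x x1))// ler_expR ler_wpM2l// Lm// normc_ge0.
  rewrite (le_trans (factor_sub1_le k x1))// -mulrA ler_wpM2l ?factor_cst_ge0//.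
  exact: kernel_pow_le.
move=> F aF uF; exists (fun x => 1 + F x); first by apply: analD => //; exact: anal_cst.
move=> r e r1 e0; have [N hN] := uF _ _ r1 e0; exists N => n x Nn xr.
have := hN n x Nn xr; congr (normc _ <= _); rewrite opprD addrA; congr (_ - _).
elim: n {Nn} => [|n IH]; first by rewrite big_ord0 /pprod big_ord0 subrr.
by rewrite big_ord_recr /= IH pprodS; ring.
Qed.

(** By Leibniz's rule only the term that differentiates the vanishing factor survives. *)
Lemma pprod_diag n m : (n < m)%N -> dpprod m (z n) =
  dfactor s (z n) (z n) * \prod_(k < m | k != n :> nat) zfactor s (z k) (z n).
Proof.
have f0 : zfactor s (z n) (z n) = 0 by apply/eqP; rewrite factor_eq0.
elim: m => // m IH; rewrite ltnS leq_eqVlt => /orP[/eqP <-|nm].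
  rewrite /= f0 mulr0 add0r mulrC big_mkcond big_ord_recr /= eqxx mulr1; congr (_ * _).
  by apply: eq_bigr => k _; rewrite ltn_eqF.
have p0 : pprod m (z n) = 0 by rewrite /pprod (bigD1 (Ordinal nm)) //= f0 mul0r.
rewrite /= IH// p0 mul0r addr0 -mulrA; congr (_ * _).
rewrite [RHS]big_mkcond big_ord_recr /= gtn_eqF//; congr (_ * _).
by rewrite big_mkcond.
Qed.

Lemma dpprod_off m x : normc x < 1 -> (forall k, x != z k) ->
  dpprod m x = (\sum_(k < m) logder s (z k) x) * pprod m x.
Proof.
move=> x1 xz; elim: m => [|m IH]; first by rewrite big_ord0 mul0r.
by rewrite /= IH dfactorE// pprodS big_ord_recr /=; ring.
Qed.

Lemma d2pprod_off m x : normc x < 1 -> (forall k, x != z k) ->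
  d2pprod m x = ((\sum_(k < m) logder s (z k) x) ^+ 2 + \sum_(k < m) dlogder s (z k) x) * pprod m x.
Proof.
move=> x1 xz; elim: m => [|m IH]; first by rewrite !big_ord0 expr0n addr0 mul0r.
by rewrite /= IH dpprod_off// dfactorE// d2factorE// pprodS !big_ord_recr /=; ring.
Qed.

(** The finite head is nonzero, and a tail whose deviations from [1] sum to at most [1/2] has
    modulus at least [1/2]. *)
Lemma pprod_bounded_below x : normc x < 1 -> (forall k, x != z k) ->
  exists2 c : R, 0 < c & exists N, forall m, (N <= m)%N -> c <= normc (pprod m x).
Proof.
move=> x1 xz; case: wsum => K K0 hK.
have [t [tv t0 ht]] : exists t : nat -> R, [/\ vanishes t, forall m, 0 <= t m &
    forall m n, (m <= n)%N -> \sum_(m <= k < n) normc (zfactor s (z k) x - 1) <= t m].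
  apply: vanishing_tail => [k|]; first exact: normc_ge0.
  exists (factor_cst * (K * L (normc x))) => m.
  apply: le_trans (ler_wpM2l factor_cst_ge0 (hK m x x1)).
  by rewrite mulr_sumr; apply: ler_sum => k _; exact: factor_sub1_le.
have h2 : 0 < (2 : R)^-1 by rewrite invr_gt0.
have [N hN] := tv _ h2; exists (normc (pprod N x) / 2).
  rewrite divr_gt0// normc_gt0 /pprod prodf_seq_neq0; apply/allP => k _ /=.
  by rewrite factor_eq0.
exists N => m Nm; have -> : pprod m x = pprod N x * \prod_(N <= k < m) zfactor s (z k) x.
  by rewrite /pprod -!(big_mkord xpredT (fun k => zfactor s (z k) x)) (big_cat_nat _ Nm).
rewrite normcM ler_wpM2l ?normc_ge0//.
apply: le_trans (prod_ge_sub _ _); have := le_trans (ht _ _ Nm) (hN _ (leqnn _)).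
by rewrite lerBrDr -lerBrDl (_ : 1 - 2^-1 = 2^-1 :> R)//; field.
Qed.

End Product.

Section ZeroFunction.
Variables (R : realType) (z : nat -> R[i]) (L : R -> R).
Local Notation C := R[i].
Local Notation W := unit_kernel.

(* What the construction of the equation uses of the canonical product. *)
Record zero_function (P P1 P2 : C -> C) : Prop := ZeroFunction {
  zf_anal : anal P; zf_anal1 : anal P1; zf_anal2 : anal P2;
  zf_cder : forall x, normc x < 1 -> cder P x (P1 x);
  zf_cder1 : forall x, normc x < 1 -> cder P1 x (P2 x);
  zf_tame : tamef L P;
  zf_zero : forall x, normc x < 1 -> (P x = 0 <-> exists k, x = z k);
  zf_low : exists2 K : R, 0 <= K & forall n, expR (- (K * L (normc (z n)))) <= normc (P1 (z n));
  zf_far : forall B : R, 0 <= B -> exists2 T : C -> R, tame L T & forall x, normc x < 1 ->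
    (forall k, expR (- (B * L (normc (z k)))) <= normc (x - z k)) ->
    normc (P1 x) <= T x * normc (P x) /\ normc (P2 x) <= T x * normc (P x) }.

Lemma tends_le_scale (u v : nat -> C) (l l' : C) (T : R) : 0 <= T -> tends u l -> tends v l' ->
  (forall n, normc (u n) <= T * normc (v n)) -> normc l <= T * normc l'.
Proof.
move=> T0 ul vl uv; apply: (le_vanishing (vanishesD ul (vanishesZ T0 vl))).
near=> n => /=.
have h1 : normc l <= normc (u n) + normc (u n - l).
  by rewrite -{1}(subKr (u n) l) le_normcB.
have h2 : normc (v n) <= normc l' + normc (v n - l').
  by rewrite -{1}(subrK l' (v n)) addrC le_normcD.
by have := uv n; have := ler_wpM2l T0 h2; rewrite mulrDr; lra.
Unshelve. all: by end_near. Qed.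

Lemma pos_lower_bound (u : nat -> R) (h : R) N : (forall n, 0 < u n) -> 0 < h ->
  (forall n, (N <= n)%N -> h <= u n) -> exists2 c, 0 < c & forall n, c <= u n.
Proof.
move=> u0; elim: N h => [|N IH] h h0 hN; first by exists h => // n; exact: hN.
apply: (IH (Num.min h (u N))); first by rewrite lt_min h0 u0.
move=> n; rewrite leq_eqVlt => /orP[/eqP <-|/hN hn]; first by rewrite ge_min lexx orbT.
by rewrite (le_trans _ hn)// ge_min lexx.
Qed.

Variable s : nat.
Hypothesis z1 : forall n, normc (z n) < 1.
Hypothesis gL : gauge L.
Hypothesis wsum : kernel_sum_bound z L s.
Hypothesis low : product_low z L s.

(** Summability of [(1 - |z n|)^(s+1)] forces [|z n| >= 1/2] for large [n]; the finitely many other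
    values are nonzero, also at the origin. *)
Lemma fcoef_low : exists2 c : R, 0 < c & forall n, c <= normc (fcoef (z n)).
Proof.
have [t [tv t0 ht]] := vanishing_tail (dist_ge0 s z1) (summable_dist z1 wsum).
have h2 : 0 < (2^-1 : R) by rewrite invr_gt0.
have [N hN] := tv _ (exprn_gt0 s.+1 h2).
apply: (@pos_lower_bound _ 2^-1 N) => // n.
  rewrite normc_gt0 /fcoef; case: (eqVneq (z n) 0) => [_|zk]; first exact: oner_neq0.
  by rewrite oppr_eq0 conjc_eq0.
move=> Nn; rewrite /fcoef; case: (eqVneq (z n) 0) => [_|zk].
  by rewrite normc1 invf_le1 ?ler1n.
rewrite normcN normc_conj.
have : (1 - normc (z n)) ^+ s.+1 <= 2^-1 ^+ s.+1.
  by have := le_trans (ht _ _ (leqnSn n)) (hN n Nn); rewrite big_nat1.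
rewrite ler_pXn2r ?nnegrE ?subr_ge0 ?(ltW (z1 n))// ?(ltW h2)// => h.
have -> : (2^-1 : R) = 1 - 2^-1 by field.
by rewrite lerBlDl -lerBlDr.
Qed.

Lemma canonical_zero_function : exists P P1 P2 : C -> C, [/\ zero_function P P1 P2,
  utends (pprod z s) P & forall x, normc x < 1 -> tends (dpprod z s ^~ x) (P1 x)].
Proof.
have [P aP uP] := canonical_limit z1 gL wsum.
have [P1 aP1 dP] := anal_cder aP; have [P2 aP2 dP1] := anal_cder aP1.
have cpp m x : normc x < 1 -> cder (pprod z s m) x (dpprod z s m x) by exact: cder_pprod.
have uP1 : utends (dpprod z s) P1.
  by apply: utends_cder cpp dP uP => // m; exact: anal_pprod.
have adp m : anal (dpprod z s m).
  have [g ag hg] := anal_cder (anal_pprod s z1 m); apply: anal_ext ag => x x1.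
  exact: cder_unique (hg x x1) (cpp m x x1).
have uP2 : utends (d2pprod z s) P2.
  by apply: utends_cder dP1 uP1 => // m x; exact: cder_dpprod.
exists P, P1, P2; split => //; last by move=> x; exact: utends_tends.
have hz x : normc x < 1 -> (P x = 0 <-> exists k, x = z k).
  move=> x1; split; last first.
    move=> [k ->]; apply: (tends_unique (utends_tends uP (z1 k))).
    apply: tends_near (tends_cst 0); exists k.+1 => // m /= km.
    rewrite /pprod (bigD1 (Ordinal km)) //=.
    by rewrite (_ : zfactor s (z k) (z k) = 0) ?mul0r//; apply/eqP; rewrite factor_eq0.
  apply: contraPP => /forallNP nz.
  have [|c c0 [N hN]] := pprod_bounded_below z1 wsum x1; first by move=> k; apply/eqP.
  suff : c <= normc (P x) by move=> /(lt_le_trans c0); rewrite normc_gt0 => /eqP.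
  by apply: (tends_ge (utends_tends uP x1)); exists N.
split => //.
- have [K K0 hK] := pprod_le z1 wsum; exists K => // x x1.
  apply: (tends_le (utends_tends uP x1)); exists 0%N => // m _; exact: hK.
- case: low => K K0 hK.
  have [c c0 hc] := fcoef_low.
  have T := tame_cst gL c^-1; case: T => K' K'0 hK'.
  exists (K' + K); first exact: addr_ge0.
  move=> n; have [N hN] := hK n; apply: (tends_ge (utends_tends uP1 (z1 n))).
  exists (maxn N n.+1) => // m /=; rewrite geq_max => /andP[Nm nm].
  rewrite (pprod_diag s z1 nm) normcM normc_prod mulrDl opprD expRD.
  rewrite ler_pM ?expR_ge0 ?hN// normc_dfactor_diag//.
  have c1 : expR (- (K' * L (normc (z n)))) <= c.
    by rewrite expRN invf_ple ?posrE ?expR_gt0// hK'.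
  rewrite (le_trans c1)// (le_trans (hc n))// -mulrA ler_peMr ?normc_ge0//.
  rewrite -[leLHS]mulr1 ler_pM//.
    rewrite invf_ge1 ?sqr_normc_lt1// gerBl sqr_ge0//.
  by rewrite (le_trans _ (expR_ge1Dx _))// lerDl log_polyR_ge0.
(* Here [1 / |x - z k|] is at most [M x] for all [k]: either the distance is at least
   [(1 - |x|) / 2], or [z k] is near enough for [L(z k) <= K' L(x)]. The sums of [logder] and
   [dlogder] then reduce to the kernel sum. *)
- move=> B B0; case: wsum => K K0 hK; case: (gL) => L1 Lm [K' K'0 hK'] _.
  (* The absolute value keeps the majorant nonnegative outside the disc too, as [tameM] asks. *)
  pose q (x : C) := `|(1 - normc x)^-1|.
  have q0 x : 0 <= q x by rewrite /q.
  have tq : tame L q.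
    apply: (tame_le _ (tame_inv gL)) => x x1.
    by rewrite /q ger0_norm// invr_ge0 subr_ge0 ltW.
  pose M x := 2 * q x + expR (B * K' * L (normc x)).
  have M0 x : 0 <= M x by rewrite addr_ge0 ?mulr_ge0 ?expR_ge0.
  have tM : tame L M.
    apply: tameD => //; last by apply: tame_exp; exact: mulr_ge0.
    exact: (tameM (fun=> ler0n R 2) q0 (tame_cst gL 2) tq).
  pose S x := K * `|L (normc x)|.
  have S0 x : 0 <= S x by rewrite mulr_ge0.
  have tS : tame L S.
    apply: (tame_le _ (tame_gauge L K0)) => x x1.
    by rewrite /S ger0_norm// gauge_ge0.
  (* The first term bounds the logarithmic derivative [l] of the partial products, the rest bounds
     [l^2 + l'], the ratio of the second derivative to the product. *)
  pose T x := M x * S x + (M x * S x * (M x * S x) + S x * M x * (s.+1%:R * q x + M x)).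
  have tMS : tame L (fun x => M x * S x) by exact: tameM.
  have MS0 x : 0 <= M x * S x by exact: mulr_ge0.
  have SM0 x : 0 <= S x * M x by exact: mulr_ge0.
  have sq0 x : 0 <= s.+1%:R * q x by exact: mulr_ge0.
  have sqM0 x : 0 <= s.+1%:R * q x + M x by exact: addr_ge0.
  have tT : tame L T.
    apply: tameD => //; apply: tameD => //; first exact: tameM.
    have tSM : tame L (fun x => S x * M x) by exact: tameM.
    apply: tameM => //; apply: tameD => //.
    exact: (tameM (fun=> ler0n R s.+1) q0 (tame_cst gL s.+1%:R) tq).
  exists T => // x x1 far; have x0 := normc_ge0 x.
  have xz k : x != z k.
    by rewrite -subr_eq0 -normc_gt0 (lt_le_trans _ (far k))// expR_gt0.
  have invM k : (normc (x - z k))^-1 <= M x.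
    have xp : 0 < normc (x - z k) by rewrite normc_gt0 subr_eq0.
    have [h|h] := leP ((1 - normc x) / 2) (normc (x - z k)).
      rewrite (le_trans _ (_ : 2 * q x <= M x))//; last by rewrite lerDl expR_ge0.
      have p : 0 < (1 - normc x) / 2 by rewrite divr_gt0// subr_gt0.
      rewrite (@le_trans _ _ ((1 - normc x) / 2)^-1)// ?lef_pV2 ?posrE//.
      by rewrite invf_div ler_wpM2l// ler_norm.
    rewrite (le_trans _ (_ : expR (B * K' * L (normc x)) <= M x))//; last first.
      by rewrite lerDr mulr_ge0.
    rewrite invf_ple ?posrE ?expR_gt0// -expRN (le_trans _ (far k))// ler_expR lerN2.
    rewrite -mulrA ler_wpM2l// (le_trans _ (hK' _ _)) ?x0// Lm ?normc_ge0//; last by lra.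
    have : normc (z k) <= normc x + normc (x - z k).
      by rewrite -{1}(subKr x (z k)) le_normcB.
    by lra.
  have sW m : \sum_(k < m) normc (W (z k) x) ^+ s.+1 <= S x.
    by rewrite (le_trans (hK m x x1))// ler_wpM2l// ler_norm.
  have b1 m : normc (\sum_(k < m) logder s (z k) x) <= M x * S x.
    rewrite (le_trans (le_normc_sum _ _ _))// (le_trans _ (ler_wpM2l (M0 x) (sW m)))//.
    rewrite mulr_sumr; apply: ler_sum => k _.
    by rewrite normcM normcX normcV mulrC ler_wpM2r ?exprn_ge0 ?normc_ge0.
  have b2 m : normc (\sum_(k < m) dlogder s (z k) x) <= S x * M x * (s.+1%:R * q x + M x).
    rewrite (le_trans (le_normc_sum _ _ _))// -mulrA mulrC.
    rewrite (le_trans _ (ler_wpM2l (mulr_ge0 (M0 x) (sqM0 x)) (sW m)))//.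
    rewrite mulr_sumr; apply: ler_sum => k _.
    rewrite /dlogder normcM normcM normcX normcV -mulrA mulrC ler_wpM2r ?exprn_ge0 ?normc_ge0//.
    rewrite ler_pM ?invr_ge0 ?normc_ge0// (le_trans (le_normcB _ _))// normcV lerD//.
    rewrite -mulrA normcM normc_nat ler_wpM2l// normcM normcV normc_conj.
    have dp : 0 < normc (1 - (z k)^*%C * x) by rewrite normc_gt0 denom_neq0.
    rewrite ler_pdivrMr// (le_trans (ltW (z1 k)))// /q ger0_norm; last by rewrite invr_ge0 subr_ge0 ltW.
    by rewrite ler_pdivlMl ?subr_gt0// mulr1 denom_ge_r.
  split.
    apply: (tends_le_scale (u := dpprod z s ^~ x) (v := pprod z s ^~ x)) => [|||m].
    - by rewrite /T !addr_ge0// !mulr_ge0.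
    - exact: utends_tends.
    - exact: utends_tends.
    rewrite dpprod_off// normcM ler_wpM2r ?normc_ge0// (le_trans (b1 m))// /T lerDl.
    by rewrite addr_ge0// mulr_ge0.
  apply: (tends_le_scale (u := d2pprod z s ^~ x) (v := pprod z s ^~ x)) => [|||m].
  - by rewrite /T !addr_ge0// !mulr_ge0.
  - exact: utends_tends.
  - exact: utends_tends.
  rewrite d2pprod_off// normcM ler_wpM2r ?normc_ge0// (le_trans (le_normcD _ _))//.
  have b3 : normc ((\sum_(k < m) logder s (z k) x) ^+ 2) <= M x * S x * (M x * S x).
    by rewrite normcX expr2 ler_pM ?normc_ge0.
  by rewrite (le_trans (lerD b3 (b2 m)))// /T lerDr.
Qed.

End ZeroFunction.

(** * The differential equation *)

Section Quotients.
Variables (R : realType) (z : nat -> R[i]) (L : R -> R).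
Local Notation C := R[i].
Local Notation W := unit_kernel.
Hypothesis z1 : forall n, normc (z n) < 1.
Hypothesis gL : gauge L.

(** The growth constant does not depend on the zero [c]: at distance at least [(1 - |x|) / 4] one
    divides directly, closer the Lipschitz bound at [x] applies, and at [c] itself the
    derivative. *)
Lemma tame_divide f f1 : anal f -> tamef L f -> (forall x, normc x < 1 -> cder f x (f1 x)) ->
  exists2 K : R, 0 <= K & forall c, normc c < 1 -> f c = 0 ->
    exists g : C -> C, [/\ anal g, forall x, normc x < 1 -> f x = (x - c) * g x, g c = f1 c &
      forall x, normc x < 1 -> normc (g x) <= expR (K * L (normc x))].
Proof.
move=> af tf df; have t1 := tame_cder gL af tf df.
case: (tf) => K0 K00 hK0; have [KL tKL [KL0 hKL]] := tame_lipschitz gL K00.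
have q0 (x : C) : 0 <= `|(1 - normc x)^-1| by [].
have tq : tame L (fun x => `|(1 - normc x)^-1|).
  apply: (tame_le _ (tame_inv gL)) => x x1.
  by rewrite ger0_norm// invr_ge0 subr_ge0 ltW.
have f0 x : 0 <= normc (f x) by exact: normc_ge0.
have tA : tame L (fun x => 4 * (`|(1 - normc x)^-1| * normc (f x))).
  have tqf := tameM q0 f0 tq tf.
  have qf0 (x : C) : 0 <= `|(1 - normc x)^-1| * normc (f x) by exact: mulr_ge0.
  exact: (tameM (fun=> ler0n R 4) qf0 (tame_cst gL 4) tqf).
have [K Kge0 hK] := tameD gL tA (tameD gL tKL t1); exists K => // c c1 fc.
have [g ag hg] := anal_divdiff af c1; exists g.
have hg' x : normc x < 1 -> f x = (x - c) * g x by move=> x1; rewrite -hg// fc subr0.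
have gc : g c = f1 c.
  have [g1 _ dg] := anal_cder ag.
  have e0 : 0 < 1 - normc c by rewrite subr_gt0.
  apply: esym; apply: (cder_unique (df c c1)).
  apply: cder_near e0 _ (cder_eq (cderM (cderB (cder_id c) (cder_cst c c)) (dg c c1)) _) => [h hh|].
    by rewrite hg'// (le_lt_trans (le_normcD _ _))//; lra.
  by rewrite subrr mul0r addr0 subr0 mul1r.
split => // x x1; apply: le_trans (hK x x1).
have A0 y : 0 <= 4 * (`|(1 - normc y)^-1| * normc (f y)) by rewrite mulr_ge0// mulr_ge0.
have [->|xc] := eqVneq x c.
  by rewrite gc; have := A0 c; have := KL0 c; lra.
have xc0 : 0 < normc (x - c) by rewrite normc_gt0 subr_eq0.
have -> : normc (g x) = normc (f x) / normc (x - c).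
  by rewrite hg'// normcM mulrC mulKf// lt0r_neq0.
have [h|h] := leP ((1 - normc x) / 4) (normc (x - c)).
  apply: (@le_trans _ _ (4 * (`|(1 - normc x)^-1| * normc (f x)))); last first.
    by rewrite lerDl addr_ge0 ?normc_ge0.
  have p : 0 < (1 - normc x) / 4 by rewrite divr_gt0// subr_gt0.
  have -> (q u : R) : 4 * (q * u) = u * (4 * q) by ring.
  apply: ler_wpM2l; first exact: normc_ge0.
  rewrite (@le_trans _ _ ((1 - normc x) / 4)^-1)// ?lef_pV2 ?posrE//.
  by rewrite invf_div ler_wpM2l// ler_norm.
rewrite ler_pdivrMr// (@le_trans _ _ (KL x * normc (x - c)))//; last first.
  rewrite ler_wpM2r ?normc_ge0// addrCA lerDl addr_ge0 ?normc_ge0//.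
have := hKL f af hK0 x x c x1; rewrite fc subr0; apply; have := normc_ge0 x; first by lra.
have : normc c <= normc x + normc (x - c) by rewrite -{1}(subKr x c) le_normcB.
by lra.
Qed.

Section Quotient.
Variables P P1 P2 : C -> C.
Hypothesis zfP : zero_function z L P P1 P2.

Lemma zf_root n : P (z n) = 0.
Proof. by apply/(zf_zero zfP (z1 n)); exists n. Qed.

Lemma zf_simple n : P1 (z n) != 0.
Proof.
by case: (zf_low zfP) => K _ /(_ n); rewrite -normc_gt0; apply: lt_le_trans; exact: expR_gt0.
Qed.

Lemma zf_tame1 : tamef L P1.
Proof. exact: (tame_cder gL (zf_anal zfP) (zf_tame zfP) (zf_cder zfP)). Qed.

Lemma zf_tame2 : tamef L P2.
Proof. exact: (tame_cder gL (zf_anal1 zfP) zf_tame1 (zf_cder1 zfP)). Qed.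

Variable T : C -> C.
Hypothesis aT : anal T.
Hypothesis tT : tamef L T.
Hypothesis T0 : forall n, T (z n) = 0.
Hypothesis Tfar : forall B : R, 0 <= B -> exists2 S : C -> R, tame L S & forall x, normc x < 1 ->
    (forall k, expR (- (B * L (normc (z k)))) <= normc (x - z k)) ->
    normc (T x) <= S x * normc (P x).

(** Outside the small discs [Tfar] bounds [T / P]. Near [z n], both functions are divided by
    [x - z n]; the reduced [P] takes the value [P1 (z n)] at [z n] and keeps at least half of it on
    the disc, so the quotient costs only [exp (O (L(z n)))]. *)
Lemma quotient_by_zf : exists Q : C -> C, [/\ forall x, normc x < 1 -> exists l, cder Q x l,
  forall x, normc x < 1 -> Q x * P x = T x & tamef L Q].
Proof.
have [T1 aT1 dT] := anal_cder aT.
have [KT KT0 hT] := tame_divide aT tT dT.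
have [KP KP0 hP] := tame_divide (zf_anal zfP) (zf_tame zfP) (zf_cder zfP).
pose Q x := if P x == 0 then T1 x / P1 x else T x / P x.
(* near a zero [z n], [Q] is the quotient of the two reduced functions *)
have loc n : exists g t : C -> C, [/\ [/\ anal g, forall x, normc x < 1 -> P x = (x - z n) * g x,
     g (z n) = P1 (z n) & forall x, normc x < 1 -> normc (g x) <= expR (KP * L (normc x))],
     anal t, forall x, normc x < 1 -> normc (t x) <= expR (KT * L (normc x)) &
     forall x, normc x < 1 -> g x != 0 -> Q x = t x / g x].
  have [g [ag hg gz gb]] := hP _ (z1 n) (zf_root n).
  have [t [at_ ht tz tb]] := hT _ (z1 n) (T0 n).
  exists g, t; split => // x x1 gx0; rewrite /Q.
  have [->|xz] := eqVneq x (z n); first by rewrite zf_root eqxx gz tz.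
  have xz0 : x - z n != 0 by rewrite subr_eq0.
  by rewrite hg// mulf_eq0 (negPf xz0) (negPf gx0)/= ht//; field; rewrite ?xz0 ?gx0.
exists Q; split.
- move=> x x1; have [/(zf_zero zfP x1)[n ->]|Px] := eqVneq (P x) 0.
    have [g [t [[ag _ gz _] at_ _ Qgt]]] := loc n.
    have [g1 _ dg] := anal_cder ag; have [t1 _ dt] := anal_cder at_.
    have gz0 : g (z n) != 0 by rewrite gz zf_simple.
    have gp : 0 < normc (g (z n)) / 2 by rewrite divr_gt0 ?normc_gt0.
    have [d d0 hd] := cder_cont (dg _ (z1 n)) gp.
    have dd0 : 0 < Num.min d (1 - normc (z n)) by rewrite lt_min d0 subr_gt0 z1.
    eexists; apply: cder_near dd0 _ (cderM (dt _ (z1 n)) (cderV (dg _ (z1 n)) gz0)).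
    move=> h; rewrite lt_min => /andP[/hd h1 h2]; apply: Qgt.
      by rewrite (le_lt_trans (le_normcD _ _))//; lra.
    rewrite -normc_gt0 (lt_le_trans gp)//.
    have : normc (g (z n)) <= normc (g (z n + h)) + normc (g (z n + h) - g (z n)).
      by rewrite -{1}(subKr (g (z n + h)) (g (z n))) le_normcB.
    by lra.
  have pp : 0 < normc (P x) / 2 by rewrite divr_gt0 ?normc_gt0.
  have [d d0 hd] := cder_cont (zf_cder zfP x1) pp.
  eexists; apply: cder_near d0 _ (cderM (dT _ x1) (cderV (zf_cder zfP x1) Px)) => h /hd h1.
  rewrite /Q ifN// -normc_gt0 (lt_le_trans pp)//.
  have : normc (P x) <= normc (P (x + h)) + normc (P (x + h) - P x).
    by rewrite -{1}(subKr (P (x + h)) (P x)) le_normcB.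
  by lra.
- move=> x x1; rewrite /Q; have [Px|Px] := eqVneq (P x) 0; last by rewrite divfK.
  by rewrite Px mulr0; case/(zf_zero zfP x1): Px => n ->; rewrite T0.
have [Kl Kl0 low] := zf_low zfP.
have [KL tKL [KL0 hKL]] := tame_lipschitz gL KP0.
case: tKL => K3 K30 hK3.
have [Kd Kd0 hKd] := tameD gL (tame_inv gL) (tame_cst gL 4).
(* [K3] beats the Lipschitz constant of the reduced [P], [Kl] its lower bound at [z n], and [1]
   supplies the factor [2] in [E2]. The part [2 * Kd] keeps the radius below [(1 - |z n|) / 4]. *)
pose B := K3 + Kl + 1 + 2 * Kd.
have B0 : 0 <= B by rewrite !addr_ge0// mulr_ge0.
have [S tS far] := Tfar B0.
have [Ks Ks0 scale] := gauge_scale gL 1.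
have tU : tame L (fun x => 2 * (expR (KT * L (normc x)) * expR (Kl * Ks * L (normc x)))).
  have e0 (K : R) (x : C) : 0 <= expR (K * L (normc x)) by exact: expR_ge0.
  have te := tameM (e0 KT) (e0 (Kl * Ks)) (tame_exp L KT0) (tame_exp L (mulr_ge0 Kl0 Ks0)).
  have ee0 (x : C) : 0 <= expR (KT * L (normc x)) * expR (Kl * Ks * L (normc x)) by rewrite mulr_ge0 ?expR_ge0.
  exact: (tameM (fun=> ler0n R 2) ee0 (tame_cst gL 2) te).
have [KQ KQ0 hKQ] := tameD gL tS tU.
suff H x : normc x < 1 -> normc (Q x) <= S x \/
    normc (Q x) <= 2 * (expR (KT * L (normc x)) * expR (Kl * Ks * L (normc x))).
  have [KS KS0 hS] := tS; have [KU KU0 hU] := tU.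
  exists (KS + KU); first exact: addr_ge0.
  move=> x x1; have Lx := gauge_ge0 gL x1; case: (H x x1) => h; rewrite (le_trans h)//.
    by rewrite (le_trans (hS x x1))// ler_expR ler_wpM2r// lerDl.
  by rewrite (le_trans (hU x x1))// ler_expR ler_wpM2r// lerDr.
move=> x1; have x0 := normc_ge0 x.
have [h|] := pselect (forall k, expR (- (B * L (normc (z k)))) <= normc (x - z k)).
  left; have Px0 : P x != 0.
    apply/eqP => /(zf_zero zfP x1)[n xz]; have := h n.
    by rewrite xz subrr normc0 leNgt expR_gt0.
  rewrite /Q ifN// normcM normcV ler_pdivrMr ?normc_gt0//.
  exact: (far x x1 h).
move=> /existsNP[n /negP]; rewrite -ltNge => near; right.
have Ln := gauge_ge1 gL (z1 n); have Ln0 := gauge_ge0 gL (z1 n).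
set l := L (normc (z n)) in near Ln Ln0.
have hd := hKd _ (z1 n); rewrite -/l in hd.
have in0 : 0 < (1 - normc (z n))^-1 by rewrite invr_gt0 subr_gt0.
have E1 : expR (- (B * l)) <= (1 - normc (z n)) / 4.
  rewrite expRN invf_ple ?posrE ?expR_gt0 ?divr_gt0 ?subr_gt0//.
  rewrite invf_div (le_trans _ (_ : expR (Kd * l) * expR (Kd * l) <= _))//; last first.
    rewrite -expRD ler_expR /B.
    by have := mulr_ge0 K30 Ln0; have := mulr_ge0 Kl0 Ln0; lra.
  by rewrite ler_pM//; lra.
have E2 : KL (z n) * expR (- (B * l)) <= expR (- (Kl * l)) / 2.
  rewrite ler_pdivlMr// mulrAC.
  apply: (@le_trans _ _ (expR (K3 * l) * expR l * expR (- (B * l)))).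
    rewrite ler_wpM2r ?expR_ge0// ler_pM// ?hK3//.
    by rewrite (le_trans _ (expR_ge1Dx _))//; lra.
  rewrite -!expRD ler_expR /B !mulrDl mul1r.
  by have := mulr_ge0 (mulr_ge0 (ler0n R 2) Kd0) Ln0; lra.
have zn0 := normc_ge0 (z n); have zn1 := z1 n.
have xzn : normc x <= normc (z n) + normc (x - z n).
  by rewrite -{1}(subrK (z n) x) addrC le_normcD.
have znx : normc (z n) <= normc x + normc (x - z n).
  by rewrite -{1}(subKr x (z n)) le_normcB.
have [g [t [[ag _ gz gb] at_ tb Qgt]]] := loc n.
have gl : normc (P1 (z n)) / 2 <= normc (g x).
  have := hKL g ag gb (z n) x (z n) zn1.
  have : normc (P1 (z n)) <= normc (g x) + normc (g x - P1 (z n)).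
    by rewrite -{1}(subKr (g x) (P1 (z n))) le_normcB.
  rewrite gz => h1 h2; have : normc (g x - P1 (z n)) <= KL (z n) * normc (x - z n).
    by apply: h2; lra.
  have : KL (z n) * normc (x - z n) <= KL (z n) * expR (- (B * l)).
    by rewrite ler_wpM2l// ltW.
  by have := low n; rewrite -/l; lra.
have P1p : 0 < normc (P1 (z n)) by rewrite normc_gt0 zf_simple.
have gx0 : 0 < normc (g x) by rewrite (lt_le_trans _ gl)// divr_gt0.
rewrite Qgt//; last by rewrite -normc_gt0.
rewrite normcM normcV mulrCA ler_pM ?invr_ge0 ?normc_ge0 ?tb//.
rewrite (@le_trans _ _ (normc (P1 (z n)) / 2)^-1)// ?lef_pV2 ?posrE ?divr_gt0//.
rewrite invf_div ler_wpM2l// invf_ple ?posrE ?expR_gt0// -expRN (le_trans _ (low n))//.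
rewrite ler_expR lerN2 -mulrA ler_wpM2l// scale ?x0 ?zn0//.
by rewrite expr1; lra.
Qed.

End Quotient.
End Quotients.

(** * Interpolation at the zeros with controlled growth *)

Section Interpolation.
Variables (R : realType) (z : nat -> R[i]) (L : R -> R) (s : nat).
Local Notation C := R[i].
Local Notation W := unit_kernel.
Hypothesis z1 : forall n, normc (z n) < 1.
Hypothesis zinj : injective z.
Hypothesis gL : gauge L.
Hypothesis wsum : kernel_sum_bound z L s.
Variables P P1 P2 : C -> C.
Hypothesis zfP : zero_function z L P P1 P2.

(* A power of the kernel at [z n], with exponent proportional to [L |z n|], absorbs
   data of size [exp (A L |z n|)]: away from [z n] the kernel is small, and near [z n]
   the gauge at [z n] is controlled by the gauge at [x]. *)
Lemma damping (A theta : R) : 0 <= A -> 0 < theta < 1 -> exists j : nat -> nat, forall N,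
  exists2 K : R, 0 <= K & forall n x, normc x < 1 ->
    expR (A * L (normc (z n))) * normc (W (z n) x) ^+ (j n + N) <= expR (K * L (normc x)) /\
    (normc (W (z n) x) <= theta ->
      expR (A * L (normc (z n))) * normc (W (z n) x) ^+ (j n + N) <= theta ^+ N).
Proof.
move=> A0 /andP[t0 t1].
pose l := - ln theta; have l0 : 0 < l by rewrite oppr_gt0 ln_lt0// t0.
have tE : theta = expR (- l) by rewrite opprK lnK.
(* As [theta = exp (- l)], this exponent gives [theta^(j n) <= exp (- A L(z n))]. *)
pose j n := (Num.truncn (A / l * L (normc (z n)))).+1.
exists j => N.
have small n x : normc x < 1 -> normc (W (z n) x) <= theta ->
   expR (A * L (normc (z n))) * normc (W (z n) x) ^+ (j n + N) <= theta ^+ N.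
  move=> x1 wt; have w0 := normc_ge0 (W (z n) x).
  apply: (@le_trans _ _ (expR (A * L (normc (z n))) * (theta ^+ j n * theta ^+ N))).
    by rewrite ler_wpM2l ?expR_ge0// -exprD lerXn2r ?nnegrE// ltW.
  rewrite mulrA ler_piMl ?exprn_ge0 ?(ltW t0)//.
  rewrite {1}tE -expRM_natl -expRD expR_le1 mulrN subr_le0.
  have := truncnS_gt (A / l * L (normc (z n))); rewrite -/(j n) => /ltW.
  by rewrite mulrAC ler_pdivrMr.
have [i hi] : exists i : nat, 2 / theta <= 2 ^+ i.
  exists (Num.truncn (2 / theta)).+1; rewrite (le_trans (ltW (truncnS_gt _)))//.
  by rewrite -natrX ler_nat ltnW// ltn_expl.
have [Ks Ks0 hs] := gauge_scale gL i.
have Al0 : 0 <= A / l by rewrite divr_ge0// ltW.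
pose K := A * Ks + (A / l * Ks + (1 + N%:R)).
have K0 : 0 <= K by rewrite !addr_ge0// mulr_ge0.
exists K => // n x x1; split; last exact: small.
have Lx := gauge_ge1 gL x1; have Lx0 := gauge_ge0 gL x1.
have [wt|wt] := leP (normc (W (z n) x)) theta.
  rewrite (le_trans (small n x x1 wt))// (@le_trans _ _ 1)//.
    by rewrite exprn_ile1// ltW.
  by rewrite -[leLHS]expR0 ler_expR mulr_ge0.
(* A kernel above [theta] means [theta |1 - conj (z n) x| < 1 - |z n|^2 <= 2 (1 - |z n|)], hence
   [1 - |x| <= (2 / theta) (1 - |z n|)]: the point [x] is no farther from the circle than [z n], up
   to a constant. *)
have Ln : L (normc (z n)) <= Ks * L (normc x).
  have zn0 := normc_ge0 (z n).
  apply: hs; rewrite ?normc_ge0 ?x1 ?z1//.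
  apply: le_trans (ler_wpM2r _ hi); last by rewrite subr_ge0 ltW.
  rewrite mulrAC ler_pdivlMr//.
  have d0 : 0 < normc (1 - (z n)^*%C * x) by rewrite normc_gt0 denom_neq0.
  move: wt; rewrite normc_kernel// ltr_pdivlMr// => wt.
  have := denom_ge_r x (z1 n).
  have := sqr_normc_lt1 (z1 n); have := z1 n; move: wt d0 zn0 t0.
  move: (normc (z n)) (normc (1 - _)) (normc x) => u v w.
  by nra.
apply: (@le_trans _ _ (expR (A * (Ks * L (normc x))) * expR (1 *+ (j n + N)))).
  rewrite ler_pM ?expR_ge0 ?exprn_ge0 ?normc_ge0//.
    by rewrite ler_expR ler_wpM2l.
  rewrite -mulr_natl expRM_natl lerXn2r ?nnegrE ?normc_ge0 ?expR_ge0//.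
  rewrite (le_trans (kernel_le2 (z1 n) x1))//.
  by rewrite (le_trans _ (expR_ge1Dx _)).
rewrite -expRD ler_expR natrD.
have jn : (j n)%:R <= A / l * (Ks * L (normc x)) + 1.
  have tl : (Num.truncn (A / l * L (normc (z n))))%:R <= A / l * L (normc (z n)).
    by rewrite truncn_le mulr_ge0 ?gauge_ge0.
  by rewrite /j -addn1 natrD lerD2r (le_trans tl)// ler_wpM2l.
have : N%:R <= N%:R * L (normc x) by rewrite ler_peMr.
move: jn; rewrite /K; move: (N%:R) ((j n)%:R) (A / l) => a b c jn na.
by lra.
Qed.

(** A Lagrange series: [Q n = P / (x - z n)] vanishes at the other zeros and equals [P1 (z n)] at
    [z n], where every power of the kernel is [1]. The powers of the kernel therefore control size
    without touching the values. *)
Lemma interpolation (b : nat -> C) (A theta rho e : R) : 0 <= A ->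
  (forall n, normc (b n) <= expR (A * L (normc (z n)))) -> 0 < theta < 1 -> rho < 1 -> 0 < e ->
  (forall n x, normc x <= rho -> normc (W (z n) x) <= theta) ->
  exists h : C -> C, [/\ anal h, tamef L h, forall n, h (z n) = b n &
    forall x, normc x <= rho -> normc (h x) <= e].
Proof.
move=> A0 hb th rho1 e0 hrho.
have [Kl Kl0 low] := zf_low zfP.
have [KP KP0 hP] := tame_divide gL (zf_anal zfP) (zf_tame zfP) (zf_cder zfP).
have [Q hQ] := choice (fun n => hP (z n) (z1 n) (zf_root z1 zfP n)).
pose beta n := b n / P1 (z n).
have A1 : 0 <= A + Kl by exact: addr_ge0.
have hbeta n : normc (beta n) <= expR ((A + Kl) * L (normc (z n))).
  have p1 := zf_simple zfP n.
  rewrite normcM normcV ler_pdivrMr ?normc_gt0// (le_trans (hb n))//.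
  rewrite (le_trans _ (ler_wpM2l (expR_ge0 _) (low n)))// -expRD ler_expR mulrDl.
  by rewrite addrK.
have [j hj] := damping A1 th.
case: (wsum) => Kw Kw0 hw; case: (gL) => L1 Lm _ _.
have [N hN] : exists N : nat, theta ^+ N * (expR (KP * L rho) * (Kw * L rho)) <= e.
  have : (fun n => theta ^+ n) @ \oo --> (0 : R).
    by apply: cvg_expr; case/andP: th => t0 t1; rewrite gtr0_norm.
  set M := _ * _; have M1 : 0 < `|M| + 1 by rewrite ltr_wpDl.
  move=> /cvgrPdist_lt/(_ _ (divr_gt0 e0 M1))[N _ /(_ N (leqnn _))/=].
  rewrite sub0r normrN => h; exists N; rewrite (le_trans (ler_norm _))// normrM.
  have := ltW h; rewrite ler_pdivlMr//; apply: le_trans.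
  by rewrite ler_wpM2l// lerDl.
have [Kd Kd0 hKd] := hj N.
(* [j n] damps the coefficient, [s + 1] makes the series converge by the kernel sum, and [N] makes
   it small where all kernels are at most [theta]. *)
pose u n x := beta n * Q n x * W (z n) x ^+ (j n + N + s.+1).
have t0 : 0 < theta by case/andP: th.
have bu n x (G : R) : normc x < 1 ->
    expR ((A + Kl) * L (normc (z n))) * normc (W (z n) x) ^+ (j n + N) <= G ->
    normc (u n x) <= G * expR (KP * L (normc x)) * normc (W (z n) x) ^+ s.+1.
  move=> x1 hG; rewrite /u normcM (normcM (beta n)) normcX exprD mulrA ler_wpM2r ?exprn_ge0 ?normc_ge0//.
  rewrite mulrAC ler_pM ?mulr_ge0 ?exprn_ge0 ?normc_ge0//; last by have [_ _ _ ->] := hQ n.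
  by apply: le_trans hG; rewrite ler_wpM2r ?exprn_ge0 ?normc_ge0.
have au n : anal (u n).
  have [aQ _ _ _] := hQ n.
  apply: analM; first by apply: analM => //; exact: anal_cst.
  by apply: analX; exact: anal_kernel.
have [h ah uh] : exists2 F, anal F & utends (fun m x => \sum_(k < m) u k x) F.
  apply: (anal_series (d := fun k => (1 - normc (z k)) ^+ s.+1)) => //.
  - by move=> k; exact: dist_ge0.
  - exact: summable_dist wsum.
  move=> r r1; have [r0|r0] := ltP r 0.
    by exists 0 => // k x /le_lt_trans/(_ r0); rewrite ltNge normc_ge0.
  exists (expR (Kd * L r) * expR (KP * L r) * (2 / (1 - r)) ^+ s.+1).
    by rewrite !mulr_ge0 ?expR_ge0// exprn_ge0// divr_ge0// subr_ge0 ltW.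
  move=> n x xr; have x1 := le_lt_trans xr r1.
  rewrite (le_trans (bu n x _ x1 (hKd n x x1).1))// -!mulrA.
  rewrite !ler_pM ?mulr_ge0 ?expR_ge0 ?exprn_ge0 ?normc_ge0//.
  - by rewrite ler_expR ler_wpM2l// Lm// normc_ge0.
  - by rewrite ler_expR ler_wpM2l// Lm// normc_ge0.
  - exact: kernel_pow_le.
exists h; split => //.
- have tB : tame L (fun x => expR (Kd * L (normc x)) * expR (KP * L (normc x)) * `|Kw * L (normc x)|).
    have ee0 K (x : C) : 0 <= expR (K * L (normc x)) by exact: expR_ge0.
    have ee (x : C) : 0 <= expR (Kd * L (normc x)) * expR (KP * L (normc x)) by rewrite mulr_ge0 ?expR_ge0.
    apply: (tameM ee (fun=> normr_ge0 _)); first exact: (tameM (ee0 _) (ee0 _) (tame_exp L Kd0) (tame_exp L KP0)).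
    apply: (tame_le _ (tame_gauge L Kw0)) => x x1.
    by rewrite ger0_norm// mulr_ge0 ?gauge_ge0.
  apply: (tame_le _ tB) => x x1; apply: (tends_le (utends_tends uh x1)).
  exists 0%N => // m _; rewrite (le_trans (le_normc_sum _ _ _))//.
  have E0 : 0 <= expR (Kd * L (normc x)) * expR (KP * L (normc x)) by rewrite mulr_ge0 ?expR_ge0.
  apply: le_trans (ler_wpM2l E0 (le_trans (hw m x x1) (ler_norm _))).
  by rewrite mulr_sumr; apply: ler_sum => k _; rewrite bu//; exact: (hKd k x x1).1.
- move=> n; apply: (tends_unique (utends_tends uh (z1 n))).
  apply: tends_near (tends_cst _); exists n.+1 => // m /= nm.
  rewrite (bigD1 (Ordinal nm)) //= big1 ?addr0.
    have [_ _ Qn _] := hQ n.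
    by rewrite /u kernel_diag// expr1n mulr1 Qn /beta divfK//; exact: (zf_simple zfP).
  move=> k kn; have [_ hQk _ _] := hQ k.
  have := hQk _ (z1 n); rewrite (zf_root z1 zfP) => /esym/eqP.
  rewrite mulf_eq0 subr_eq0 => /orP[/eqP/zinj nk|/eqP Q0]; last by rewrite /u Q0 mulr0 mul0r.
  by case/negP: kn; apply/eqP/val_inj.
- move=> x xr; have x1 := le_lt_trans xr rho1; have x0 := normc_ge0 x.
  apply: (tends_le (utends_tends uh x1)); exists 0%N => // m _.
  apply: le_trans hN; rewrite (le_trans (le_normc_sum _ _ _))//.
  apply: (@le_trans _ _ (theta ^+ N * expR (KP * L (normc x)) * (Kw * L (normc x)))).
    have E0 : 0 <= theta ^+ N * expR (KP * L (normc x)).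
      by rewrite mulr_ge0 ?expR_ge0 ?exprn_ge0// ltW.
    apply: le_trans (ler_wpM2l E0 (hw m x x1)).
    rewrite mulr_sumr; apply: ler_sum => k _; rewrite bu//.
    by apply: (hKd k x x1).2; exact: hrho.
  have Lx : L (normc x) <= L rho by rewrite Lm.
  have Lx0 := gauge_ge0 gL x1.
  rewrite -mulrA ler_wpM2l ?exprn_ge0 ?(ltW t0)// ler_pM ?expR_ge0 ?mulr_ge0//.
    by rewrite ler_expR ler_wpM2l.
  by rewrite ler_wpM2l.
Qed.

End Interpolation.

Section Genus.
Variables (R : realType) (z : nat -> R[i]) (L : R -> R) (s : nat).
Local Notation C := R[i].
Local Notation W := unit_kernel.
Hypothesis z1 : forall n, normc (z n) < 1.
Hypothesis gL : gauge L.
Hypothesis wsum : kernel_sum_bound z L s.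

Lemma kernel_sum_genus N : kernel_sum_bound z L (s + N).
Proof.
case: wsum => K K0 hK; exists (2 ^+ N * K); first by rewrite mulr_ge0 ?exprn_ge0.
move=> m x x1; rewrite -mulrA; apply: le_trans (ler_wpM2l _ (hK m x x1)).
  rewrite mulr_sumr; apply: ler_sum => k _.
  rewrite -addSn exprD mulrC ler_wpM2r ?exprn_ge0 ?normc_ge0//.
  by rewrite lerXn2r ?nnegrE ?normc_ge0// kernel_le2.
by rewrite exprn_ge0.
Qed.

Lemma log_poly_genus N (w : C) : log_poly (s + N) w - log_poly s w = \sum_(s.+1 <= j < (s + N).+1) w ^+ j / j%:R.
Proof.
rewrite /log_poly (@big_cat_nat _ _ _ s.+1 1 (s + N).+1) //=; last by rewrite ltnS leq_addr.
by rewrite addrAC subrr add0r.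
Qed.

Lemma log_poly_genus_le N (w : C) : normc w <= 2 ->
  normc (log_poly (s + N) w - log_poly s w) <= N%:R * 2 ^+ N * normc w ^+ s.+1.
Proof.
move=> w2; rewrite log_poly_genus (le_trans (le_normc_sum _ _ _))//.
apply: (@le_trans _ _ (\sum_(s.+1 <= j < (s + N).+1) 2 ^+ N * normc w ^+ s.+1)); last first.
  by rewrite sumr_const_nat subSS addKn -[leLHS]mulr_natl mulrA.
rewrite !big_nat; apply: ler_sum => j /andP[sj jN].
rewrite normcM normcX normcV normc_nat.
have -> : j = (s.+1 + (j - s.+1))%N by rewrite subnKC.
rewrite exprD -mulrA mulrC ler_wpM2r ?exprn_ge0 ?normc_ge0//.
apply: (@le_trans _ _ (2 ^+ (j - s.+1))).
  rewrite ler_pdivrMr; last by rewrite ltr0n.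
  rewrite -[leLHS]mulr1 ler_pM ?exprn_ge0 ?normc_ge0// ?lerXn2r ?nnegrE ?normc_ge0//.
  by rewrite ler1n.
by rewrite ler_weXn2l ?ler1n//; lia.
Qed.

(** Raising the genus multiplies each factor by the exponential of at most [N 2^N |W|^(s+1)] in
    modulus, and these exponents are summable by the kernel bound. *)
Lemma product_low_genus N : product_low z L s -> product_low z L (s + N).
Proof.
case=> K K0 hK; case: wsum => Kw Kw0 hw; pose c : R := N%:R * 2 ^+ N.
have c0 : 0 <= c by rewrite mulr_ge0// exprn_ge0.
exists (K + c * Kw) => [|n]; first by rewrite addr_ge0// mulr_ge0.
have [N0 hN0] := hK n; exists N0 => m /hN0 h.
have E k : zfactor (s + N) (z k) (z n) = zfactor s (z k) (z n) *
    cexp (log_poly (s + N) (W (z k) (z n)) - log_poly s (W (z k) (z n))).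
  by rewrite /zfactor -mulrA -cexpD (addrC (log_poly s _)) subrK.
have -> : \prod_(k < m | k != n :> nat) normc (zfactor (s + N) (z k) (z n)) =
   \prod_(k < m | k != n :> nat) normc (zfactor s (z k) (z n)) *
   \prod_(k < m | k != n :> nat) normc (cexp (log_poly (s + N) (W (z k) (z n)) - log_poly s (W (z k) (z n)))).
  by rewrite -big_split; apply: eq_bigr => k _; rewrite E normcM.
rewrite mulrDl opprD expRD ler_pM ?expR_ge0//.
apply: (@le_trans _ _ (\prod_(k < m | k != n :> nat) expR (- (c * normc (W (z k) (z n)) ^+ s.+1)))).
  rewrite -expR_sum ler_expR sumrN lerN2 -mulrA.
  apply: le_trans (ler_wpM2l c0 (hw m _ (z1 n))); rewrite mulr_sumr big_mkcond /=.
  by apply: ler_sum => k _; case: ifP => // _; rewrite mulr_ge0// exprn_ge0// normc_ge0.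
apply: ler_prod => k _; rewrite expR_ge0/= (le_trans _ (ge_normc_cexp _))//.
by rewrite ler_expR lerN2 log_poly_genus_le// kernel_le2.
Qed.

Lemma log_polyR_le n (t : R) : 0 <= t < 1 -> log_polyR n t <= (1 - t)^-1.
Proof.
move=> t01; case/andP: (t01) => t0 t1.
apply: (@le_trans _ _ (\sum_(1 <= j < n.+1) t ^+ j)).
  rewrite /log_polyR !big_nat; apply: ler_sum => j /andP[j0 _].
  by rewrite ler_pdivrMr ?ltr0n// ler_peMr ?exprn_ge0// ler1n.
apply: le_trans (geo_sum_le n.+1 t01).
by rewrite -(big_mkord xpredT (fun j => t ^+ j)) [leRHS]big_ltn// lerDr exprn_ge0.
Qed.

(** Each extra power of the kernel gains a factor [theta], while the exponentials in the factors
    stay below [exp (1 / (1 - theta))] for every genus. *)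
Lemma pprod_near1 (theta rho e : R) : 0 < theta < 1 -> rho < 1 -> 0 < e ->
  (forall n x, normc x <= rho -> normc (W (z n) x) <= theta) ->
  exists N, forall m x, normc x <= rho -> normc (pprod z (s + N) m x - 1) <= e.
Proof.
move=> /andP[t0 t1] rho1 e0 hrho; case: wsum => K K0 hK; case: (gL) => L1 Lm _ _.
pose M := expR (1 - theta)^-1 * (K * L rho).
have d0 : 0 < ln (1 + e) by rewrite ln_gt0// ltrDl.
have [N hN] : exists N : nat, theta ^+ N * M <= ln (1 + e).
  have : (fun n => theta ^+ n) @ \oo --> (0 : R) by apply: cvg_expr; rewrite gtr0_norm.
  have M1 : 0 < `|M| + 1 by rewrite ltr_wpDl.
  move=> /cvgrPdist_lt/(_ _ (divr_gt0 d0 M1))[N _ /(_ N (leqnn _))/=].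
  rewrite sub0r normrN => h; exists N; rewrite (le_trans (ler_norm _))// normrM.
  have := ltW h; rewrite ler_pdivlMr//; apply: le_trans.
  by rewrite ler_wpM2l// lerDl.
exists N => m x xr; have x1 := le_lt_trans xr rho1.
rewrite (le_trans (prod_sub1_le _ _))// lerBlDr [leRHS]addrC.
rewrite -[leRHS]lnK ?posrE ?addr_gt0// ler_expR (le_trans _ hN)//.
apply: (@le_trans _ _ (theta ^+ N * (expR (1 - theta)^-1 * \sum_(k < m) normc (W (z k) x) ^+ s.+1))).
  rewrite !mulr_sumr; apply: ler_sum => k _; have wt := hrho k x xr.
  (* A point at the origin would have the constant kernel [1 > theta]. *)
  have zk : z k != 0.
    apply/eqP => zk; move: wt; rewrite zk kernel0 normc1; lra.
  rewrite factorE// (le_trans (primary_factor_sub1 _ wt))//.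
  have -> : normc (W (z k) x) ^+ (s + N).+1 = normc (W (z k) x) ^+ N * normc (W (z k) x) ^+ s.+1.
    by rewrite -exprD addnS addnC.
  rewrite -mulrA (mulrC (_ ^+ s.+1)) ler_pM ?mulr_ge0 ?expR_ge0 ?exprn_ge0 ?normc_ge0//.
    by rewrite lerXn2r ?nnegrE ?normc_ge0// ltW.
  rewrite ler_wpM2r ?exprn_ge0 ?normc_ge0// ler_expR log_polyR_le//.
  by rewrite t1 ltW.
rewrite ler_wpM2l ?exprn_ge0 ?(ltW t0)// ler_wpM2l ?expR_ge0// (le_trans (hK m x x1))//.
by rewrite ler_wpM2l// Lm// normc_ge0.
Qed.

End Genus.

Section Equation.
Variables (R : realType) (z : nat -> R[i]) (L : R -> R).
Local Notation C := R[i].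
Local Notation W := unit_kernel.
Hypothesis z1 : forall n, normc (z n) < 1.
Hypothesis zinj : injective z.
Hypothesis gL : gauge L.

Definition solves (a f : C -> C) :=
  [/\ analytic_in_disc (a : R[i]^o -> R[i]^o),
      analytic_in_disc (f : R[i]^o -> R[i]^o),
      forall w, unit_disc w -> derive1n 2 (f : R[i]^o -> R[i]^o) w + a w * f w = 0
    & forall w, unit_disc w -> (f w = 0 <-> exists k, w = z k)].

Variables P P1 P2 : C -> C.
Hypothesis zfP : zero_function z L P P1 P2.

Lemma solves_of_quotient (h h1 Q : C -> C) : anal h -> (forall x, normc x < 1 -> cder h x (h1 x)) ->
  (forall x, normc x < 1 -> exists l, cder h1 x l) ->
  (forall x, normc x < 1 -> exists l, cder Q x l) ->
  (forall x, normc x < 1 -> Q x * P x = P2 x + 2 * P1 x * h x) ->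
  exists f, solves (fun x => - (Q x + h1 x + h x ^+ 2)) f.
Proof.
move=> ah dh dh1 dQ QP; have [H aH dH] := anal_primitive ah.
pose f x := P x * cexp (H x); pose g x := (P1 x + P x * h x) * cexp (H x).
have dE x : normc x < 1 -> cder (fun x => cexp (H x)) x (cexp (H x) * h x).
  by move=> x1; exact: cder_comp (dH x x1) (cder_cexp _).
have df x : normc x < 1 -> cder f x (g x).
  move=> x1; apply: cder_eq (cderM (zf_cder zfP x1) (dE x x1)) _.
  by rewrite /g; ring.
have dg x : normc x < 1 -> cder g x ((P2 x + 2 * P1 x * h x + P x * (h1 x + h x ^+ 2)) * cexp (H x)).
  move=> x1; apply: cder_eq (cderM (cderD (zf_cder1 zfP x1) (cderM (zf_cder zfP x1) (dh x x1))) (dE x x1)) _.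
  by ring.
exists f; split => [w w1|w w1|w w1|w w1].
- have [l dl] := dQ w w1; have [l1 dl1] := dh1 w w1.
  have da := cderN (cderD (cderD dl dl1) (cderX 2 (dh w w1))).
  exact: (cder_derivable da).1.
- exact: (cder_derivable (df w w1)).1.
- rewrite derive1nS derive1n1.
  have w0 : 0 < 1 - normc w by rewrite subr_gt0.
  have : cder (derive1 (f : R[i]^o -> R[i]^o)) w
      ((P2 w + 2 * P1 w * h w + P w * (h1 w + h w ^+ 2)) * cexp (H w)).
    apply: (cder_near w0 _ (dg w w1)) => k kw; apply: (cder_derivable (df _ _)).2.
    by rewrite (le_lt_trans (le_normcD _ _))//; lra.
  by move=> /cder_derivable[_ ->]; rewrite -QP// /f; ring.
- rewrite -(zf_zero zfP w1) /f; split => [/eqP|->]; last by rewrite mul0r.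
  by rewrite mulf_eq0 (negPf (cexp_neq0 _)) orbF => /eqP.
Qed.

Lemma quotient_exists (h : C -> C) : anal h -> tamef L h ->
  (forall n, P2 (z n) + 2 * P1 (z n) * h (z n) = 0) ->
  exists Q : C -> C, [/\ forall x, normc x < 1 -> exists l, cder Q x l,
  forall x, normc x < 1 -> Q x * P x = P2 x + 2 * P1 x * h x & tamef L Q].
Proof.
move=> ah th h0.
have t1 := zf_tame1 gL zfP; have t2 := zf_tame2 gL zfP.
apply: (quotient_by_zf z1 gL zfP) => //.
- apply: analD; first exact: zf_anal2 zfP.
  apply: analM => //; apply: analM; [exact: anal_cst|exact: zf_anal1 zfP].
- apply: (tamefD gL) => //; apply: tamefM => //; apply: tamefM => //.
  exact: tamef_cst.
move=> B B0; have [T tT hT] := zf_far zfP B0.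
pose T' x := `|T x| .
have tT' : tame L (fun x => Num.max 0 (T x)).
  case: tT => K K0 hK; exists K => // x x1; rewrite ge_max expR_ge0/=; exact: hK.
have m0 x : 0 <= Num.max 0 (T x) by rewrite le_max lexx.
have n0 x : 0 <= 2 * normc (h x) by rewrite mulr_ge0 ?normc_ge0.
have t2h : tame L (fun x => 2 * normc (h x)).
  exact: (tameM (fun=> ler0n R 2) (fun x => normc_ge0 (h x)) (tame_cst gL 2) th).
exists (fun x => Num.max 0 (T x) + 2 * normc (h x) * Num.max 0 (T x)).
  by apply: (tameD gL) => //; exact: (tameM n0 m0 t2h tT').
move=> x x1 far; have [b1 b2] := hT x x1 far.
have TT : T x <= Num.max 0 (T x) by rewrite le_max lexx orbT.
rewrite (le_trans (le_normcD _ _))// [leRHS]mulrDl lerD//.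
  by rewrite (le_trans b2)// ler_wpM2r ?normc_ge0.
rewrite !normcM normc_nat [leLHS]mulrAC -[leRHS]mulrA ler_wpM2l//.
by rewrite (le_trans b1)// ler_wpM2r ?normc_ge0.
Qed.

End Equation.

Lemma cder_small (R : realType) (f : R[i] -> R[i]) l : cder f 0 l -> f 0 = 0 ->
  exists2 rho, 0 < rho < 1 & forall x, normc x <= rho -> normc (f x) <= 1.
Proof.
move=> /(_ 1 ltr01)[d d0 hd] f0; have l0 := normc_ge0 l.
exists (Num.min (d / 2) (2 + normc l)^-1).
  rewrite lt_min divr_gt0// invr_gt0 gt_min invf_lt1; lra.
move=> x; rewrite le_min => /andP[x1 x2].
have := hd x; rewrite add0r f0 subr0 mul1r => H.
have xd : normc x < d by lra.
have := le_trans (le_normc_sub (f x) (l * x)) (H xd); rewrite normcM.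
have x0 := normc_ge0 x.
have : normc x * (2 + normc l) <= 1 by rewrite -ler_pdivlMr ?div1r//; lra.
by lra.
Qed.

Section Solutions.
Variables (R : realType) (z : nat -> R[i]) (L : R -> R) (s : nat).
Local Notation C := R[i].
Local Notation W := unit_kernel.
Hypothesis z1 : forall n, normc (z n) < 1.
Hypothesis zinj : injective z.
Hypothesis gL : gauge L.
Hypothesis wsum : kernel_sum_bound z L s.

Lemma tame_coefficient (Q h h1 : C -> C) : tamef L Q -> anal h -> tamef L h ->
  (forall x, normc x < 1 -> cder h x (h1 x)) -> tamef L (fun x => - (Q x + h1 x + h x ^+ 2)).
Proof.
move=> tQ ah th dh; have th1 := tame_cder gL ah th dh.
apply: tamefN; apply: (tamefD gL) => //; first exact: tamefD.
by apply: (tame_le _ (tamefM th th)) => x _; rewrite expr2.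
Qed.

Lemma good_interpolant P P1 P2 (theta rho e : R) : zero_function z L P P1 P2 ->
  0 < theta < 1 -> rho < 1 -> 0 < e ->
  (forall n x, normc x <= rho -> normc (W (z n) x) <= theta) ->
  exists h : C -> C, [/\ anal h, tamef L h,
    forall n, P2 (z n) + 2 * P1 (z n) * h (z n) = 0 &
    forall x, normc x <= rho -> normc (h x) <= e].
Proof.
move=> zfP th rho1 e0 hrho.
have [K K0 hK] := zf_tame2 gL zfP; have [Kl Kl0 low] := zf_low zfP.
pose b n := - P2 (z n) / (2 * P1 (z n)).
have hb n : normc (b n) <= expR ((K + Kl) * L (normc (z n))).
  have p0 := zf_simple zfP n; have p1 : 0 < normc (P1 (z n)) by rewrite normc_gt0.
  rewrite /b normcM normcN normcV normcM normc_nat ler_pdivrMr ?mulr_gt0//.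
  rewrite (le_trans (hK _ (z1 n)))//.
  have := low n; rewrite mulrDl expRD expRN invf_ple ?posrE ?expR_gt0// => h.
  rewrite -mulrA ler_peMr ?expR_ge0//.
  have : 1 <= expR (Kl * L (normc (z n))) * normc (P1 (z n)).
    by rewrite -ler_pdivrMr// mul1r.
  by have := expR_ge0 (Kl * L (normc (z n))); move=> ? ?; rewrite mulrCA mulr_natl mulr2n; lra.
have KK : 0 <= K + Kl by exact: addr_ge0.
have [h [ah th' hz hs]] := interpolation z1 zinj gL wsum zfP KK hb th rho1 e0 hrho.
exists h; split => // n; rewrite hz /b; field.
by rewrite (zf_simple zfP).
Qed.

Lemma solve_at0 : product_low z L s ->
  exists a f : C -> C, [/\ solves z a f, tamef L a &
    exists2 rho, 0 < rho < 1 & forall x, normc x <= rho -> normc (a x) <= 1].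
Proof.
move=> low; have [P [P1 [P2 [zfP _ _]]]] := canonical_zero_function z1 gL wsum low.
have h12 : 0 < (2^-1 : R) < 1 by rewrite invr_gt0 ltr0n invf_lt1 ?ltr1n.
(* The disc of radius [-1] is empty, so the smallness clause of the interpolation is vacuous
   here. *)
have n1 : (-1 : R) < 1 by lra.
have vac n x : normc x <= -1 -> normc (W (z n) x) <= 2^-1.
  by move=> /(le_trans (normc_ge0 x)); rewrite ler0N1.
have [h0 [ah0 th0 hz0 _]] := good_interpolant zfP h12 n1 ltr01 vac.
have [h1 ah1 dh0] := anal_cder ah0.
have [Q [dQ QP tQ]] := quotient_exists z1 gL zfP ah0 th0 hz0.
(* Adding [l * P * e] to the interpolant keeps its values at the zeros of [P]; the
   coefficient at [0] is then affine in [l] and can be made to vanish. *)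
pose e x : C := if P 0 == 0 then 1 else x; pose e1 : C := if P 0 == 0 then 0 else 1.
have ae : anal e by rewrite /e; case: eqP => _; [exact: anal_cst|exact: anal_id].
have de x : cder e x e1 by rewrite /e /e1; case: eqP => _; [exact: cder_cst|exact: cder_id].
have te : tamef L e.
  apply: (tame_le _ (tame_cst gL 1)) => x x1; rewrite /e; case: ifP => _; last exact: ltW.
  by rewrite normc1.
have n10 : normc (0 : C) < 1 by rewrite normc0.
pose a0 := - (Q 0 + h1 0 + h0 0 ^+ 2).
(* If [P 0 = 0], then [e = 1], and the correction adds [2 l P1 0] to the quotient and [l P1 0] to
   the derivative of [h]. Otherwise [e x = x], and only the derivative of [h] changes at [0], by
   [l P 0]. *)
pose l := if P 0 == 0 then a0 / (3 * P1 0) else a0 / P 0.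
pose h x := h0 x + l * (P x * e x).
pose hd x := h1 x + l * (P1 x * e x + P x * e1).
pose Ql x := Q x + 2 * l * (P1 x * e x).
have aPe : anal (fun x => P x * e x) by apply: analM => //; exact: zf_anal zfP.
have ah : anal h by apply: analD => //; apply: analM => //; exact: anal_cst.
have th : tamef L h.
  apply: (tamefD gL) => //; apply: tamefM; first exact: tamef_cst.
  by apply: tamefM => //; exact: zf_tame zfP.
have dh x : normc x < 1 -> cder h x (hd x).
  by move=> x1; apply: cderD (dh0 x x1) (cderZ l (cderM (zf_cder zfP x1) (de x))).
have tQl : tamef L Ql.
  apply: (tamefD gL) => //; apply: tamefM; first exact: tamef_cst.
  by apply: tamefM => //; exact: (zf_tame1 gL zfP).
have ahd : forall x, normc x < 1 -> exists l, cder hd x l.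
  move=> x x1; have [h2 _ dh1] := anal_cder ah1; eexists.
  exact: cderD (dh1 x x1) (cderZ l (cderD (cderM (zf_cder1 zfP x1) (de x)) (cderM (zf_cder zfP x1) (cder_cst _ x)))).
have dQl x : normc x < 1 -> exists m, cder Ql x m.
  move=> x1; have [m dm] := dQ x x1; eexists.
  exact: cderD dm (cderZ _ (cderM (zf_cder1 zfP x1) (de x))).
have QlP x : normc x < 1 -> Ql x * P x = P2 x + 2 * P1 x * h x.
  by move=> x1; rewrite /Ql mulrDl QP// /h; ring.
have [f hf] := solves_of_quotient zfP ah dh ahd dQl QlP.
exists (fun x => - (Ql x + hd x + h x ^+ 2)), f; split => //; first exact: tame_coefficient dh.
have [m dm] := dQl 0 n10; have [m' dm'] := ahd 0 n10.
apply: (cder_small (cderN (cderD (cderD dm dm') (cderX 2 (dh 0 n10))))).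
rewrite /Ql /hd /h /l /e /e1; have [P0|P0] := eqVneq (P 0) 0.
  have p10 : P1 0 != 0.
    by case/(zf_zero zfP n10): P0 => n zn; have := zf_simple zfP n; rewrite -zn.
  by rewrite P0 /a0; field.
by rewrite /a0; field.
Qed.

Lemma solve_small (theta rho rho' : R) : product_low z L s -> 0 < theta < 1 ->
  rho < rho' -> rho' < 1 -> (forall n x, normc x <= rho' -> normc (W (z n) x) <= theta) ->
  exists a f : C -> C, [/\ solves z a f, tamef L a & forall x, normc x <= rho -> normc (a x) <= 1].
Proof.
move=> low th rr r1 hrho.
pose rho1 := (rho + rho') / 2.
have h1 : rho < rho1 by rewrite /rho1; lra.
have h2 : rho1 < rho' by rewrite /rho1; lra.
have rho11 : rho1 < 1 by lra.
pose K := 2 / (rho1 - rho) ^+ 2; pose K' := 2 / (rho' - rho1) ^+ 2.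
have K0 : 0 < K by rewrite divr_gt0// exprn_gt0// subr_gt0.
have K'0 : 0 < K' by rewrite divr_gt0// exprn_gt0// subr_gt0.
(* With Cauchy constants [K'] from [rho'] to [rho1] and [K] from [rho1] to [rho], the coefficient is
   at most [2 (K K' e + 2 K' e^2) + K e + e]. The last [1] ensures [e <= 1/2], hence
   [|P| >= 1/2]. *)
pose M := 2 * (K * K') + 4 * K' + K + 1 + 1.
have M0 : 0 < M by rewrite /M; have := mulr_gt0 K0 K'0; lra.
pose e := M^-1; have e0 : 0 < e by rewrite invr_gt0.
have e12 : e <= 2^-1.
  by rewrite lef_pV2 ?posrE// /M; have := mulr_gt0 K0 K'0; lra.
(* Raising the genus brings [P] close to [1], hence the coefficient close to [0], on the
   disc of radius [rho'], which is free of zeros. *)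
have [N hN] := pprod_near1 gL wsum th r1 e0 hrho.
have wsumN := kernel_sum_genus z1 wsum N.
have lowN := product_low_genus z1 wsum N low.
have [P [P1 [P2 [zfP uP _]]]] := canonical_zero_function z1 gL wsumN lowN.
have [h [ah th' hz hs]] := good_interpolant zfP th r1 e0 hrho.
have [hd ahd dh] := anal_cder ah.
have [Q [dQ QP tQ]] := quotient_exists z1 gL zfP ah th' hz.
have dhd : forall x, normc x < 1 -> exists l, cder hd x l.
  by move=> x x1; have [h3 _ dh1] := anal_cder ahd; exists (h3 x); exact: dh1.
have [f hf] := solves_of_quotient zfP ah dh dhd dQ QP.
exists (fun x => - (Q x + hd x + h x ^+ 2)), f; split => //; first exact: tame_coefficient dh.
move=> x xr; have x1 : normc x < 1 by lra.
have P1e w : normc w <= rho' -> normc (P w - 1) <= e.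
  move=> wr; have w1 := le_lt_trans wr r1.
  have uw : tends (fun m => pprod z (s + N) m w + - 1) (P w + - 1).
    by apply: tendsD (utends_tends uP w1) (tends_cst _).
  by apply: (tends_le uw); exists 0%N => // m _; exact: hN.
have dP1 w : normc w <= rho1 -> normc (P1 w) <= K' * e.
  move=> wr; have w1 : normc w < 1 by rewrite (le_lt_trans wr).
  have aP := analB (zf_anal zfP) (anal_cst 1).
  have dP := cderB (zf_cder zfP w1) (cder_cst 1 w).
  by have := anal_cder_le aP h2 r1 P1e wr dP; rewrite subr0.
have dP2 : normc (P2 x) <= K * (K' * e).
  exact: (anal_cder_le (zf_anal1 zfP) h1 rho11 dP1 xr (zf_cder1 zfP x1)).
have he w : normc w <= rho1 -> normc (h w) <= e by move=> wr; apply: hs; lra.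
have dhe : normc (hd x) <= K * e by exact: (anal_cder_le ah h1 rho11 he xr (dh x x1)).
have Pge : 2^-1 <= normc (P x).
  have : normc 1 <= normc (P x) + normc (P x - 1) by rewrite -{1}(subKr (P x) 1) le_normcB.
  rewrite normc1; have := P1e x; lra.
have Pp : 0 < normc (P x) by lra.
have xr1 : normc x <= rho1 by lra.
have b1 := dP1 x xr1; have b2 := he x xr1.
have Qe : normc (Q x) <= 2 * (K * (K' * e) + 2 * (K' * e) * e).
  rewrite -(ler_pM2r Pp) -normcM QP//.
  apply: (@le_trans _ _ (K * (K' * e) + 2 * (K' * e) * e)).
    rewrite (le_trans (le_normcD _ _))// lerD// !normcM normc_nat.
    by rewrite ler_pM ?mulr_ge0 ?normc_ge0// ler_wpM2l.
  have q0 : 0 <= K * (K' * e) + 2 * (K' * e) * e.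
    by have := mulr_gt0 K0 (mulr_gt0 K'0 e0); have := mulr_gt0 (mulr_gt0 K'0 e0) e0; lra.
  by move: q0 Pge; move: (K * _ + _) (normc _) => q p; nra.
have h2e : normc (h x ^+ 2) <= e * 1.
  by rewrite normcX expr2 ler_pM ?normc_ge0// (le_trans b2)//; lra.
rewrite normcN (le_trans (le_normcD _ _))// (@le_trans _ _ (2 * (K * (K' * e) + 2 * (K' * e) * e) + K * e + e * 1))//.
  by rewrite lerD// (le_trans (le_normcD _ _))// lerD.
have eM : e * M = 1 by rewrite mulVf// lt0r_neq0.
have ee : K' * e * e <= K' * e * 1.
  by rewrite ler_wpM2l ?(ltW (mulr_gt0 K'0 e0))//; lra.
rewrite !mulr1 in ee *; rewrite -[leRHS]eM; move: ee e0; rewrite /M; move: (e) (K) (K') => d k k'; lra.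
Qed.

End Solutions.

(** * The growth scale of [psi] *)

Section Psi.
Variables (R : realType) (psi : R -> R).
Hypothesis psi_ge0 : forall x, 1 <= x -> 0 <= psi x.
Hypothesis psi_nd : forall x y, 1 <= x -> x <= y -> psi x <= psi y.

(** [psi] is monotone only on [[1, +oo)]; composed with the maximum with [1] it becomes monotone on
    the line and keeps its values on [D]. *)
Lemma measurable_psi_div (D : set R) : measurable D -> D `<=` `[1, +oo[ ->
  measurable_fun D (EFin \o (fun t : R => psi t / t)).
Proof.
move=> mD D1; apply/measurable_EFinP.
pose m1 (t : R) := Num.max 1 t.
have m1ge t : 1 <= m1 t by rewrite le_max lexx.
have m1nd : {homo m1 : x y / x <= y} by move=> x y xy; rewrite /m1 ge_max le_max lexx/= le_max xy orbT.
apply: (@eq_measurable_fun _ _ _ _ _ (fun t => psi (m1 t) * (m1 t)^-1)).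
  by move=> t /set_mem/D1/=; rewrite in_itv /= andbT => t1; rewrite /m1 max_r.
apply: measurable_funM.
  by apply: nondecreasing_measurable => // x y xy; apply: psi_nd => //; exact: m1nd.
apply: nonincreasing_measurable => // x y xy.
by rewrite lef_pV2 ?posrE ?(lt_le_trans ltr01)//; exact: m1nd.
Qed.

Lemma psi_int_bounds x y : 1 <= x -> x <= y ->
  ((psi x * (y - x) / y)%:E <= \int[lebesgue_measure]_(t in `]x, y]) (psi t / t)%:E /\
  \int[lebesgue_measure]_(t in `]x, y]) (psi t / t)%:E <= (psi y * (y - x) / x)%:E)%E.
Proof.
move=> x1 xy; have y1 := le_trans x1 xy.
have x0 : 0 < x by rewrite (lt_le_trans ltr01).
have y0 : 0 < y by rewrite (lt_le_trans ltr01).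
have mD : measurable (`]x, y]%classic : set R) by exact: measurable_itv.
have mf : measurable_fun (`]x, y]%classic : set R) (EFin \o (fun t : R => psi t / t)).
  apply: measurable_psi_div => // t /=; rewrite !in_itv /= andbT => /andP[xt _].
  by rewrite (le_trans x1)// ltW.
have leb : lebesgue_measure (`]x, y]%classic : set R) = (y - x)%:E.
  rewrite lebesgue_measure_itv /= lte_fin; case: ifPn => [_|]; first by rewrite EFinB.
  by rewrite -leNgt => yx; rewrite (@le_anti _ _ x y) ?xy ?subrr.
have H (c : R) : (\int[lebesgue_measure]_(t in `]x, y]) (cst c%:E) t = (c * (y - x))%:E)%E.
  by rewrite integral_cst// [X in (_ * X)%E]leb EFinM.
split.
- rewrite mulrAC -H; apply: ge0_le_integral => //.
  + by move=> t _; rewrite lee_fin divr_ge0 ?psi_ge0// ltW.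
  + move=> t /=; rewrite in_itv /= => /andP[xt ty]; rewrite lee_fin.
    have t0 : 0 < t by rewrite (lt_trans x0).
    by rewrite ler_pM ?invr_ge0 ?(ltW y0) ?psi_ge0// ?psi_nd// ?(ltW xt)// lef_pV2.
- rewrite mulrAC -H; apply: ge0_le_integral => //.
  + move=> t /=; rewrite in_itv /= => /andP[xt ty]; rewrite lee_fin.
    by rewrite divr_ge0 ?psi_ge0// ?(le_trans x1) ?(ltW xt)// ltW// (lt_trans x0).
  + move=> t /=; rewrite in_itv /= => /andP[xt ty]; rewrite lee_fin.
    have t0 : 0 < t by rewrite (lt_trans x0).
    have t1 : 1 <= t by rewrite (le_trans x1)// ltW.
    by rewrite ler_pM ?invr_ge0 ?(ltW t0) ?psi_ge0// ?psi_nd// lef_pV2 ?posrE ?(ltW xt).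
Qed.

Definition psit (x : R) : R := fine (psi_tilde psi x).

Lemma psi_tilde_split x y : 1 <= x -> x <= y ->
  (psi_tilde psi y = psi_tilde psi x + \int[lebesgue_measure]_(t in `]x, y]) (psi t / t)%:E)%E.
Proof.
move=> x1 xy; rewrite /psi_tilde.
have <- : (`[1, x] `|` `]x, y] = `[1, y])%classic.
  by rewrite -itv_bndbnd_setU// ?bnd_simp.
have sub t : ((`[1, x] `|` `]x, y])%classic t) -> 1 <= t.
  by move=> [|] /=; rewrite in_itv /= => /andP[h _] //; rewrite (le_trans x1)// ltW.
apply: ge0_integral_setU => //.
- apply: measurable_psi_div; first by apply: measurableU; exact: measurable_itv.
  by move=> t /sub; rewrite /= in_itv /= andbT.
- by move=> t /sub t1; rewrite lee_fin divr_ge0 ?psi_ge0// (le_trans ler01).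
- rewrite disj_set2E; apply/eqP/seteqP; split => // t [/=]; rewrite !in_itv /= => /andP[_ tx] /andP[].
  by rewrite ltNge tx.
Qed.

Lemma psi_tilde1 : (psi_tilde psi 1 = 0)%E.
Proof. by rewrite /psi_tilde set_itv1 integral_set1. Qed.

Lemma psi_tilde_fin x : 1 <= x -> psi_tilde psi x = (psit x)%:E.
Proof.
move=> x1; rewrite /psit fineK// fin_numElt.
have [h1 h2] := psi_int_bounds (lexx 1) x1.
rewrite (psi_tilde_split (lexx _) x1) psi_tilde1 add0e.
by apply/andP; split; [apply: lt_le_trans h1; exact: ltNyr|apply: le_lt_trans h2 (ltry _)].
Qed.

Lemma psit_incr x y : 1 <= x -> x <= y ->
  psi x * (y - x) / y <= psit y - psit x <= psi y * (y - x) / x.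
Proof.
move=> x1 xy; have [h1 h2] := psi_int_bounds x1 xy.
have := psi_tilde_split x1 xy.
rewrite !psi_tilde_fin ?(le_trans x1)//.
move: h1 h2; case: (\int[_]_(_ in _) _)%E => [j||] //=.
by rewrite !lee_fin => h1 h2 [->]; rewrite addrAC subrr add0r h1.
Qed.

Lemma psit_le x y : 1 <= x -> x <= y -> psit x <= psit y.
Proof.
move=> x1 xy; have /andP[h _] := psit_incr x1 xy; rewrite -subr_ge0 (le_trans _ h)//.
by rewrite divr_ge0 ?mulr_ge0 ?psi_ge0 ?subr_ge0// (le_trans ler01)// (le_trans x1).
Qed.

Lemma psit1 : psit 1 = 0.
Proof. by rewrite /psit psi_tilde1. Qed.

Lemma psit_ge0 x : 1 <= x -> 0 <= psit x.
Proof. by move=> x1; rewrite -psit1 psit_le. Qed.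

Lemma psit_gt0 x y : 1 <= x -> x < y -> 0 < psi x -> 0 < psit y.
Proof.
move=> x1 xy px; have /andP[h _] := psit_incr x1 (ltW xy).
have := psit_ge0 x1 => p0; suff : 0 < psit y - psit x by lra.
apply: lt_le_trans h; rewrite divr_gt0 ?mulr_gt0 ?subr_gt0//.
by rewrite (lt_trans _ xy)// (lt_le_trans ltr01).
Qed.

Lemma psit_double_ge x : 1 <= x -> psi x / 2 <= psit (2 * x) - psit x.
Proof.
move=> x1; have x2 : x <= 2 * x by lra.
have /andP[h _] := psit_incr x1 x2; apply: le_trans h.
have x0 : x != 0 by rewrite gt_eqF// (lt_le_trans ltr01).
by rewrite le_eqVlt; apply/orP; left; apply/eqP; field.
Qed.

Lemma psit_double_le x : 1 <= x -> psit (2 * x) - psit x <= psi (2 * x).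
Proof.
move=> x1; have x2 : x <= 2 * x by lra.
have /andP[_ h] := psit_incr x1 x2; apply: le_trans h _.
have x0 : x != 0 by rewrite gt_eqF// (lt_le_trans ltr01).
by rewrite le_eqVlt; apply/orP; left; apply/eqP; field.
Qed.

Lemma dyadic (x : R) : 1 <= x -> exists i : nat, 2 ^+ i <= x /\ x < 2 ^+ i.+1.
Proof.
move=> x1; have x0 : 0 <= x by rewrite (le_trans ler01).
pose n := Num.truncn x; have n0 : (0 < n)%N by rewrite truncn_gt0.
have /andP[h1 h2] := trunc_log_bounds (isT : (1 < 2)%N) n0.
exists (trunc_log 2 n); split.
  rewrite -natrX (@le_trans _ _ n%:R) ?ler_nat//.
  by rewrite truncn_le.
by rewrite -natrX (lt_le_trans (truncnS_gt x))// ler_nat.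
Qed.

Hypothesis psi_unbounded : forall M, exists2 x, 1 <= x & M < psi x.
Hypothesis psi_doubling : exists2 K : R, 0 < K & \forall x \near +oo%R, psi (2 * x) <= K * psi x.

Lemma doubling_from : exists K X : R, [/\ 1 <= K, 1 <= X & forall x, X <= x -> psi (2 * x) <= K * psi x].
Proof.
case: psi_doubling => K K0 [M [_ hM]]; exists (Num.max 1 K), (Num.max 1 (M + 1)).
split; rewrite ?le_max ?lexx// => x; rewrite ge_max => /andP[x1 xM].
have Mx : M < x by rewrite (lt_le_trans _ xM)// ltrDl.
rewrite (le_trans (hM _ Mx))// ler_wpM2r ?psi_ge0//.
by rewrite le_max lexx orbT.
Qed.

(** On [[x/2, x]] the function [psit] gains at least [psi (x/2) / 2], and two doublings lead from
    [x/2] to [2x]. The summand [1] covers bounded [x], since [psit] vanishes at [1]. *)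
Lemma psi_le_psit : exists2 K : R, 0 <= K & forall x, 1 <= x -> psi (2 * x) <= K * (1 + psit x).
Proof.
have [K [X [K1 X1 hK]]] := doubling_from.
have K0 : 0 <= K by rewrite (le_trans ler01).
have p0 : 0 <= psi (4 * X) by rewrite psi_ge0//; lra.
exists (2 * K ^+ 2 + psi (4 * X)) => [|x x1]; first by rewrite addr_ge0// mulr_ge0// exprn_ge0.
have t0 := psit_ge0 x1; have K20 : 0 <= K ^+ 2 by exact: exprn_ge0.
have [h|h] := leP x (2 * X).
  have : psi (2 * x) <= psi (4 * X) by rewrite psi_nd//; lra.
  by have := mulr_ge0 K20 t0; have := mulr_ge0 p0 t0; lra.
have Xx : X <= x / 2 by lra.
have x2 : 1 <= x / 2 by lra.
have xE : 2 * (x / 2) = x by field.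
have h1 := hK _ Xx; rewrite xE in h1.
have h2 : psi (2 * x) <= K * psi x by apply: hK; lra.
have h3 := psit_double_ge x2; rewrite xE in h3.
have h4 := psit_ge0 x2.
have h5 : psi (x / 2) <= 2 * psit x by lra.
have h6 : K * psi x <= K * (K * (2 * psit x)).
  by rewrite ler_wpM2l// (le_trans h1)// ler_wpM2l.
have : K * (K * (2 * psit x)) = 2 * K ^+ 2 * psit x by ring.
by have := mulr_ge0 p0 t0; lra.
Qed.

Definition psi_gauge (r : R) : R := 1 + psit (1 / (1 - r)).

Lemma inv1_ge1 (r : R) : 0 <= r < 1 -> 1 <= 1 / (1 - r).
Proof.
move=> /andP[r0 r1]; rewrite ler_pdivlMr ?mul1r ?subr_gt0//.
by rewrite gerBl.
Qed.

(** The last clause uses that [psi] is unbounded: past some [X] it exceeds [1], so [psit] gains at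
    least [1/2] at each doubling and [log x = O (1 + psit x)]. *)
Lemma gauge_psi : gauge psi_gauge.
Proof.
split.
- by move=> r r01; rewrite lerDl psit_ge0// inv1_ge1.
- move=> r r' r0 rr r'1; rewrite lerD2l psit_le ?inv1_ge1 ?r0 ?(le_lt_trans rr)//.
  by rewrite !div1r lef_pV2 ?posrE ?subr_gt0 ?(le_lt_trans rr)// lerD2l lerN2.
- have [K K0 hK] := psi_le_psit; exists (1 + K); first by rewrite addr_ge0.
  move=> r r01; have x1 := inv1_ge1 r01; rewrite /psi_gauge.
  have -> : 1 / (1 - (1 + r) / 2) = 2 * (1 / (1 - r)).
    have h1 : 1 - r != 0 by case/andP: r01 => r0 r1; rewrite gt_eqF// subr_gt0.
    have -> : 1 - (1 + r) / 2 = (1 - r) / 2 by field.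
    by field.
  by have := hK _ x1; have := psit_double_le x1; have := psit_ge0 x1; lra.
have [X X1 pX] := psi_unbounded 1.
have tX i : (i%:R : R) / 2 <= psit (2 ^+ i * X).
  elim: i => [|i IH]; first by rewrite expr0 mul1r mul0r psit_ge0.
  have y1 : 1 <= 2 ^+ i * X by rewrite -[leLHS]mulr1 ler_pM// exprn_ege1// ler1n.
  have h := psit_double_ge y1; rewrite exprS -mulrA -natr1.
  have : psi X <= psi (2 ^+ i * X).
    by rewrite psi_nd// ler_peMl ?exprn_ege1 ?ler1n// (le_trans ler01).
  by lra.
have X0 : 0 < X by rewrite (lt_le_trans ltr01).
exists (X + 3); first by rewrite addr_ge0// ltW.
move=> r r01; have := inv1_ge1 r01; rewrite /psi_gauge !div1r; move: ((1 - r)^-1) => x x1.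
have t0 := psit_ge0 x1.
have key : x <= expR X * expR (1 + 2 * psit x).
  have eX : X <= expR X by rewrite (le_trans _ (expR_ge1Dx _))// lerDr.
  have e1 : 1 <= expR (1 + 2 * psit x) by rewrite (le_trans _ (expR_ge1Dx _))//; lra.
  have [xX|Xx] := leP x X.
    by rewrite -[leLHS]mulr1 ler_pM// ?(le_trans xX)// (le_trans ler01).
  have xX1 : 1 <= x / X by rewrite ler_pdivlMr// mul1r ltW.
  have [i [h1 h2]] := dyadic xX1.
  rewrite ler_pdivlMr// in h1; rewrite ltr_pdivrMr// in h2.
  rewrite (le_trans (ltW h2))// mulrC ler_pM ?exprn_ge0 ?(ltW X0)//.
  apply: (@le_trans _ _ (expR 1 ^+ i.+1)).
    rewrite lerXn2r ?nnegrE ?expR_ge0// (le_trans _ (expR_ge1Dx _))//.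
  rewrite -expRM_natl mulr1 ler_expR -natr1 addrC lerD2l.
  have y1 : 1 <= 2 ^+ i * X by rewrite -[leLHS]mulr1 ler_pM// exprn_ege1// ler1n.
  by have := tX i; have := psit_le y1 h1; lra.
rewrite (le_trans key)// -expRD ler_expR.
by have := mulr_ge0 (ltW X0) t0; lra.
Qed.

Let polya_set := [set rho : R | \forall x & c \near +oo%R, psi (c * x) <= c `^ rho * psi x].

Lemma lt_powR (a x y : R) : 1 < a -> x < y -> a `^ x < a `^ y.
Proof.
move=> a1 xy; rewrite /powR gt_eqF ?(lt_trans ltr01)// ltr_expR.
by rewrite ltr_pM2r// ln_gt0.
Qed.

Lemma polya_setE rho : polya_set rho -> exists X : R, [/\ 1 <= X, 0 < psi X &
  forall x c, X <= x -> X <= c -> psi (c * x) <= c `^ rho * psi x].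
Proof.
move=> [[A B] /= [[M1 [_ hA]] [M2 [_ hB]]] AB].
have [X0 X01 pX0] := psi_unbounded 0.
pose X := Num.max (Num.max (M1 + 1) (M2 + 1)) X0.
exists X; split; first by rewrite le_max X01 orbT.
  by rewrite (lt_le_trans pX0)// psi_nd// le_max lexx orbT.
move=> x c; rewrite !ge_max => /andP[/andP[x1 _] _] /andP[/andP[_ c2] _].
apply: (AB (x, c)); split => /=.
  by apply: hA; rewrite (lt_le_trans _ x1)// ltrDl.
by apply: hB; rewrite (lt_le_trans _ c2)// ltrDl.
Qed.

(** Monotonicity gives [psi X <= psi (c X) <= c^rho psi X] with [psi X > 0] and [c > 1], which is
    impossible for negative [rho]. *)
Lemma polya_set_ge0 rho : polya_set rho -> 0 <= rho.
Proof.
move=> /polya_setE[X [X1 pX h]]; rewrite leNgt; apply/negP => rho0.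
pose c := X + 1; have c1 : 1 < c by rewrite /c; lra.
have := h X c (lexx _); have Xc : X <= c by rewrite /c; lra.
move=> /(_ Xc) H; have X0 : 0 <= X by rewrite (le_trans ler01).
have : psi X <= psi (c * X) by rewrite psi_nd// ler_peMl// ltW.
move=> /le_trans/(_ H); apply/negP; rewrite -ltNge gtr_pMl//.
by rewrite -(powRr0 c) lt_powR.
Qed.

(** For [2^i <= c < 2^(i+1)], doubling [i + 1] times costs [K^(i+1) <= 2^(j (i+1))]. As [i >= 1],
    this is at most [2^(2 i j) <= c^(2j)]. *)
Lemma polya_set_nonempty : polya_set !=set0.
Proof.
have [K [X [K1 X1 hK]]] := doubling_from.
have K0 : 0 <= K by rewrite (le_trans ler01).
have it i x : X <= x -> psi (2 ^+ i * x) <= K ^+ i * psi x.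
  move=> Xx; elim: i => [|i IH]; first by rewrite !expr0 !mul1r.
  rewrite exprS -mulrA (le_trans (hK _ _))//.
    by rewrite (le_trans Xx)// ler_peMl ?exprn_ege1 ?ler1n// (le_trans (le_trans ler01 X1)).
  by rewrite [K ^+ _]exprS -mulrA ler_wpM2l.
have [j hj] : exists j : nat, K <= 2 ^+ j.
  exists (Num.truncn K).+1; rewrite (le_trans (ltW (truncnS_gt _)))//.
  by rewrite -natrX ler_nat ltnW// ltn_expl.
exists (2 * j)%:R; exists ([set x | X <= x], [set c | 2 <= c]) => /=.
  by split; [exists X|exists 2]; split; rewrite ?num_real// => x /ltW.
move=> [x c] [/= Xx c2].
have c1 : 1 <= c by lra.
have x1 : 1 <= x by rewrite (le_trans X1).
have [i [h1 h2]] := dyadic c1.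
have i0 : (0 < i)%N.
  by rewrite lt0n; apply/eqP => i0; move: h2; rewrite i0 expr1; lra.
have x0 : 0 <= x by rewrite (le_trans ler01).
apply: (@le_trans _ _ (psi (2 ^+ i.+1 * x))).
  rewrite psi_nd//; last by rewrite ler_wpM2r// ltW.
  by rewrite -[leLHS]mulr1 ler_pM.
rewrite (le_trans (it _ _ Xx))// ler_wpM2r ?psi_ge0// powR_mulrn ?(le_trans ler01)//.
apply: (@le_trans _ _ ((2 ^+ j) ^+ i.+1)); first by rewrite lerXn2r ?nnegrE// exprn_ge0.
apply: (@le_trans _ _ ((2 ^+ i) ^+ (2 * j))); last by rewrite lerXn2r ?nnegrE ?exprn_ge0 ?(le_trans ler01 c1).
by rewrite -!exprM ler_weXn2l ?ler1n//; nia.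
Qed.

(** The order is below its floor plus one, so some admissible [rho] is less than [s], and
    [q = 2^rho]. Admissibility holds only for large dilations and arguments: [q^i1] enlarges the
    dilation beyond [X], and the [1] beside [psi x] covers [x < X], where [psi x] may be [0]. *)
Lemma polya_growth (s : nat) : (Num.floor (polya_order psi) + 1 <= s%:Z)%R ->
  (0 < s)%N /\ exists A q : R, [/\ 0 <= A, 0 < q, q < 2 ^+ s &
    forall i x, 1 <= x -> psi (2 ^+ i * x) <= A * q ^+ i * (psi x + 1)].
Proof.
move=> hs; have hinf : has_inf polya_set.
  by split; [exact: polya_set_nonempty|exists 0 => rho; exact: polya_set_ge0].
have inf0 : 0 <= polya_order psi by apply: lb_le_inf; [exact: hinf.1|exact: polya_set_ge0].
have infs : polya_order psi < s%:R.
  have h := floorD1_gt (polya_order psi); rewrite (lt_le_trans h)//.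
  by rewrite -[s%:R]/(s%:Z%:~R) ler_int.
have s0 : (0 < s)%N by rewrite -(ltr_nat R) (le_lt_trans inf0).
split => //; have [rho hrho rs] := inf_lt hinf.1 infs.
have rho0 := polya_set_ge0 hrho; have [X [X1 pX h]] := polya_setE hrho.
pose q := 2 `^ rho.
have q1 : 1 <= q.
  by rewrite /q -[leLHS](powRr0 2) ler_powR// ler1n.
have qE i : (2 ^+ i) `^ rho = q ^+ i.
  by rewrite -powR_mulrn// -powRrM mulrC powRrM powR_mulrn ?powR_ge0.
have [i1 hi1] : exists i1 : nat, X <= 2 ^+ i1.
  exists (Num.truncn X).+1; rewrite (le_trans (ltW (truncnS_gt _)))//.
  by rewrite -natrX ler_nat ltnW// ltn_expl.
have X0 : 0 <= X by rewrite (le_trans ler01).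
have big i x : X <= x -> psi (2 ^+ i * x) <= q ^+ i1 * q ^+ i * psi x.
  move=> Xx; have x1 : 1 <= x by rewrite (le_trans X1).
  have x0 : 0 <= x by rewrite (le_trans ler01).
  apply: (@le_trans _ _ (psi (2 ^+ (i1 + i) * x))).
    rewrite psi_nd//; first by rewrite -[leLHS]mulr1 ler_pM// exprn_ege1// ler1n.
    by rewrite ler_wpM2r// ler_weXn2l ?ler1n// leq_addl.
  by rewrite -exprD -qE h// (le_trans hi1)// ler_weXn2l ?ler1n// leq_addr.
have qi i : 0 <= q ^+ i1 * q ^+ i by rewrite -exprD exprn_ge0// (le_trans ler01).
exists (q ^+ i1 * (1 + psi X)), q; split.
- by rewrite mulr_ge0 ?exprn_ge0 ?(le_trans ler01 q1)// addr_ge0// psi_ge0.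
- by rewrite (lt_le_trans ltr01).
- by rewrite -powR_mulrn// lt_powR// ltr1n.
move=> i x x1; have px := psi_ge0 x1; have pX0 := psi_ge0 X1.
have -> : q ^+ i1 * (1 + psi X) * q ^+ i * (psi x + 1) =
  q ^+ i1 * q ^+ i * ((1 + psi X) * (psi x + 1)) by ring.
have [Xx|xX] := leP X x.
  rewrite (le_trans (big i x Xx))// ler_wpM2l//.
  by have := mulr_ge0 pX0 px; lra.
apply: (@le_trans _ _ (psi (2 ^+ i * X))).
  rewrite psi_nd//; first by rewrite -[leLHS]mulr1 ler_pM// exprn_ege1// ler1n.
  by rewrite ler_wpM2l ?exprn_ge0// ltW.
rewrite (le_trans (big i X (lexx _)))// ler_wpM2l//.
by have := mulr_ge0 pX0 px; lra.
Qed.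

End Psi.

(** * The density condition *)

Section Counting.
Variable R : realType.
Local Notation C := R[i].

Lemma disc_count_le (z : nat -> C) (w : C) (t M : R) m :
  (disc_count z w t <= M%:E)%E -> \sum_(k < m | normc (z k - w) <= t) (1 : R) <= M.
Proof.
rewrite /disc_count /counting; case: ifPn => [/asboolP fin|_]; last by rewrite leNgt ltry.
rewrite lee_fin; apply: le_trans; rewrite sumr_const ler_nat.
set A := [set k | _] in fin *.
pose sq := [seq k <- iota 0 m | normc (z k - w) <= t].
have -> : #|[pred k : 'I_m | normc (z k - w) <= t]| = size sq.
  rewrite cardE /sq size_filter -val_enum_ord count_map -size_filter /enum_mem.
  by rewrite -filter_predI; congr size; apply: eq_filter => k /=; rewrite andbT.
apply: uniq_leq_size; first by rewrite filter_uniq ?iota_uniq.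
move=> k; rewrite mem_filter => /andP[h _].
by rewrite in_fset_set// inE.
Qed.

Lemma cell_sum_le (z : nat -> C) (m : nat) (P : pred 'I_m) (F : 'I_m -> R) (k0 : 'I_m) (N G r : R) :
  0 <= G -> (forall k, P k -> F k <= G) ->
  \sum_(k < m | normc (z k - z k0) <= r) (1 : R) <= N ->
  (forall k, P k -> normc (z k - z k0) <= r) ->
  \sum_(k < m | P k) F k <= N * G.
Proof.
move=> G0 FG hN hr.
apply: (@le_trans _ _ (\sum_(k < m | P k) 1 * G)); first by apply: ler_sum => k /FG; rewrite mul1r.
rewrite -mulr_suml ler_wpM2r// (le_trans _ hN)//.
rewrite big_mkcond [leRHS]big_mkcond; apply: ler_sum => k _.
case: (boolP (P k)) => [Pk|_]; last by case: ifP.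
by rewrite hr.
Qed.

(** [t / (D + |t|)] has derivative [D / (D + |t|)^2]. A step [h <= D] at most doubles [D + |t|],
    hence the factor [4]. *)
Lemma telescope_step (D h t : R) : 0 < h -> h <= D ->
  h / (D + `|t|) ^+ 2 <= 4 / D * ((t + h) / (D + `|t + h|) - t / (D + `|t|)).
Proof.
move=> h0 hD; have D0 : 0 < D by rewrite (lt_le_trans h0).
have a0 u : 0 < D + `|u : R| by rewrite ltr_wpDr.
rewrite ler_pdivrMr ?exprn_gt0//.
have [t0|t0] := leP 0 t.
  have th : 0 <= t + h by rewrite addr_ge0// ltW.
  rewrite !ger0_norm//.
  have -> : 4 / D * ((t + h) / (D + (t + h)) - t / (D + t)) * (D + t) ^+ 2 =
     4 * h * ((D + t) / (D + (t + h))).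
    by field; rewrite !gt_eqF//; lra.
  have : 1 / 2 <= (D + t) / (D + (t + h)) by rewrite ler_pdivlMr; lra.
  by set q := (D + t) / _; nra.
rewrite (ltr0_norm t0); have [th|th] := leP 0 (t + h).
  rewrite ger0_norm//.
  have -> : 4 / D * ((t + h) / (D + (t + h)) - t / (D - t)) * (D - t) ^+ 2 =
     4 / D * ((t + h) * (D - t) / (D + (t + h)) - t) * (D - t).
    by field; rewrite !gt_eqF//; lra.
  have h1 : (t + h) / 2 <= (t + h) * (D - t) / (D + (t + h)).
    by rewrite ler_pdivlMr; [nra|lra].
  have h2 : h / 2 <= (t + h) * (D - t) / (D + (t + h)) - t by lra.
  have h3 : 1 <= (D - t) / D by rewrite ler_pdivlMr//; lra.
  have -> q : 4 / D * q * (D - t) = 4 * q * ((D - t) / D) by ring.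
  set q := _ - t in h2 *; set r := (D - t) / D in h3 *; nra.
rewrite ltr0_norm//.
have -> : 4 / D * ((t + h) / (D - (t + h)) - t / (D - t)) * (D - t) ^+ 2 =
     4 * h * ((D - t) / (D - (t + h))).
  by field; rewrite !gt_eqF//; lra.
have : 1 <= (D - t) / (D - (t + h)) by rewrite ler_pdivlMr; lra.
by set q := (D - t) / _; nra.
Qed.

(** A Riemann sum of [1 / (D + |t|)^2], bounded independently of its length and shift because
    [t / (D + |t|)] oscillates by at most [2]. *)
Lemma telescope_sum (D h tau : R) M : 0 < h -> h <= D ->
  \sum_(i < M) h / (D + `|i%:R * h - tau|) ^+ 2 <= 8 / D.
Proof.
move=> h0 hD; have D0 : 0 < D by rewrite (lt_le_trans h0).
pose Phi (t : R) := t / (D + `|t|).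
have a0 u : 0 < D + `|u : R| by rewrite ltr_wpDr.
have Phi1 t : `|Phi t| <= 1.
  by rewrite normrM normfV (gtr0_norm (a0 t)) ler_pdivrMr// mul1r lerDr ltW.
apply: (@le_trans _ _ (4 / D * (Phi (M%:R * h - tau) - Phi (0%:R * h - tau)))).
  elim: M => [|M IH]; first by rewrite big_ord0 subrr mulr0.
  rewrite big_ord_recr /=.
  have := telescope_step (M%:R * h - tau) h0 hD.
  have -> : M%:R * h - tau + h = M.+1%:R * h - tau by rewrite -natr1; ring.
  rewrite -/(Phi _) -/(Phi _) => H; rewrite (le_trans (lerD IH H))//.
  by rewrite le_eqVlt; apply/orP; left; apply/eqP; ring.
have -> : 8 / D = 4 / D * 2 by ring.
rewrite ler_wpM2l ?divr_ge0 ?(ltW D0)//.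
have := Phi1 (M%:R * h - tau); have := Phi1 (0%:R * h - tau).
by rewrite !ler_norml => /andP[? ?] /andP[? ?]; lra.
Qed.

(** Modulus, smaller coordinate [t] and sign of the larger coordinate [p] locate a point:
    [p^2 = rho^2 - t^2] controls [(p - p') (p + p')], and [p + p'] is bounded below since [p], [p']
    agree in sign and dominate. The result is [32 h^2 + h^2 <= 36 h^2]. *)
Lemma close_coords (p t p' t' rho rho' h : R) : `|t| <= `|p| -> `|t'| <= `|p'| -> 0 <= p * p' ->
  0 <= rho -> 0 <= rho' -> rho ^+ 2 = p ^+ 2 + t ^+ 2 -> rho' ^+ 2 = p' ^+ 2 + t' ^+ 2 ->
  rho <= 1 -> rho' <= 1 -> 2^-1 <= rho -> 2^-1 <= rho' -> `|rho - rho'| <= h -> `|t - t'| <= h ->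
  (p - p') ^+ 2 + (t - t') ^+ 2 <= (6 * h) ^+ 2.
Proof.
move=> tp tp' pp r0 r0' rE rE' r1 r1' rh rh' hr ht.
have h0 : 0 <= h by rewrite (le_trans _ hr).
have sq (x y : R) : `|x| <= `|y| -> x ^+ 2 <= y ^+ 2.
  by move=> xy; rewrite -(real_normK (num_real x)) -(real_normK (num_real y)) lerXn2r.
have tp2 := sq _ _ tp; have tp2' := sq _ _ tp'.
have p2 : 8^-1 <= p ^+ 2 by nra.
have p2' : 8^-1 <= p' ^+ 2 by nra.
have hh : h = `|h| by rewrite ger0_norm.
have t2 : (t - t') ^+ 2 <= h ^+ 2 by apply: sq; rewrite -hh.
have r2 : (rho - rho') ^+ 2 <= h ^+ 2 by apply: sq; rewrite -hh.
have ppb : 8^-1 <= p * p'.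
  have : (8^-1 : R) ^+ 2 <= (p * p') ^+ 2.
    by rewrite exprMn expr2 ler_pM.
  by rewrite ler_pXn2r ?nnegrE.
have S : 2^-1 <= (p + p') ^+ 2 by rewrite sqrrD; lra.
have e1 : (p - p') * (p + p') = (rho - rho') * (rho + rho') - (t - t') * (t + t').
  have -> : (p - p') * (p + p') = p ^+ 2 - p' ^+ 2 by ring.
  have -> : (rho - rho') * (rho + rho') = rho ^+ 2 - rho' ^+ 2 by ring.
  by rewrite rE rE'; ring.
have tle1 : `|t| <= 1.
  by rewrite -(@ler_pXn2r _ 2) ?nnegrE// expr1n real_normK ?num_real//; nra.
have tle1' : `|t'| <= 1.
  by rewrite -(@ler_pXn2r _ 2) ?nnegrE// expr1n real_normK ?num_real//; nra.
have e2 : `|(p - p') * (p + p')| <= 4 * h.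
  rewrite e1 (le_trans (ler_normB _ _))// !normrM.
  have : `|rho - rho'| * `|rho + rho'| <= h * 2.
    by rewrite ler_pM// ger0_norm ?addr_ge0//; lra.
  have : `|t - t'| * `|t + t'| <= h * 2.
    by rewrite ler_pM// (le_trans (ler_normD _ _))//; lra.
  by lra.
have e3 : ((p - p') * (p + p')) ^+ 2 <= (4 * h) ^+ 2.
  by apply: sq; rewrite (le_trans e2)// ler_norm.
have e4 : (p - p') ^+ 2 * 2^-1 <= (4 * h) ^+ 2.
  by rewrite (le_trans _ e3)// exprMn ler_wpM2l// sqr_ge0.
have -> : (6 * h) ^+ 2 = 36 * h ^+ 2 by ring.
have e5 : (4 * h) ^+ 2 = 16 * h ^+ 2 by ring.
by rewrite e5 in e4; have := sqr_ge0 h; lra.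
Qed.

(** The squares differ by [(1 - |a|^2) (1 - |x|^2)]: the pseudo-hyperbolic distance is less than
    [1]. *)
Lemma denom_ge_dist (a x : C) : normc a < 1 -> normc x < 1 -> normc (x - a) <= normc (1 - a^*%C * x).
Proof.
move=> a1 x1; rewrite -(@ler_pXn2r _ 2) ?nnegrE ?normc_ge0//.
rewrite -subr_ge0.
have -> : normc (1 - a^*%C * x) ^+ 2 - normc (x - a) ^+ 2 = (1 - normc a ^+ 2) * (1 - normc x ^+ 2).
  by case: a x {a1 x1} => ? ? [? ?]; rewrite !sqr_normcE /=; ring.
by rewrite mulr_ge0// ltW// sqr_normc_lt1.
Qed.

End Counting.

(** * Dyadic shells and the kernel sum *)

Section Shells.
Variables (R : realType) (z : nat -> R[i]) (psi : R -> R) (s : nat).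
Local Notation C := R[i].
Local Notation W := unit_kernel.
Hypothesis s0 : (0 < s)%N.
Hypothesis z1 : forall n, normc (z n) < 1.
Hypothesis psi_ge0 : forall x, 1 <= x -> 0 <= psi x.
Hypothesis psi_nd : forall x y, 1 <= x -> x <= y -> psi x <= psi y.
Variable D : R.
Hypothesis D0 : 0 < D.
Hypothesis density : forall w : C, unit_disc w ->
  (disc_count z w ((1 - normc w) / 2) <= (D * psi (1 / (1 - normc w)))%:E)%E.

(** The smaller Cartesian coordinate plays the part of the angle, so no argument function is
    involved; this flag records which coordinate dominates. *)
Definition large_re (w : C) : bool := `|complex.Im w| <= `|complex.Re w|.
Definition small_coord (b : bool) (w : C) : R := if b then complex.Im w else complex.Re w.
Definition large_coord (b : bool) (w : C) : R := if b then complex.Re w else complex.Im w.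

Lemma small_coord_dist b (v w : C) : `|small_coord b v - small_coord b w| <= normc (v - w).
Proof.
have -> : small_coord b v - small_coord b w = small_coord b (v - w) by case: b v w => [[? ?] [? ?]|[? ?] [? ?]].
by case: b; [exact: normc_Im|exact: normc_Re].
Qed.

Lemma coord_norm b (w : C) : normc w ^+ 2 = large_coord b w ^+ 2 + small_coord b w ^+ 2.
Proof. by rewrite sqr_normcE; case: b => //=; rewrite addrC. Qed.

Lemma coord_dist b (v w : C) : normc (v - w) ^+ 2 =
  (large_coord b v - large_coord b w) ^+ 2 + (small_coord b v - small_coord b w) ^+ 2.
Proof. by rewrite (coord_norm b); case: b v w => [[? ?] [? ?]|[? ?] [? ?]]. Qed.

Lemma small_le_large (w : C) : `|small_coord (large_re w) w| <= `|large_coord (large_re w) w|.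
Proof.
rewrite /small_coord /large_coord; have [h|h] := boolP (large_re w); first exact: h.
by rewrite /large_re -ltNge in h; exact: ltW.
Qed.

Lemma truncn_close (u v h : R) : 0 < h -> 0 <= u -> 0 <= v ->
  Num.truncn (u / h) = Num.truncn (v / h) -> `|u - v| <= h.
Proof.
move=> h0 u0 v0 E.
have hu : 0 <= u / h by rewrite divr_ge0// ltW.
have hv : 0 <= v / h by rewrite divr_ge0// ltW.
have /andP[a1 a2] := truncn_itv hu; have /andP[b1 b2] := truncn_itv hv.
move: a1 a2 b1 b2; rewrite E -natr1; move: (Num.truncn _)%:R => n a1 a2 b1 b2.
rewrite ler_pdivlMr// in a1; rewrite ltr_pdivrMr// in a2.
rewrite ler_pdivlMr// in b1; rewrite ltr_pdivrMr// in b2.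
rewrite mulrDl mul1r in a2 b2.
by rewrite ler_norml; apply/andP; split; lra.
Qed.

(** With [e = 2^-j] and [De = 1 - |x| + e], the kernel on a cell at tangential distance [S] is
    [O (e / (De + S))]. Two of the [s + 1] powers are summed over the cells and yield [O (e / De)],
    the other [s - 1] are bounded by taking [S = 0]; hence the final exponent [s]. *)
Lemma shell_sum : exists2 K : R, 0 <= K & forall j m x, normc x < 1 ->
  \sum_(k < m | (2^-1 <= normc (z k)) && (2 ^+ j * (1 - normc (z k)) <= 1 < 2 ^+ j.+1 * (1 - normc (z k))))
     normc (W (z k) x) ^+ s.+1
  <= K * (psi (2 ^+ j.+1) * (1 + 2 ^+ j * (1 - normc x)) ^- s).
Proof.
pose K0 := D * 24 ^+ s.+1 * 256.
have K00 : 0 <= K0 by rewrite !mulr_ge0 ?exprn_ge0// ltW.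
exists ((#|{: bool * bool * 'I_33}|)%:R * K0); first by rewrite mulr_ge0.
move=> j m x x1.
pose P (k : 'I_m) := (2^-1 <= normc (z k)) && (2 ^+ j * (1 - normc (z k)) <= 1 < 2 ^+ j.+1 * (1 - normc (z k))).
rewrite -/P.
pose e : R := 2 ^- j; have e0 : 0 < e by rewrite invr_gt0 exprn_gt0.
have eE : 2 ^+ j * e = 1 by rewrite mulfV// expf_eq0 pnatr_eq0 andbF.
have Pd k : P k -> [/\ 2^-1 <= normc (z k), 1 - normc (z k) <= e & e / 2 < 1 - normc (z k)].
  move=> /andP[zh /andP[h1 h2]]; split => //.
    by rewrite -(ler_pM2l (exprn_gt0 j (ltr0Sn R 1))) eE.
  rewrite ltr_pdivrMr// -(ltr_pM2l (exprn_gt0 j (ltr0Sn R 1))) eE.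
  by move: h2; rewrite exprS; lra.
(* A cell has diameter at most [6 h], which is below [(1 - |z k|) / 2 > e / 4 = 8 h]. The depth
   [1 - |z k|] is at most [32 h], whence the [33] radial slices. *)
pose h := e / 32; have h0 : 0 < h by rewrite divr_gt0.
pose dl := 1 - normc x; have dl0 : 0 < dl by rewrite subr_gt0.
pose De := dl + e; have De0 : 0 < De by rewrite addr_gt0.
have hDe : h <= De by rewrite /De /h; lra.
pose M := (Num.truncn (2 / h)).+1.
(* A cell of the shell lies in a single disc of the density hypothesis, and the cells
   of one type are spaced by [h] in the smaller coordinate. *)
pose key (k : 'I_m) : (bool * bool * 'I_33) * 'I_M :=
  (large_re (z k), 0 <= large_coord (large_re (z k)) (z k),
   inord (Num.truncn ((1 - normc (z k)) / h)),
   inord (Num.truncn ((small_coord (large_re (z k)) (z k) + 1) / h))).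
pose G (b : bool) (i : nat) := 24 ^+ s.+1 * (e / De) ^+ s.-1 *
   (e ^+ 2 / (De + `|i%:R * h - (1 + small_coord b x)|) ^+ 2).
have G0 b i : 0 <= G b i.
  by rewrite !mulr_ge0 ?exprn_ge0 ?invr_ge0 ?sqr_ge0 ?divr_ge0 ?(ltW e0) ?(ltW De0).
pose N := D * psi (2 ^+ j.+1).
have j1 : 1 <= (2 : R) ^+ j.+1 by rewrite exprn_ege1// ler1n.
have N0 : 0 <= N by rewrite mulr_ge0 ?psi_ge0// ltW.
have tr1 k : P k -> (Num.truncn ((1 - normc (z k)) / h) < 33)%N.
  move=> /Pd[_ h1 _]; have u0 : 0 <= (1 - normc (z k)) / h by rewrite divr_ge0 ?(ltW h0)// subr_ge0 ltW.
  have := truncn_itv u0 => /andP[t1 _]; rewrite -(ltr_nat R) (le_lt_trans t1)//.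
  by rewrite ltr_pdivrMr// /h; lra.
have sc1 b (w : C) : normc w < 1 -> `|small_coord b w| < 1.
  move=> w1; rewrite (le_lt_trans _ w1)//; case: b; [exact: normc_Im|exact: normc_Re].
have tr2 k : (Num.truncn ((small_coord (large_re (z k)) (z k) + 1) / h) < M)%N.
  rewrite ltnS; apply: le_truncn; rewrite ler_pM2r ?invr_gt0//.
  by have := sc1 (large_re (z k)) _ (z1 k); rewrite ltr_norml => /andP[? ?]; lra.
have sp k : 0 <= small_coord (large_re (z k)) (z k) + 1.
  by have := sc1 (large_re (z k)) _ (z1 k); rewrite ltr_norml => /andP[? ?]; lra.
have dp k : 0 <= 1 - normc (z k) by rewrite subr_ge0 ltW.
have close k k0 : P k -> P k0 -> key k = key k0 -> normc (z k - z k0) <= (1 - normc (z k0)) / 2.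
  move=> Pk Pk0 [kb ks kd kt].
  have [zk1 zk2 zk3] := Pd _ Pk; have [zl1 zl2 zl3] := Pd _ Pk0.
  move: kd => /(congr1 (@nat_of_ord _)); rewrite !inordK ?tr1// => kd.
  move: kt => /(congr1 (@nat_of_ord _)); rewrite !inordK ?tr2// => kt.
  have hd := truncn_close h0 (dp k) (dp k0) kd.
  have ht := truncn_close h0 (sp k) (sp k0) kt.
  have c6 : normc (z k - z k0) <= 6 * h.
    rewrite -(@ler_pXn2r _ 2) ?nnegrE ?normc_ge0 ?(mulr_ge0 (ler0n R 6) (ltW h0))//.
    rewrite (coord_dist (large_re (z k))).
    apply: (@close_coords _ _ _ _ _ (normc (z k)) (normc (z k0))); rewrite ?normc_ge0//.
    - exact: small_le_large.
    - by rewrite kb; exact: small_le_large.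
    - move: ks; rewrite -kb; case: (leP 0 (large_coord _ (z k))) => c1; case: (leP 0 (large_coord _ (z k0))) => c2 // _.
        exact: mulr_ge0.
      by rewrite mulr_le0 ?ltW.
    - exact: coord_norm.
    - exact: coord_norm.
    - exact: ltW.
    - exact: ltW.
    - by move: hd; rewrite ler_distl ler_distl => /andP[? ?]; apply/andP; split; lra.
    - by move: ht; rewrite -kb !ler_distl => /andP[? ?]; apply/andP; split; lra.
  by rewrite (le_trans c6)// /h; lra.
have cnt k0 : P k0 -> \sum_(k < m | normc (z k - z k0) <= (1 - normc (z k0)) / 2) (1 : R) <= N.
  move=> Pk0; have [zl1 zl2 zl3] := Pd _ Pk0.
  apply: disc_count_le; rewrite (le_trans (density (z1 k0)))// lee_fin ler_wpM2l ?(ltW D0)//.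
  have d0 : 0 < 1 - normc (z k0) by rewrite subr_gt0.
  apply: psi_nd; first by rewrite ler_pdivlMr// mul1r gerBl normc_ge0.
  rewrite ler_pdivrMr// -ler_pdivrMl ?exprn_gt0// mulr1.
  by rewrite exprS invfM mulrC -/e ltW.
have FG k : P k -> normc (W (z k) x) ^+ s.+1 <= G (key k).1.1.1 (key k).2.
  move=> Pk; have [zk1 zk2 zk3] := Pd _ Pk.
  set b := (key k).1.1.1; have bE : b = large_re (z k) by [].
  have -> : ((key k).2 : nat) = Num.truncn ((small_coord b (z k) + 1) / h) by rewrite /key /= inordK.
  set i := Num.truncn ((small_coord b (z k) + 1) / h); rewrite /G; set S := `|i%:R * h - _|.
  have den0 : 0 < normc (1 - (z k)^*%C * x) by rewrite normc_gt0 denom_neq0.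
  (* The denominator dominates [1 - |x|], [1 - |z k| > e / 2] and the distance of the small
     coordinates; up to constants and the rounding [h], [De + S] is their sum. *)
  have den : (De + S) / 12 <= normc (1 - (z k)^*%C * x).
    have d1 := denom_ge_r x (z1 k); have d2 := denom_ge_l (z k) x1.
    have d3 := le_trans (small_coord_dist b x (z k)) (denom_ge_dist (z1 k) x1).
    have hu : 0 <= (small_coord b (z k) + 1) / h by rewrite divr_ge0 ?sp ?(ltW h0).
    have := truncn_itv hu; rewrite -/i ler_pdivlMr// ltr_pdivrMr// -natr1 mulrDl mul1r => /andP[i1 i2].
    have S1 : S <= h + `|small_coord b x - small_coord b (z k)|.
      rewrite /S -(subrK (small_coord b (z k) - small_coord b x) (i%:R * h - _)) (le_trans (ler_normD _ _))//.
      rewrite (distrC (small_coord b x)) lerD2r ler_norml; apply/andP; split; lra.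
    by move: d1 d2 d3 S1 hDe; rewrite /De /dl /h; lra.
  have S0 : 0 <= S by exact: normr_ge0.
  have DS : 0 < De + S by rewrite ltr_wpDr.
  have W1 : normc (W (z k) x) <= 24 * (e / (De + S)).
    rewrite normc_kernel// ler_pdivrMr//.
    have u1 : 1 - normc (z k) ^+ 2 <= 2 * e.
      by have := normc_ge0 (z k); move: zk2 (z1 k); move: (normc (z k)) => u; nra.
    rewrite (le_trans u1)//.
    have -> : 2 * e = 24 * (e / (De + S)) * ((De + S) / 12) by field; rewrite gt_eqF.
    by rewrite ler_wpM2l// mulr_ge0// divr_ge0// ltW.
  have ge : e / (De + S) <= e / De.
    by rewrite ler_pM2l// lef_pV2 ?posrE// lerDl.
  have g0 : 0 <= e / (De + S) by rewrite divr_ge0// ltW.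
  apply: (@le_trans _ _ ((24 * (e / (De + S))) ^+ s.+1)).
    by rewrite lerXn2r ?nnegrE ?normc_ge0 ?(mulr_ge0 (ler0n R 24) g0).
  rewrite exprMn -mulrA ler_wpM2l ?exprn_ge0//.
  have -> : s.+1 = (s.-1 + 2)%N by rewrite addn2 prednK.
  rewrite exprD -expr_div_n ler_wpM2r ?exprn_ge0//.
  by rewrite lerXn2r ?nnegrE// divr_ge0// ltW.
rewrite (partition_big key predT) //=.
apply: (@le_trans _ _ (\sum_(c : (bool * bool * 'I_33) * 'I_M) N * G c.1.1.1 c.2)).
  apply: ler_sum => c _; have [k1 /andP[Pk1 /eqP kc]|none] := pickP (fun k => P k && (key k == c)); last first.
    by rewrite big_pred0// mulr_ge0.
  apply: (@cell_sum_le _ _ _ _ _ k1 _ _ ((1 - normc (z k1)) / 2)) => //.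
  - by move=> k /andP[Pk /eqP <-]; exact: FG.
  - exact: cnt.
  - by move=> k /andP[Pk /eqP kk]; apply: close => //; rewrite kk.
rewrite -(pair_bigA _ (fun (a : bool * bool * 'I_33) (i : 'I_M) => N * G a.1.1 i)) /=.
have row b : \sum_(i < M) G b i <= 24 ^+ s.+1 * 256 * (1 + 2 ^+ j * dl) ^- s.
  rewrite -mulr_sumr.
  have -> : \sum_(i < M) e ^+ 2 / (De + `|i%:R * h - (1 + small_coord b x)|) ^+ 2 =
      32 * e * \sum_(i < M) h / (De + `|i%:R * h - (1 + small_coord b x)|) ^+ 2.
    rewrite mulr_sumr; apply: eq_bigr => i _; rewrite mulrA; congr (_ / _).
    by rewrite /h; field.
  have T := telescope_sum (1 + small_coord b x) M h0 hDe.
  have e32 : 0 <= 32 * e by rewrite mulr_ge0// ltW.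
  have c0 : 0 <= 24 ^+ s.+1 * (e / De) ^+ s.-1 by rewrite mulr_ge0 ?exprn_ge0// divr_ge0// ltW.
  apply: le_trans (ler_wpM2l c0 (ler_wpM2l e32 T)) _.
  have eD : e / De = (1 + 2 ^+ j * dl)^-1.
    have -> : De = e * (1 + 2 ^+ j * dl).
      by rewrite /De mulrDr mulr1 mulrA (mulrC e) eE mul1r addrC.
    by rewrite invfM mulrA divff ?mul1r// gt_eqF.
  have -> : 24 ^+ s.+1 * (e / De) ^+ s.-1 * (32 * e * (8 / De)) = 24 ^+ s.+1 * 256 * ((e / De) ^+ s.-1 * (e / De)) by ring.
  by rewrite -exprSr prednK// eD exprVn.
apply: (@le_trans _ _ (\sum_(a : bool * bool * 'I_33) N * (24 ^+ s.+1 * 256 * (1 + 2 ^+ j * dl) ^- s))).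
  by apply: ler_sum => a _; rewrite -mulr_sumr ler_wpM2l.
rewrite sumr_const -[leLHS]mulr_natl -[leRHS]mulrA.
by rewrite le_eqVlt; apply/orP; left; apply/eqP; rewrite /K0 /N /dl; ring.
Qed.

Lemma inner_sum : exists2 K : R, 0 <= K & forall m x, normc x < 1 ->
  \sum_(k < m | normc (z k) < 2^-1) normc (W (z k) x) ^+ s.+1 <= K.
Proof.
exists (D * psi 1 * 2 ^+ s.+1); first by rewrite !mulr_ge0 ?exprn_ge0 ?psi_ge0// ltW.
move=> m x x1.
apply: (@le_trans _ _ (\sum_(k < m | normc (z k - 0) <= 2^-1) 1 * 2 ^+ s.+1)).
  rewrite big_mkcond [leRHS]big_mkcond; apply: ler_sum => k _.
  rewrite subr0; case: ltP => [/ltW ->|_]; last by case: ifP => // _; rewrite mul1r exprn_ge0.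
  by rewrite mul1r lerXn2r ?nnegrE ?normc_ge0// kernel_le2.
rewrite -mulr_suml ler_wpM2r ?exprn_ge0//; apply: disc_count_le.
have E : normc (0 : C) = 0 by exact: normc0.
have d0 : unit_disc (0 : C) by rewrite /unit_disc /mkset E ltr01.
by have := density d0; rewrite !E subr0 divr1 div1r.
Qed.

End Shells.

Section KernelSum.
Variables (R : realType) (z : nat -> R[i]) (psi : R -> R) (s : nat).
Local Notation C := R[i].
Local Notation W := unit_kernel.
Hypothesis z1 : forall n, normc (z n) < 1.
Hypothesis psi_ge0 : forall x, 1 <= x -> 0 <= psi x.
Hypothesis psi_nd : forall x y, 1 <= x -> x <= y -> psi x <= psi y.
Hypothesis psi_unbounded : forall M, exists2 x, 1 <= x & M < psi x.
Hypothesis psi_doubling : exists2 K : R, 0 < K & \forall x \near +oo%R, psi (2 * x) <= K * psi x.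
Hypothesis s_ge : (Num.floor (polya_order psi) + 1 <= s%:Z)%R.

(** While [2^j] is at most about [x], the values [psi (2^(j+1))] are increments of [psit] up to a
    factor [2], and the sum is [O (1 + psit x)]. Beyond that the terms decay geometrically with
    ratio [q / 2^s < 1]. *)
Lemma shell_series : exists2 K : R, 0 <= K & forall J x, 1 <= x ->
  \sum_(j < J) psi (2 ^+ j.+1) * (1 + 2 ^+ j / x) ^- s <= K * (1 + psit psi x).
Proof.
have [s0 [A [q [A0 q0 qs hA]]]] := polya_growth psi_ge0 psi_nd psi_unbounded psi_doubling s_ge.
have [K K0 hK] := psi_le_psit psi_ge0 psi_nd psi_doubling.
have p2 j : 1 <= (2 : R) ^+ j by rewrite exprn_ege1// ler1n.
have s2 : 0 < (2 : R) ^+ s by rewrite exprn_gt0.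
pose t := q / 2 ^+ s; have t01 : 0 <= t < 1.
  by rewrite divr_ge0 ?(ltW q0) ?(ltW s2)//= ltr_pdivrMr// mul1r.
pose B := A * q ^+ 2 * (1 - t)^-1.
have t1 : 0 < 1 - t by case/andP: t01 => _; rewrite subr_gt0.
have B0 : 0 <= B by rewrite !mulr_ge0 ?exprn_ge0 ?invr_ge0 ?(ltW q0) ?(ltW t1).
exists (2 * (1 + K + K * (1 + K)) + B * (K + 1)).
  by have := mulr_ge0 K0 K0; have := mulr_ge0 B0 K0; move: B0; clearbody B; lra.
move=> J x x1; have x0 : 0 < x by rewrite (lt_le_trans ltr01).
have [i0 [h1 h2]] := dyadic x1.
have tx := psit_ge0 psi_ge0 psi_nd x1.
pose F (j : nat) := psi (2 ^+ j.+1) * (1 + 2 ^+ j / x) ^- s.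
have den j : 1 <= 1 + 2 ^+ j / x by rewrite lerDl divr_ge0 ?exprn_ge0// ltW.
have F0 j : 0 <= F j.
  by rewrite mulr_ge0 ?psi_ge0 ?p2// invr_ge0 exprn_ge0// (le_trans ler01 (den j)).
have inv1 j : (1 + 2 ^+ j / x) ^- s <= 1.
  by rewrite invf_le1 ?exprn_ege1// exprn_gt0// (lt_le_trans ltr01).
apply: (@le_trans _ _ (\sum_(0 <= j < i0.+1 + J) F j)).
  rewrite -(big_mkord xpredT F) (@big_cat_nat _ _ _ J 0 (i0.+1 + J)) ?leq_addl//=.
  by rewrite lerDl; apply: sumr_ge0.
rewrite (@big_cat_nat _ _ _ i0.+1 0 (i0.+1 + J)) ?leq_addr//= mulrDl; apply: lerD.
  apply: (@le_trans _ _ (2 * psit psi (2 ^+ i0.+2))).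
    elim: (i0.+1) => [|n IH].
      by rewrite big_nil expr1 mulr_ge0// psit_ge0// ler1n.
    rewrite big_nat_recr//=; have y1 := p2 n.+1.
    have := psit_double_ge psi_ge0 psi_nd y1; rewrite -exprS => hd.
    have : F n <= psi (2 ^+ n.+1) by rewrite /F ler_piMr// psi_ge0 ?p2.
    by lra.
  rewrite -mulrA ler_wpM2l//.
  have le4 : 2 ^+ i0.+2 <= 2 * (2 * x) by rewrite !exprS; lra.
  rewrite (le_trans (psit_le psi_ge0 psi_nd _ le4))//.
  have x2 : 1 <= 2 * x by lra.
  have g1 := psit_double_le psi_ge0 psi_nd x2; have g2 := psit_double_le psi_ge0 psi_nd x1.
  have g3 := hK _ x1; have g4 := hK _ x2.
  have g5 : K * (1 + psit psi (2 * x)) <= K * (1 + (psit psi x + K * (1 + psit psi x))).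
    by rewrite ler_wpM2l//; lra.
  have := mulr_ge0 K0 tx; have := mulr_ge0 (mulr_ge0 K0 K0) tx; have := mulr_ge0 K0 K0; lra.
have px : psi x + 1 <= (K + 1) * (1 + psit psi x).
  have : psi x <= psi (2 * x) by rewrite psi_nd//; lra.
  by have := hK _ x1; lra.
apply: (@le_trans _ _ (\sum_(j < J) A * q ^+ 2 * (psi x + 1) * t ^+ j)).
  rewrite -{1}(add0n i0.+1) big_addn addKn big_mkord; apply: ler_sum => j _.
  have P1 : psi (2 ^+ (j + i0.+1).+1) <= A * q ^+ j.+2 * (psi x + 1).
    have -> : (j + i0.+1).+1 = (j.+2 + i0)%N by rewrite addnS !addSn.
    rewrite exprD (le_trans (hA _ _ (p2 _)))//; apply: ler_wpM2l.
      by rewrite mulr_ge0// exprn_ge0// ltW.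
    by rewrite lerD2r psi_nd.
  have P2 : (1 + 2 ^+ (j + i0.+1) / x) ^- s <= (2 ^+ s) ^- j.
    rewrite -exprM mulnC exprM lef_pV2 ?posrE ?exprn_gt0 ?(lt_le_trans ltr01)// ?ler1n//.
    rewrite lerXn2r ?nnegrE ?exprn_ge0 ?(le_trans ler01 (den _))//.
    have : 2 ^+ j <= 2 ^+ (j + i0.+1) / x.
      by rewrite ler_pdivlMr// exprD ler_wpM2l ?exprn_ge0// ltW.
    by lra.
  rewrite /F (le_trans (ler_pM _ _ P1 P2))//.
  - by rewrite psi_ge0 ?p2.
  - by rewrite invr_ge0 exprn_ge0// (le_trans ler01 (den _)).
  rewrite /t expr_div_n !exprS le_eqVlt; apply/orP; left; apply/eqP; ring.
rewrite -mulr_sumr.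
have G := geo_sum_le J t01.
have c0 : 0 <= A * q ^+ 2 * (psi x + 1).
  by rewrite !mulr_ge0 ?exprn_ge0 ?(ltW q0)// addr_ge0// psi_ge0.
rewrite (le_trans (ler_wpM2l c0 G))//.
have -> : A * q ^+ 2 * (psi x + 1) * (1 - t)^-1 = B * (psi x + 1) by rewrite /B; ring.
by rewrite -mulrA ler_wpM2l.
Qed.

Variable D : R.
Hypothesis D0 : 0 < D.
Hypothesis density : forall w : C, unit_disc w ->
  (disc_count z w ((1 - normc w) / 2) <= (D * psi (1 / (1 - normc w)))%:E)%E.

Lemma kernel_sum_psi : kernel_sum_bound z (psi_gauge psi) s.
Proof.
have [s0 _] := polya_growth psi_ge0 psi_nd psi_unbounded psi_doubling s_ge.
have [K1 K10 h1] := shell_sum s0 z1 psi_ge0 psi_nd D0 density.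
have [K2 K20 h2] := inner_sum s z1 psi_ge0 D0 density.
have [K3 K30 h3] := shell_series.
exists (K2 + K1 * K3) => [|m x x1]; first by rewrite addr_ge0// mulr_ge0.
have xx : 1 <= 1 / (1 - normc x) by rewrite inv1_ge1// normc_ge0.
have tx := psit_ge0 psi_ge0 psi_nd xx.
rewrite (bigID (fun k : 'I_m => normc (z k) < 2^-1)) /= mulrDl; apply: lerD.
  by rewrite (le_trans (h2 m x x1))// ler_peMr// /psi_gauge lerDl.
have hj (k : 'I_m) : exists j : nat, 2 ^+ j * (1 - normc (z k)) <= 1 < 2 ^+ j.+1 * (1 - normc (z k)).
  have d0 : 0 < 1 - normc (z k) by rewrite subr_gt0.
  have d1 : 1 <= 1 / (1 - normc (z k)) by rewrite inv1_ge1// normc_ge0 z1.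
  have [j [ha hb]] := dyadic d1; exists j.
  by rewrite ler_pdivlMr// in ha; rewrite ltr_pdivrMr// in hb; rewrite ha hb.
have [j hj'] := choice hj.
pose J := \max_(k < m) j k.
pose jo (k : 'I_m) : 'I_J.+1 := inord (j k).
have joE k : jo k = j k :> nat by rewrite inordK// ltnS /J (leq_bigmax k).
rewrite (partition_big jo predT)//=.
apply: (@le_trans _ _ (\sum_(i < J.+1) K1 * (psi (2 ^+ i.+1) * (1 + 2 ^+ i * (1 - normc x)) ^- s))).
  apply: ler_sum => i _; apply: le_trans (h1 i m x x1).
  rewrite big_mkcond [leRHS]big_mkcond; apply: ler_sum => k _.
  case: ifPn => [/andP[zk /eqP ki]|_]; last by case: ifP => // _; rewrite exprn_ge0 ?normc_ge0.
  by rewrite [2^-1 <= _]leNgt zk /= -ki joE hj'.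
rewrite -mulr_sumr -mulrA ler_wpM2l//.
have := h3 J.+1 _ xx; rewrite /psi_gauge; congr (_ <= _); apply: eq_bigr => i _.
by rewrite invf_div divr1.
Qed.

End KernelSum.

(** * Lower bounds at the zeros *)

Section LogIntegral.
Variable R : realType.
Local Notation mu := (@lebesgue_measure R).

(** The integral of a nonnegative function is a supremum over the simple functions below it, so
    monotonicity holds for arbitrary functions, such as the counting integrand of [disc_N]. *)
Lemma ge0_le_integral_sup d (T : measurableType d) (nu : {measure set T -> \bar R})
    (D : set T) (f g : T -> \bar R) :
  (forall x, D x -> (0 <= f x)%E) -> (forall x, D x -> (f x <= g x)%E) ->
  (\int[nu]_(x in D) f x <= \int[nu]_(x in D) g x)%E.
Proof.
move=> f0 fg; rewrite !ge0_integralE//; last by move=> x Dx; rewrite (le_trans (f0 x Dx))// fg.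
apply: le_ereal_sup => _ [h /= hf <-]; exists h => // x; rewrite (le_trans (hf x))//.
by rewrite /patch; case: ifPn => // /set_mem; exact: fg.
Qed.

Lemma integral_inv (a b : R) : 0 < a -> a <= b ->
  (\int[mu]_(t in `[a, b]) (t^-1)%:E = (ln (b / a))%:E)%E.
Proof.
move=> a0; rewrite le_eqVlt => /orP[/eqP <-|ab].
  by rewrite divff ?gt_eqF// ln1 set_itv1 integral_set1.
have b0 := lt_trans a0 ab.
have gt0 x : x \in `[a, b] -> 0 < x by rewrite in_itv /= => /andP[+ _]; exact: lt_le_trans.
rewrite lnM ?lnV ?posrE ?invr_gt0// EFinB.
have := @continuous_FTC2 R (fun t => t^-1) (@ln R) a b ab; apply.
- apply: continuous_in_subspaceT => x /set_mem/gt0 x0.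
  by apply: inv_continuous; rewrite gt_eqF.
- split; first by move=> x /subset_itv_oo_cc/gt0 x0; exact: (@ex_derive _ _ _ _ _ _ _ (is_derive1_ln x0)).
  + by apply: cvg_at_right_filter; exact: continuous_ln.
  + by apply: cvg_at_left_filter; exact: continuous_ln.
- move=> x /subset_itv_oo_cc/gt0 x0; rewrite derive1E.
  exact: (@derive_val _ _ _ _ _ _ _ (is_derive1_ln x0)).
Qed.

(** [ln (r / d)] is the integral of [1 / t] over [[d, r]]; adding over [d] turns the integrand into
    the counting function divided by [t]. *)
Lemma sum_ln_le_integral (s : seq R) (r : R) (f : R -> \bar R) :
  (forall d, d \in s -> 0 < d <= r) ->
  (forall t, 0 < t <= r -> ((\sum_(d <- s | d <= t) t^-1)%:E <= f t)%E) ->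
  ((\sum_(d <- s) ln (r / d))%:E <= \int[mu]_(t in `]0%R, r]) f t)%E.
Proof.
move=> sr hf.
have -> : ((\sum_(d <- s) ln (r / d))%:E =
   \int[mu]_(t in `]0%R, r]) \sum_(d <- s) (if (d <= t)%R then t^-1%R else 0%R)%:E)%E.
  have memle (d t : R) : (t \in [set t | d <= t]) = (d <= t) by apply/idP/idP; rewrite inE.
  have mf d : measurable_fun (`]0%R, r]%classic : set R) (fun t : R => (if d <= t then t^-1 else 0)%:E).
    have mA : measurable ([set t | d <= t] : set R) by rewrite -set_itvcy; exact: measurable_itv.
    have mD : measurable (`]0%R, r]%classic : set R) by exact: measurable_itv.
    have -> : (fun t : R => (if d <= t then t^-1 else 0)%:E) = (EFin \o (@GRing.inv R)) \_ [set t | d <= t].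
      by apply/funext => t; rewrite /patch memle; case: ifP.
    apply: (iffLR (measurable_restrict (EFin \o @GRing.inv R) mA mD)).
    apply/measurable_EFinP; apply: (@measurable_funS _ _ _ _ `]0%R, r]%classic) => //.
    apply: (subspace_continuous_measurable_fun mD).
    apply: continuous_in_subspaceT => t /set_mem/=; rewrite in_itv /= => /andP[t0 _].
    by apply: inv_continuous; rewrite gt_eqF.
  rewrite ge0_integral_sum//; last first.
  - by move=> d t /=; rewrite in_itv /= => /andP[t0 _]; rewrite lee_fin; case: ifP => // _; rewrite invr_ge0 ltW.
  rewrite -sumEFin big_seq [RHS]big_seq; apply: eq_bigr => d /sr/andP[d0 dr].
  rewrite -integral_inv//.
  have -> : `[d, r]%classic = `]0%R, r]%classic `&` [set t | d <= t].
    apply/seteqP; split => t /=; rewrite !in_itv /=.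
      by move=> /andP[dt ->]; rewrite (lt_le_trans d0).
    by move=> [/andP[_ ->] ->].
  rewrite integral_mkcondr; apply: eq_integral => t _.
  by rewrite /patch memle; case: ifP.
apply: ge0_le_integral_sup => t /=; rewrite in_itv /= => /andP[t0 tr].
  by apply: sume_ge0 => d _; rewrite lee_fin; case: ifP => // _; rewrite invr_ge0 ltW.
by rewrite sumEFin -big_mkcond hf ?t0.
Qed.

End LogIntegral.

Section NearbyPoints.
Variables (R : realType) (z : nat -> R[i]).
Local Notation C := R[i].
Hypothesis zinj : injective z.

Lemma dist_gt0 n k : k != n -> 0 < normc (z k - z n).
Proof. by move=> kn; rewrite normc_gt0 subr_eq0; apply: contra kn => /eqP/zinj/eqP. Qed.

(** For [t >= 0] the disc contains its centre [z n], which accounts for the subtracted [1]. *)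
Lemma punctured_count_le n t m :
  ((\sum_(0 <= k < m | (k != n) && (normc (z k - z n) <= t)) 1)%:E <= maxe (disc_count z (z n) t - 1) 0 :> \bar R)%E
  \/ t < 0.
Proof.
have [t0|t0] := leP 0 t; [left|by right].
suff H M : (disc_count z (z n) t <= M%:E)%E ->
    \sum_(0 <= k < m | (k != n) && (normc (z k - z n) <= t)) 1 <= M - 1.
  case E : (disc_count z (z n) t) => [M||]; last 2 first.
  - by rewrite addye//= le_max leey.
  - by rewrite le_max lee_fin orbC (le_trans (H 1 _)) ?subrr// E leNye.
  by rewrite -EFinB le_max lee_fin H// E.
(* The range is enlarged so that the index [n] itself occurs in it. *)
move=> /(@disc_count_le _ _ _ _ _ (maxn m n.+1)) h.
have nm : (n < maxn m n.+1)%N by rewrite leq_max leqnn orbT.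
rewrite lerBrDl (le_trans _ h)// (bigD1 (Ordinal nm))/= ?subrr ?normc0// lerD2l.
apply: (@le_trans _ _ (\sum_(0 <= k < maxn m n.+1 | (k != n) && (normc (z k - z n) <= t)) 1)).
  by rewrite [leRHS](@big_cat_nat _ _ _ m) ?leq_maxl//= lerDl sumr_ge0.
rewrite big_mkord le_eqVlt; apply/orP; left; apply/eqP.
by apply: eq_bigl => k; rewrite andbC.
Qed.

Lemma sum_ln_le_disc_N n r m (M : R) : (disc_N z (z n) r <= M%:E)%E ->
  \sum_(0 <= k < m | (k != n) && (normc (z k - z n) <= r)) ln (r / normc (z k - z n)) <= M.
Proof.
move=> hM; rewrite -lee_fin (le_trans _ hM)// /disc_N.
pose P k := (k != n) && (normc (z k - z n) <= r).
have := @sum_ln_le_integral R [seq normc (z k - z n) | k <- index_iota 0 m & P k] r.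
rewrite big_map big_filter; apply.
  by move=> d /mapP[k]; rewrite mem_filter => /andP[/andP[kn kr] _] ->; rewrite dist_gt0.
move=> t /andP[t0 tr]; rewrite big_map big_filter_cond /=.
have [h|] := punctured_count_le n t m; last by rewrite ltNge ltW.
apply: (@le_trans _ _ ((\sum_(0 <= k < m | (k != n) && (normc (z k - z n) <= t)) 1)%:E * (t^-1)%:E)%E); last first.
  by apply: lee_wpmul2r => //; rewrite lee_fin invr_ge0 ltW.
rewrite -EFinM lee_fin mulr_suml big_mkcond [leRHS]big_mkcond; apply: ler_sum => k _.
rewrite /P mul1r; case: ifP => [/andP[/andP[-> _] ->]|_] //.
by case: ifP => // _; rewrite invr_ge0 ltW.
Qed.

End NearbyPoints.

Section ConditionA.
Variables (R : realType) (z : nat -> R[i]) (L : R -> R) (s : nat).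
Local Notation C := R[i].
Local Notation W := unit_kernel.
Hypothesis z1 : forall n, normc (z n) < 1.
Hypothesis zinj : injective z.
Hypothesis gL : gauge L.
Hypothesis wsum : kernel_sum_bound z L s.

(** The contribution of [z k] to [N] at the centre [z n] with radius [(1 - |z n|) / 2]. *)
Definition nearness n k : R := let r := (1 - normc (z n)) / 2 in let d := normc (z k - z n) in
  if d <= r then ln (r / d) else 0.

Lemma expR_sub1_le (u : R) : 0 <= u -> u <= 2^-1 -> expR (- (2 * u)) <= 1 - u.
Proof.
move=> u0 u2; rewrite expRN -[leLHS]mul1r ler_pdivrMr ?expR_gt0//.
have := expR_ge1Dx (2 * u); have : 0 <= 1 - u by lra.
by move: (expR _) => e; nra.
Qed.

Lemma denom_le_dist (a x : C) : normc x < 1 -> normc (1 - a^*%C * x) <= 2 * (1 - normc x) + normc (a - x).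
Proof.
move=> x1; have -> : 1 - a^*%C * x = ((1 - normc x ^+ 2)%:C)%C - (a - x)^*%C * x.
  by rewrite -kernel_num kernel_num_conj rmorphB/=; ring.
have x0 := normc_ge0 x.
rewrite (le_trans (le_normcB _ _))// lerD// ?normc_real.
  by rewrite ger0_norm; nra.
by rewrite normcM normc_conj ler_piMr ?normc_ge0// ltW.
Qed.

(* A factor with a small kernel is close to [1]; there are few other factors, and for
   these the distance to the zero is what can be small. *)
Lemma factor_low : exists2 A : R, 0 <= A & forall n k, k != n ->
  expR (- (A * normc (W (z k) (z n)) ^+ s.+1 + nearness n k)) <= normc (zfactor s (z k) (z n)).
Proof.
have [c0 c00 hc0] := fcoef_low z1 wsum.
pose c := factor_cst R s; have c1 : 0 <= c by exact: factor_cst_ge0.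
(* A fixed loss [K] is tolerable for a factor with [c v > 1/2]: it is charged to the kernel, because
   [2 c v >= 1]. *)
pose K := Num.max 0 (log_polyR s 2 - ln (c0 / 5)).
have K0 : 0 <= K by rewrite le_max lexx.
exists (2 * c * (1 + K)) => [|n k kn]; first by rewrite !mulr_ge0// addr_ge0.
set v := normc (W _ _) ^+ s.+1; have v0 : 0 <= v by rewrite exprn_ge0// normc_ge0.
have d0 := dist_gt0 zinj kn; set d := normc (z k - z n) in d0.
pose r := (1 - normc (z n)) / 2; have r0 : 0 < r by rewrite divr_gt0// subr_gt0.
have l0 : 0 <= nearness n k.
  by rewrite /nearness; case: ifP => // dr; rewrite ln_ge0// ler_pdivlMr// mul1r.
have [cv|cv] := leP (c * v) 2^-1.
  have E1 := factor_sub1_le s z1 k (z1 n); rewrite -/c -/v in E1.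
  have E2 : 1 - c * v <= normc (zfactor s (z k) (z n)).
    have := le_normc_sub 1 (1 - zfactor s (z k) (z n)).
    by rewrite normc1 (normcB 1 (zfactor s (z k) (z n))) subKr; lra.
  apply: le_trans E2; apply: le_trans (expR_sub1_le (mulr_ge0 c1 v0) cv).
  by rewrite ler_expR; have := mulr_ge0 (mulr_ge0 c1 v0) K0; lra.
rewrite factor_lin// [normc (_ * cexp _)]normcM [normc (_ / _)]normcM [normc (_ * (_ - _))]normcM.
rewrite normcV (normcB (z n)) -/d.
have den0 : 0 < normc (1 - (z k)^*%C * z n) by rewrite normc_gt0 denom_neq0.
(* The denominator is at most [2 (1 - |z n|) + d = 4 r + d], that is at most five times the larger
   of [r] and [d]. *)
have E1 : expR (- nearness n k) / 5 <= d / normc (1 - (z k)^*%C * z n).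
  have dl := denom_le_dist (z k) (z1 n); rewrite -/d in dl.
  rewrite ler_pdivlMr// /nearness /= -/d -/r; case: (leP d r) => dr.
    have -> : expR (- ln (r / d)) = d / r by rewrite expRN lnK ?invf_div// posrE divr_gt0.
    have h : normc (1 - (z k)^*%C * z n) <= 5 * r by move: dl dr; rewrite /r; lra.
    apply: le_trans (ler_wpM2l _ h) _; first exact: divr_ge0 (divr_ge0 (ltW d0) (ltW r0)) _.
    by rewrite le_eqVlt; apply/orP; left; apply/eqP; field; rewrite gt_eqF.
  by rewrite oppr0 expR0; move: dr dl; rewrite /r; lra.
have E2 : expR (- log_polyR s 2) <= normc (cexp (log_poly s (W (z k) (z n)))).
  apply: le_trans (ge_normc_cexp _); rewrite ler_expR lerN2; apply: le_log_poly.
  exact: kernel_le2.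
have E3 : expR (- K) <= (c0 / 5) * expR (- log_polyR s 2).
  have -> : c0 / 5 = expR (ln (c0 / 5)) by rewrite lnK// posrE divr_gt0.
  have : log_polyR s 2 - ln (c0 / 5) <= K by rewrite le_max lexx orbT.
  by rewrite -expRD ler_expR; lra.
apply: (@le_trans _ _ (expR (- K) * expR (- nearness n k))).
  rewrite -expRD ler_expR; have : 1 <= 2 * (c * v) by lra.
  by have := mulr_ge0 c1 v0; have := mulr_ge0 K0 l0; nra.
apply: (@le_trans _ _ (c0 * (expR (- nearness n k) / 5) * expR (- log_polyR s 2))).
  apply: le_trans (ler_wpM2r (expR_ge0 _) E3) _.
  by rewrite le_eqVlt; apply/orP; left; apply/eqP; ring.
rewrite -[normc (fcoef _) * _ * _]mulrA.
have e5 : 0 <= expR (- nearness n k) / 5 by rewrite divr_ge0 ?expR_ge0.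
apply: (ler_pM _ (expR_ge0 _) _ E2); first by rewrite (mulr_ge0 (ltW c00) e5).
exact: (ler_pM (ltW c00) e5 (hc0 k) E1).
Qed.

Lemma product_low_of_disc_N (B : R) : 0 <= B ->
  (forall n, disc_N z (z n) ((1 - normc (z n)) / 2) <= (B * L (normc (z n)))%:E)%E ->
  product_low z L s.
Proof.
move=> B0 hB; have [A A0 hA] := factor_low; case: wsum => K K0 hK.
exists (A * K + B) => [|n]; first by rewrite addr_ge0// mulr_ge0.
exists 0 => m _.
apply: (@le_trans _ _ (\prod_(k < m | k != n :> nat)
    expR (- (A * normc (W (z k) (z n)) ^+ s.+1 + nearness n k)))); last first.
  by apply: ler_prod => k kn; rewrite expR_ge0 hA.
rewrite -expR_sum ler_expR sumrN lerN2 big_split/= mulrDl; apply: lerD.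
  rewrite -mulr_sumr -mulrA ler_wpM2l//; apply: le_trans (hK m _ (z1 n)).
  rewrite big_mkcond; apply: ler_sum => k _.
  by case: ifP => // _; rewrite exprn_ge0// normc_ge0.
apply: le_trans (sum_ln_le_disc_N zinj m (hB n)).
rewrite big_mkord big_mkcondr/= le_eqVlt; apply/orP; left; apply/eqP.
by apply: eq_bigr => k _.
Qed.

End ConditionA.

Section CanonicalProduct.
Variables (R : realType) (z : nat -> R[i]) (s : nat).
Local Notation C := R[i].

Lemma tends_lim (u : nat -> C) l : tends u l -> lim ((fun m => u m : C^o) @ \oo) = l.
Proof.
move=> ul; apply: cvg_lim; first exact: norm_hausdorff.
apply/cvgrPdist_le => e e0.
have [r eE] : exists r : R, e = (r%:C)%C.
  by case: e e0 => a b; rewrite ltcE /= => /andP[/eqP -> _]; exists a.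
have /ul[N hN] : 0 < r by move: e0; rewrite eE ltcR.
by exists N => // m /= Nm; rewrite -[X in X <= _]normcE' eE lecR normcB hN.
Qed.

(** For [a <= 0] the logarithm is [-oo] and the hypothesis fails, so the conclusion includes
    positivity of [a]. *)
Lemma ge_lne (a M : R) : (- lne a%:E <= M%:E)%E -> expR (- M) <= a.
Proof.
have [a0|a0] := leP a 0; first by rewrite le0_lneNy.
by rewrite lne_EFin// lee_fin lerNl -{2}(lnK a0) ler_expR.
Qed.

(** The kernel of the origin is constantly [1], a zero of [E]. The whole product then vanishes,
    which is how conditions (b) and (c) exclude a point at the origin. *)
Lemma canonical_factor0 k x : z k = 0 -> canonical_factor z s k x = 0.
Proof. by move=> zk; rewrite /canonical_factor /primary_factor zk -/(unit_kernel 0 x) kernel0 subrr mul0r. Qed.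

Lemma canonical_product0 k x : z k = 0 -> canonical_product z s x = 0.
Proof.
move=> zk; apply: tends_lim; apply: tends_near (tends_cst 0).
by exists k.+1 => // m /= km; rewrite (bigD1 (Ordinal km))//= canonical_factor0// mul0r.
Qed.

Lemma canonical_product_except0 k n x : z k = 0 -> k != n -> canonical_product_except z s n x = 0.
Proof.
move=> zk kn; apply: tends_lim; apply: tends_near (tends_cst 0).
by exists k.+1 => // m /= km; rewrite (bigD1 (Ordinal km))//= canonical_factor0// mul0r.
Qed.

Lemma canonical_factorE k x : z k != 0 -> canonical_factor z s k x = zfactor s (z k) x.
Proof. by move=> zk; rewrite factorE. Qed.

Variable L : R -> R.
Hypothesis z1 : forall n, normc (z n) < 1.
Hypothesis gL : gauge L.
Hypothesis wsum : kernel_sum_bound z L s.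

Lemma canonical_derivative : exists P P1 : C -> C, forall x, normc x < 1 ->
  [/\ tends (pprod z s ^~ x) (P x), cder P x (P1 x) & tends (dpprod z s ^~ x) (P1 x)].
Proof.
have [P aP uP] := canonical_limit z1 gL wsum; have [P1 aP1 dP] := anal_cder aP.
have uP1 : utends (dpprod z s) P1.
  by apply: utends_cder dP uP => // [m|m x]; [exact: anal_pprod|exact: cder_pprod].
by exists P, P1 => x x1; split; [exact: utends_tends|exact: dP|exact: utends_tends].
Qed.

Lemma dfactor_diag_neq0 n : dfactor s (z n) (z n) != 0.
Proof.
rewrite -normc_gt0 normc_dfactor_diag// mulr_gt0 ?expR_gt0// divr_gt0 ?sqr_normc_lt1// normc_gt0.
by rewrite /fcoef; case: (eqVneq (z n) 0) => [_|zn]; [exact: oner_neq0|rewrite oppr_eq0 conjc_eq0].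
Qed.

Lemma dfactor_diag_le n : (1 - normc (z n)) * normc (dfactor s (z n) (z n)) <= expR (log_polyR s 1).
Proof.
have n0 := normc_ge0 (z n); have n1 := z1 n.
have f1 : normc (fcoef (z n)) <= 1.
  by rewrite /fcoef; case: ifP => _; rewrite ?normc1// normcN normc_conj ltW.
have q : 0 < 1 - normc (z n) ^+ 2 by exact: sqr_normc_lt1.
rewrite normc_dfactor_diag// mulrA ler_piMl ?expR_ge0// mulrA ler_pdivrMr// mul1r.
by have := normc_ge0 (fcoef (z n)); nra.
Qed.

Lemma punctured_product_limit P1 n : tends (dpprod z s ^~ (z n)) P1 ->
  tends (fun m => \prod_(k < m | k != n :> nat) zfactor s (z k) (z n)) (P1 / dfactor s (z n) (z n)).
Proof.
move=> h; have d0 := dfactor_diag_neq0 n.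
apply: tends_near (tendsM h (tends_cst (dfactor s (z n) (z n))^-1)).
by exists n.+1 => // m /= nm; rewrite pprod_diag// mulrAC divff// mul1r.
Qed.

(** Raising the constant from [B] to [B + 1] leaves a strict gap below the limit, which the partial
    products eventually respect. *)
Lemma product_low_of_limit (B : R) : 0 <= B ->
  (forall n, exists2 l, tends (fun m => \prod_(k < m | k != n :> nat) zfactor s (z k) (z n)) l &
     expR (- (B * L (normc (z n)))) <= normc l) -> product_low z L s.
Proof.
move=> B0 h; exists (B + 1) => [|n]; first by rewrite addr_ge0.
have [l hl Bl] := h n.
have L1 : 1 <= L (normc (z n)) by exact: (gauge_ge1 gL (z1 n)).
pose e := normc l - expR (- ((B + 1) * L (normc (z n)))).
have e0 : 0 < e by rewrite subr_gt0 (lt_le_trans _ Bl)// ltr_expR ltrN2 mulrDl ltrDl mul1r (lt_le_trans ltr01).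
have [N hN] := hl _ e0; exists N => m Nm; rewrite -normc_prod.
have := hN m Nm; rewrite normcB => /(le_trans (le_normc_sub _ _)).
by rewrite /e; lra.
Qed.

Variable B : R.
Hypothesis B0 : 0 <= B.

Lemma product_low_of_derivative :
  (forall n, - lne ((1 - normc (z n)) * normc (derive1 (canonical_product z s) (z n)))%:E
     <= (B * L (normc (z n)))%:E)%E -> product_low z L s.
Proof.
move=> h.
have nz k : z k != 0.
  apply/eqP => zk; have := ge_lne (h k).
  have -> : canonical_product z s = cst 0 by apply/funext => x; exact: canonical_product0 zk.
  by rewrite derive1_cst normc0 mulr0 leNgt expR_gt0.
have [P [P1 hP]] := canonical_derivative.
have dE n : derive1 (canonical_product z s) (z n) = P1 (z n).
  have [_ dP _] := hP _ (z1 n); apply: (cder_derivable _).2.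
  apply: (@cder_near _ P _ _ _ (1 - normc (z n))) dP; first by rewrite subr_gt0.
  move=> k kz; have x1 : normc (z n + k) < 1 by rewrite (le_lt_trans (le_normcD _ _))//; lra.
  have [hx _ _] := hP _ x1; apply: tends_lim; apply: tends_near hx; exists 0%N => // m _.
  by apply: eq_bigr => j _; rewrite canonical_factorE.
(* [P1 (z n)] is the punctured product times [dfactor], and [1 - |z n|] times the modulus of the
   latter is at most [exp (log_polyR s 1)]. *)
apply: (@product_low_of_limit (B + log_polyR s 1)) => [|n]; first by rewrite addr_ge0 ?log_polyR_ge0.
have [_ _ /punctured_product_limit hl] := hP _ (z1 n); eexists; first exact: hl.
have := ge_lne (h n); rewrite dE => hn.
have dp : 0 < normc (dfactor s (z n) (z n)) by rewrite normc_gt0 dfactor_diag_neq0.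
rewrite normcM normcV ler_pdivlMr//.
have d0 : 0 < 1 - normc (z n) by rewrite subr_gt0.
rewrite -(ler_pM2l d0); apply: le_trans hn.
rewrite mulrCA; apply: le_trans (ler_wpM2l (expR_ge0 _) (dfactor_diag_le n)) _.
rewrite -expRD ler_expR; have : 1 <= L (normc (z n)) by exact: (gauge_ge1 gL (z1 n)).
by have := log_polyR_ge0 s (@ler01 R); nra.
Qed.

Lemma product_low_of_except :
  (forall n, - lne (normc (canonical_product_except z s n (z n)))%:E
     <= (B * L (normc (z n)))%:E)%E -> product_low z L s.
Proof.
move=> h.
have nz k : z k != 0.
  (* Any index other than [k] would do: the product that omits it still contains the vanishing
     factor. *)
  apply/eqP => zk; have := ge_lne (h k.+1).
  by rewrite (@canonical_product_except0 k) ?ltn_eqF// normc0 leNgt expR_gt0.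
have [P [P1 hP]] := canonical_derivative.
apply: (product_low_of_limit B0) => n; have [_ _ /punctured_product_limit hl] := hP _ (z1 n).
eexists; first exact: hl.
have := ge_lne (h n); rewrite /canonical_product_except (tends_lim (l := P1 (z n) / dfactor s (z n) (z n)))//.
by apply: tends_near hl; exists 0%N => // m _; apply: eq_bigr => j _; rewrite canonical_factorE.
Qed.

End CanonicalProduct.

(** * Proof of the theorem *)

Section Growth.
Variables (R : realType) (psi : R -> R).
Local Notation C := R[i].
Hypothesis psi_ge0 : forall x, 1 <= x -> 0 <= psi x.
Hypothesis psi_nd : forall x y, 1 <= x -> x <= y -> psi x <= psi y.

Lemma lne_le (x : \bar R) (M : R) : (x <= (expR M)%:E)%E -> (lne x <= M%:E)%E.
Proof.
case: x => [r||]//; rewrite ?leNye// lee_fin => rM.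
have [r0|r0] := leP r 0; first by rewrite le0_lneNy// leNye.
by rewrite lne_EFin// lee_fin -ler_expR lnK.
Qed.

Lemma max_modulus_growth (a : C -> C) (rho : R) : tamef (psi_gauge psi) a -> 0 < rho < 1 ->
  (forall x, normc x <= rho -> normc (a x) <= 1) -> 0 < psit psi (1 / (1 - rho)) ->
  exists2 B : R, 0 < B & forall r : R, 0 < r < 1 ->
    (lne (max_modulus r a) <= B%:E * psi_tilde psi (1 / (1 - r)))%E.
Proof.
move=> [K K0 hK] /andP[rho0 rho1] ha; set p := psit psi _ => p0.
have kp : 0 <= K * (1 + p^-1) by rewrite mulr_ge0// addr_ge0// invr_ge0 ltW.
(* For [r > rho] one has [psit >= p], hence [1 + psit <= (1 + p^-1) psit]; the final [1] only makes
   the constant positive. *)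
exists (K * (1 + p^-1) + 1) => [|r /andP[r0 r1]]; first by lra.
have x1 : 1 <= 1 / (1 - r) by rewrite inv1_ge1// ltW.
rewrite psi_tilde_fin// -EFinM; apply: lne_le; apply: ge_ereal_sup => _ [x /= xr <-].
have t0 := psit_ge0 psi_ge0 psi_nd x1.
rewrite lee_fin; have [rr|rr] := leP r rho.
  by rewrite (le_trans (ha _ _)) ?xr// -[leLHS]expR0 ler_expR mulr_ge0// addr_ge0.
apply: le_trans (hK x _) _; first by rewrite xr.
rewrite xr ler_expR /psi_gauge.
have pt : p <= psit psi (1 / (1 - r)).
  rewrite psit_le ?inv1_ge1 ?(ltW rho0)// !div1r lef_pV2 ?posrE ?subr_gt0// lerD2l lerN2 ltW//.
have h : 1 <= p^-1 * psit psi (1 / (1 - r)) by rewrite mulrC ler_pdivlMr// [1 * p]mul1r.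
have := ler_wpM2l K0 h; lra.
Qed.

End Growth.

Section ZeroFreeDisc.
Variables (R : realType) (z : nat -> R[i]) (psi : R -> R) (D : R).
Local Notation C := R[i].
Local Notation W := unit_kernel.
Hypothesis z1 : forall n, normc (z n) < 1.
Hypothesis psi_ge0 : forall x, 1 <= x -> 0 <= psi x.
Hypothesis psi_nd : forall x y, 1 <= x -> x <= y -> psi x <= psi y.
Hypothesis density : forall w : C, unit_disc w ->
  (disc_count z w ((1 - normc w) / 2) <= (D * psi (1 / (1 - normc w)))%:E)%E.

(** Where [psi] vanishes, the density condition empties the discs of radius [(1 - |w|) / 2] about
    all [w] with [|w| <= 1 - 1 / x]. A point of modulus at most [1 - 1 / (2 x)] lies in the one
    about its radial retraction to [|w| <= 1 - 1 / x]. *)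
Lemma zero_free_disc (x : R) n : 1 <= x -> psi x = 0 -> 1 - (2 * x)^-1 < normc (z n).
Proof.
move=> x1 px; have x0 : 0 < x by rewrite (lt_le_trans ltr01).
have n0 := normc_ge0 (z n); rewrite ltNge; apply/negP => zn.
pose t := 1 - x^-1; have t1 : t < 1 by rewrite gtrBl invr_gt0.
have t0 : 0 <= t by rewrite subr_ge0 invf_le1.
have znt : normc (z n) <= (1 + t) / 2 by move: zn; rewrite invfM /t; lra.
pose w : C := if normc (z n) <= t then z n else ((t / normc (z n))%:C)%C * z n.
have [wt wz] : normc w <= t /\ normc (z n - w) <= (1 - normc w) / 2.
  rewrite /w; case: (leP (normc (z n)) t) => h; first by rewrite subrr normc0 divr_ge0// subr_ge0 ltW.
  have zn0 : 0 < normc (z n) by rewrite (le_lt_trans t0).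
  have wE : normc (((t / normc (z n))%:C)%C * z n) = t.
    by rewrite normcM normc_real ger0_norm ?divr_ge0// divfK// gt_eqF.
  rewrite wE; split => //; rewrite -{1}(mul1r (z n)) -mulrBl normcM.
  rewrite (_ : 1 - _ = ((1 - t / normc (z n))%:C)%C); last by rewrite rmorphB rmorph1.
  rewrite normc_real ger0_norm; last by rewrite subr_ge0 ler_pdivrMr// mul1r ltW.
  by rewrite mulrBl mul1r divfK ?gt_eqF//; lra.
have w1 : normc w < 1 by exact: le_lt_trans t1.
have yx : 1 / (1 - normc w) <= x.
  rewrite ler_pdivrMr ?subr_gt0// -ler_pdivrMl// mulr1.
  by move: wt; rewrite /t; lra.
have y1 : 1 <= 1 / (1 - normc w) by rewrite inv1_ge1// normc_ge0.
have py : psi (1 / (1 - normc w)) = 0.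
  by apply/eqP; rewrite eq_le psi_ge0// -px psi_nd.
have := density w1; rewrite py mulr0 => /(@disc_count_le _ _ _ _ _ n.+1).
rewrite (bigD1 ord_max)//= => H; have : 0 <= \sum_(i < n.+1 | (normc (z i - w) <= (1 - normc w) / 2) && (i != ord_max)) (1 : R).
  exact: sumr_ge0.
lra.
Qed.

(** On [|x| <= p] the largest kernel of a point of modulus [u] is [(1 - u^2) / (1 - u p)], which
    decreases for [u >= p]. All zeros beyond modulus [v] are thus controlled by [v] itself. *)
Lemma kernel_decr (u v p : R) : 0 <= p -> p <= v -> v <= u -> u < 1 ->
  (1 - u ^+ 2) / (1 - u * p) <= (1 - v ^+ 2) / (1 - v * p).
Proof.
move=> p0 pv vu u1; have v0 : 0 <= v by exact: le_trans pv.
have q w : w <= u -> 0 <= w -> 0 < 1 - w * p by move=> wu w0; nra.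
rewrite ler_pdivrMr ?q// ?(le_trans v0)// mulrAC ler_pdivlMr ?q//.
rewrite -subr_ge0.
have -> : (1 - v ^+ 2) * (1 - u * p) - (1 - u ^+ 2) * (1 - v * p) =
  (u - v) * ((v - p) + u * (1 - v * p)) by ring.
rewrite mulr_ge0 ?subr_ge0// addr_ge0 ?subr_ge0//.
exact: mulr_ge0 (le_trans v0 vu) (ltW (q v vu v0)).
Qed.

Lemma kernel_small (rho v : R) : 0 < rho -> rho < v -> v < 1 -> (forall n, v < normc (z n)) ->
  exists2 theta, 0 < theta < 1 & forall n x, normc x <= rho -> normc (W (z n) x) <= theta.
Proof.
move=> rho0 rv v1 hz; exists ((1 - v ^+ 2) / (1 - v * rho)).
  have h1 : 0 < 1 - v * rho by nra.
  by rewrite divr_gt0 ?ltr_pdivrMr//=; nra.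
move=> n x xr; have v0 := lt_trans rho0 rv.
apply: le_trans (kernel_decr (ltW rho0) (ltW rv) (ltW (hz n)) (z1 n)).
rewrite normc_kernel//; have zr : normc (z n) * rho < 1.
  by have := normc_ge0 (z n); have := z1 n; nra.
rewrite ler_pM2l ?sqr_normc_lt1// lef_pV2 ?posrE ?normc_gt0 ?denom_neq0 ?subr_gt0//; last first.
  by rewrite (le_lt_trans xr)// (lt_trans rv).
apply: le_trans (le_normc_sub _ _); rewrite normc1 normcM normc_conj lerD2l lerN2.
by rewrite ler_wpM2l// normc_ge0.
Qed.

End ZeroFreeDisc.

Theorem theorem2 (R : realType) (z : nat -> R[i]) (psi : R -> R) (s : nat)
  (z_disc : forall n, unit_disc (z n))
  (z_distinct : injective z)
  (psi_ge0 : forall x, 1 <= x -> 0 <= psi x)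
  (psi_nondecreasing : forall x y, 1 <= x -> x <= y -> psi x <= psi y)
  (psi_unbounded : forall M, exists2 x, 1 <= x & M < psi x)
  (psi_doubling : exists2 K : R, 0 < K &
     \forall x \near +oo%R, psi (2 * x) <= K * psi x)
  (s_ge : Num.floor (polya_order psi) + 1 <= s%:Z)
  (z_density : exists2 C : R, 0 < C & forall w : R[i], unit_disc w ->
     (disc_count z w ((1 - normc w) / 2)
        <= (C * psi (1 / (1 - normc w)))%:E)%E)
  (z_cond :
     [\/ exists2 C : R, 0 < C & forall n,
           (disc_N z (z n) ((1 - normc (z n)) / 2)
              <= C%:E * psi_tilde psi (1 / (1 - normc (z n))))%E,
         exists2 C : R, 0 < C & forall n,
           (- lne (((1 - normc (z n))
                     * normc (derive1 (canonical_product z s) (z n)))%:E)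
              <= C%:E * psi_tilde psi (1 / (1 - normc (z n))))%E
       | exists2 C : R, 0 < C & forall n,
           (- lne ((normc (canonical_product_except z s n (z n)))%:E)
              <= C%:E * psi_tilde psi (1 / (1 - normc (z n))))%E]) :
  exists a : R[i]^o -> R[i]^o,
    [/\ analytic_in_disc a,
        exists2 C : R, 0 < C & forall r : R, 0 < r < 1 ->
          (lne (max_modulus r a) <= C%:E * psi_tilde psi (1 / (1 - r)))%E
      & exists f : R[i]^o -> R[i]^o,
          [/\ analytic_in_disc f,
              forall w, unit_disc w -> derive1n 2 f w + a w * f w = 0
            & forall w, unit_disc w -> (f w = 0 <-> exists k, w = z k)]].
Proof.
case: z_density => D D0 density.
have wsum := kernel_sum_psi z_disc psi_ge0 psi_nondecreasing psi_unbounded psi_doubling s_ge D0 density.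
have gL := gauge_psi psi_ge0 psi_nondecreasing psi_unbounded psi_doubling.
have bound (u : nat -> \bar R) : (exists2 B : R, 0 < B & forall n,
      (u n <= B%:E * psi_tilde psi (1 / (1 - normc (z n))))%E) ->
    exists2 B : R, 0 <= B & forall n, (u n <= (B * psi_gauge psi (normc (z n)))%:E)%E.
  move=> [B B0 h]; exists B => [|n]; first exact: ltW.
  apply: le_trans (h n) _; rewrite psi_tilde_fin ?inv1_ge1 ?normc_ge0 ?z_disc//.
  by rewrite -EFinM lee_fin ler_wpM2l ?(ltW B0)// /psi_gauge lerDr.
have low : product_low z (psi_gauge psi) s.
  case: z_cond => /bound[B B0 h].
  - exact: (product_low_of_disc_N z_disc z_distinct wsum B0 h).
  - exact: (product_low_of_derivative z_disc gL wsum B0 h).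
  - exact: (product_low_of_except z_disc gL wsum B0 h).
suff [a [f [[da df ode zeros] ta [rho rho01 [ha prho]]]]] : exists a f : R[i] -> R[i],
    [/\ solves z a f, tamef (psi_gauge psi) a & exists2 rho, 0 < rho < 1 &
      (forall x, normc x <= rho -> normc (a x) <= 1) /\ 0 < psit psi (1 / (1 - rho))].
  exists a; split => //; last by exists f.
  exact: (max_modulus_growth psi_ge0 psi_nondecreasing ta rho01 ha prho).
have [p1|p1] := ltP 0 (psi 1).
  have [a [f [sol ta [rho rho01 ha]]]] := solve_at0 z_disc z_distinct gL wsum low.
  exists a, f; split => //; exists rho => //; split => //.
  case/andP: rho01 => rho0 rho1; apply: (psit_gt0 _ _ (lexx 1)) => //.
  by rewrite ltr_pdivlMr ?subr_gt0// mul1r gtrBl.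
(* With [psi 1 = 0], the least power of [3/2] at which [psi] is positive comes one step after an [x]
   with [psi x = 0]. The ratio must be below [2]: the zeros stay beyond [1 - 1 / (2 x)], while
   [psit] is positive past [(3/2) x]. *)
have [n0 hn0] : exists n, 0 < psi ((3 / 2) ^+ n).
  have [x x1 px] := psi_unbounded 0; have [n [_ hn]] := dyadic x1.
  exists (n.+1 * 2)%N; apply: lt_le_trans px _; apply: psi_nondecreasing => //.
  rewrite (le_trans (ltW hn))// mulnC exprM lerXn2r ?nnegrE ?exprn_ge0//; lra.
have exn : exists n, 0 < psi ((3 / 2) ^+ n) by exists n0.
case: (ex_minnP exn) => [[|n]]; first by rewrite expr0 ltNge p1.
move=> pn /(_ n) min; pose x := (3 / 2 : R) ^+ n.
have x1 : 1 <= x by rewrite exprn_ege1//; lra.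
have x0 : 0 < x by rewrite (lt_le_trans ltr01).
have px : psi x = 0.
  by apply/eqP; rewrite eq_le psi_ge0// andbT leNgt; apply/negP => /min; rewrite ltnn.
have zfree k := zero_free_disc z_disc psi_ge0 psi_nondecreasing density k x1 px.
pose y := x^-1; have y0 : 0 < y by rewrite invr_gt0.
have y1 : y <= 1 by rewrite invf_le1.
(* Here [1 / (1 - rho) = (7/4) x] lies between [(3/2) x] and [2 x], and [rho'] is the midpoint of
   [rho] and [1 - y / 2], since [15/28] is halfway between [16/28] and [14/28]. *)
pose rho := 1 - 4 / 7 * y.
pose rho' := 1 - 15 / 28 * y.
have zfree' k : 1 - 2^-1 * y < normc (z k) by have := zfree k; rewrite invfM.
have [theta th hW] : exists2 theta, 0 < theta < 1 &
    forall n x, normc x <= rho' -> normc (unit_kernel (z n) x) <= theta.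
  by apply: (kernel_small z_disc _ _ _ zfree'); rewrite /rho'; lra.
have r1 : rho < rho' by rewrite /rho /rho'; lra.
have r2 : rho' < 1 by rewrite /rho'; lra.
have [a [f [sol ta ha]]] := solve_small z_disc z_distinct gL wsum low th r1 r2 hW.
exists a, f; split => //; exists rho; first by rewrite /rho; lra.
split => //; have -> : 1 / (1 - rho) = 7 / 4 * x.
  by rewrite /rho /y; field; rewrite gt_eqF//= subKr pnatr_eq0.
apply: (@psit_gt0 _ _ _ _ ((3 / 2) ^+ n.+1)) => //.
  by rewrite exprn_ege1//; lra.
by rewrite exprS -/x; lra.
Qed.
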